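(* Let $O$ be a (non-symmetric) topological cyclic operad with multiplication, and let $O^*$ be its associated cosimplicial space. Then the totalization $\mathrm{Tot}(O^* )$ is an algebra over the symmetric topological operad $fMS$; that is, there are structure maps $\theta_m : fMS(m) \times \mathrm{Tot}(O^* )^m \to \mathrm{Tot}(O^* )$, $m \ge 0$, defining a morphism of symmetric operads $fMS \to \mathrm{End}(\mathrm{Tot}(O^* ))$.
   Context: A non-symmetric topological operad $O$ is a sequence of spaces $O(k)$, $k\in\mathbb{N}$, with maps $\circ_t: O(k)\times O(l)\to O(k+l-1)$, $1\le t\le k$, satisfying $(a\circ_i b)\circ_{j+p-1}c=(a\circ_j c)\circ_i b$ for $a\in O(n)$, $b\in O(p)$, $c\in O(q)$, $1\le i<j\le n$, and $a\circ_i(b\circ_j c)=(a\circ_i b)\circ_{i+j-1}c$, together with a two-sided unit $\iota\in O(1)$. An operad with multiplication is such an operad with points $m\in O(2)$, $u\in O(0)$ with $m\circ_1 m=m\circ_2 m$ and $m\circ_1 u=m\circ_2 u=\iota$ (equivalently an operad map from the associative operad $Ass$, which has $Ass(n)=$ point for all $n$). A cyclic operad is an operad with an action of $\mathbb{Z}_{n+1}$ on each $O(n)$, generator $t_n$, such that for $f\in O(m)$, $g\in O(n)$: $t_{m+n-1}(f\circ_1 g)=t_n(g)\circ_n t_m(f)$, $t_{m+n-1}(f\circ_i g)=t_m(f)\circ_{i-1}g$ for $1<i\le m$, and $t_1(\iota)=\iota$. A cyclic operad with multiplication is a cyclic operad $O$ with a morphism of cyclic operads $Ass\to O$ ($Ass$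 with trivial cyclic actions); equivalently an operad with multiplication which is cyclic and satisfies $t_2(m)=m$. The cosimplicial space $O^*$ has $O^k=O(k)$, cofaces $d^i(x)=x\circ_i m$ ($1\le i\le k$), $d^0(x)=m\circ_2 x$, $d^{k+1}(x)=m\circ_1 x$, codegeneracies $s^i(x)=x\circ_{i+1}u$. With $\Delta^k=\{(x_1,\dots,x_k):0\le x_1\le\dots\le x_k\le 1\}$ (cofaces $d^0$ prepends $0$, $d^{k+1}$ appends $1$, $d^i$ for $1\le i\le k$ doubles $x_i$; codegeneracy $s^i$ deletes $x_{i+1}$), $\mathrm{Tot}(S^* )$ is the space of sequences of maps $f^k:\Delta^k\to S^k$ commuting with all cofaces and codegeneracies, topologized as a subspace of $\prod_k \mathrm{Map}(\Delta^k,S^k)$. The coendomorphism operad $\mathrm{Coend}(S^1)$: $\mathrm{Coend}(S^1)(n)=\mathrm{Map}(S^1,(S^1)^n)$, with $f\circ_i g=(f_1,\dots,f_{i-1},g_1\circ f_i,\dots,g_l\circ f_i,f_{i+1},\dots,f_k)$ for $f=(f_1,\dots,f_k)$, $g=(g_1,\dots,g_l)$, and $\Sigma_n$ permuting coordinates. Identify $S^1=I/\partial I$ (circumference $1$, base point the image of $0$). $\mathcal{F}(n)$ is the space of partitions $x$ of $S^1$ into $n$ closed $1$-submanifolds $I_1(x),\dots,I_n(x)$, each of measure $1/n$, with pairwise disjoint interiors, such that there is no cyclically ordered $4$-tuple $(z_1,z_2,z_3,z_4)$ in $S^1$ with $z_1,z_3\in\mathrm{int}\,I_j(x)$, $z_2,z_4\in\mathrm{int}\,I_k(x)$,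 $j\ne k$; metric $d(x,y)=\sum_j \ell(I_j(x)\setminus I_j(y))$ ($\ell$ = measure); $\Sigma_n$ acts by relabeling. For $x\in\mathcal{F}(n)$ and $j$, let $\pi_j:S^1\to S^1$ be the based map obtained by collapsing each connected component of the closure of $S^1\setminus I_j(x)$ to a point and rescaling the resulting circle by the factor $n$; the cactus map is $c(x)=(\pi_1,\dots,\pi_n):S^1\to(S^1)^n$. $\mathrm{Mon}(I,\partial I)$ is the space of self-maps of $S^1=I/\partial I$ induced by weakly monotone maps $I\to I$ fixing $0$ and $1$. $MS(n)=\mathcal{F}(n)\times \mathrm{Mon}(I,\partial I)$ for $n>0$ and $MS(0)$ is a point. $fMS(n)=MS(n)\times(S^1)^n$, with embedding $c':fMS(n)\to\mathrm{Coend}(S^1)(n)$, $(x,f,(z_1,\dots,z_n))\mapsto (L_{z_1}\times\dots\times L_{z_n})\circ c(x)\circ f$, where $L_z$ is multiplication by $z\in S^1$ (for $n=0$, the unique map to a point). The images $c'(fMS(n))$ form a symmetric suboperad of $\mathrm{Coend}(S^1)$, and $fMS$ carries the symmetric operad structure transported along $c'$ (with $\Sigma_n$ acting by relabeling the $I_j$ and permuting the $z_j$). *)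

(* Defs.v *)
From HB Require Import structures.
From mathcomp Require Import all_boot all_order all_algebra all_fingroup.
From mathcomp Require Import all_classical all_reals all_analysis.
Import Order.TTheory GRing.Theory Num.Theory numFieldNormedType.Exports.

Unset Strict Implicit.
Unset Printing Implicit Defensive.

Local Open Scope ring_scope.
Local Open Scope classical_set_scope.

(* O k is the space of arity k; ocomp t a b = a o_t b (1 <= t <= arity a).  *)
(* Index mismatches between equal arities are handled by comparing the      *)
(* dependent pairs (existT O _ x) in the total space {k & O k}.             *)
Record cyc_op_mult (O : nat -> topologicalType) := CycOpMult {
  ocomp : forall k l : nat, nat -> O k -> O l -> O (k + l - 1)%N;
  ounit : O 1%N;
  omul  : O 2%N;
  ou    : O 0%N;
  ocyc  : forall n : nat, O n -> O n  (* t_n, generator of Z_{n+1} *)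
}.
Arguments ocomp {O} _ {k l}.
Arguments ocyc {O} _ {n}.
Arguments ounit {O} _.
Arguments omul {O} _.
Arguments ou {O} _.

Section OperadAxioms.
Context {O : nat -> topologicalType} (P : cyc_op_mult O).
Local Notation c := (ocomp P).

Definition op_comp_continuous : Prop :=
  forall k l t, (1 <= t <= k)%N ->
    continuous (fun ab : O k * O l => c t ab.1 ab.2).

Definition op_assoc_par : Prop :=
  forall n p q (a : O n) (b : O p) (x : O q) i j,
    (1 <= i)%N -> (i < j)%N -> (j <= n)%N ->
    existT O _ (c (j + p - 1)%N (c i a b) x) = existT O _ (c i (c j a x) b).

Definition op_assoc_seq : Prop :=
  forall n p q (a : O n) (b : O p) (x : O q) i j,
    (1 <= i <= n)%N -> (1 <= j <= p)%N ->
    existT O _ (c i a (c j b x)) = existT O _ (c (i + j - 1)%N (c i a b) x).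

Definition op_unit : Prop :=
  (forall n (a : O n), existT O _ (c 1%N (ounit P) a) = existT O _ a) /\
  (forall n (a : O n) i, (1 <= i <= n)%N ->
     existT O _ (c i a (ounit P)) = existT O _ a).

Definition op_mult : Prop :=
  [/\ c 1%N (omul P) (omul P) = c 2%N (omul P) (omul P),
      existT O _ (c 1%N (omul P) (ou P)) = existT O _ (ounit P) &
      existT O _ (c 2%N (omul P) (ou P)) = existT O _ (ounit P)].

Definition op_cyclic : Prop :=
  [/\ (forall n, continuous (@ocyc O P n)),
      (forall n (x : O n), iter n.+1 (@ocyc O P n) x = x),
      (forall m n (f : O m) (g : O n), (1 <= m)%N -> (1 <= n)%N ->
         existT O _ (ocyc P (c 1%N f g)) = existT O _ (c n (ocyc P g) (ocyc P f))),
      (forall m n (f : O m) (g : O n) i, (1 < i <= m)%N ->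
         existT O _ (ocyc P (c i f g)) = existT O _ (c i.-1 (ocyc P f) g)) &
      ocyc P (ounit P) = ounit P].

(* the multiplication is a morphism of cyclic operads Ass -> O *)
Definition op_cyclic_mult : Prop := ocyc P (omul P) = omul P.

Definition is_cyc_op_mult : Prop :=
  [/\ op_comp_continuous, op_assoc_par, op_assoc_seq & op_unit] /\
  [/\ op_mult, op_cyclic & op_cyclic_mult].

Definition coface_op (k i : nat) (x : O k) : {n & O n} :=
  if i == 0%N then existT O _ (c 2%N (omul P) x)
  else if i == k.+1 then existT O _ (c 1%N (omul P) x)
  else existT O _ (c i x (omul P)).

Definition codeg_op (k i : nat) (x : O k) : {n & O n} :=
  existT O _ (c i.+1 x (ou P)).

End OperadAxioms.

Section Tot.
Context {R : realType}.

Definition simplex (k : nat) : set {ptws 'I_k -> R} :=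
  [set x | (forall a b : 'I_k, (a <= b)%N -> x a <= x b) /\
           (forall a, 0 <= x a <= 1)].

Definition Delta (k : nat) : topologicalType := set_type (simplex k).

Definition getc {k} (x : {ptws 'I_k -> R}) (j : nat) : R :=
  if insub j is Some o then x o else 0.

Definition coface_nat (k i : nat) (x : nat -> R) (a : nat) : R :=
  if i == 0%N then (if a == 0%N then 0 else x a.-1)
  else if i == k.+1 then (if (a < k)%N then x a else 1)
  else (if (a < i)%N then x a else x a.-1).

Definition codeg_nat (i : nat) (x : nat -> R) (a : nat) : R :=
  if (a < i)%N then x a else x a.+1.

Context {O : nat -> topologicalType} (P : cyc_op_mult O).

Definition MapProd : topologicalType :=
  prod_topology (fun k : nat => {compact-open, Delta k -> O k}).

Definition TotSet : set MapProd :=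
  [set F | [/\ (forall k, continuous (F k : Delta k -> O k)),
     (forall k i, (i <= k.+1)%N -> forall (y : Delta k) (y' : Delta k.+1),
        (forall a, (a < k.+1)%N ->
           getc (set_val y') a = coface_nat k i (getc (set_val y)) a) ->
        existT O k.+1 (F k.+1 y') = coface_op P k i (F k y)) &
     (forall k i, (i < k)%N -> forall (y : Delta k) (y' : Delta k.-1),
        (forall a, (a < k.-1)%N ->
           getc (set_val y') a = codeg_nat i (getc (set_val y)) a) ->
        existT O k.-1 (F k.-1 y') = codeg_op P k i (F k y))]].

Definition TotT : topologicalType := set_type TotSet.

Definition Totpow (m : nat) : topologicalType := {ptws 'I_m -> TotT}.

End Tot.

(* The circle S^1 = I / dI, represented by [0,1) inside R.                  *)
Section Circle.
Context {R : realType}.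

Definition fracR (x : R) : R := x - (Num.floor x)%:~R.

Definition cdist (a b : R) : R := Num.min (fracR (a - b)) (fracR (b - a)).

Definition arc (a L : R) : set R := [set t | (0 <= t < 1) /\ fracR (t - a) <= L].

Definition closed_1sub (A : set R) : Prop :=
  exists s : seq (R * R),
    (forall p, p \in s -> (0 <= p.1 < 1) /\ (0 < p.2 <= 1)) /\
    A = [set t | exists2 p, p \in s & arc p.1 p.2 t].

Definition cint (A : set R) : set R :=
  [set t | (0 <= t < 1) /\
     exists2 e : R, 0 < e & forall s : R, `|s| < e -> A (fracR (t + s))].

Definition cyc4 (z1 z2 z3 z4 : R) : Prop :=
  [\/ z1 < z2 < z3 /\ z3 < z4, z2 < z3 < z4 /\ z4 < z1,
      z3 < z4 < z1 /\ z1 < z2 | z4 < z1 < z2 /\ z2 < z3].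

(* F(n), n > 0; components indexed 0 .. n-1 (junk normalised to set0) *)
Definition Fpart (n : nat) (I : nat -> set R) : Prop :=
  [/\ (forall j, (j < n)%N ->
         closed_1sub (I j) /\ lebesgue_measure (I j) = (n%:R^-1)%:E),
      (forall j, (n <= j)%N -> I j = set0),
      (forall t, 0 <= t < 1 -> exists2 j, (j < n)%N & I j t),
      (forall j k, (j < n)%N -> (k < n)%N -> j != k ->
         cint (I j) `&` cint (I k) = set0) &
      (forall j k, (j < n)%N -> (k < n)%N -> j != k ->
         forall z1 z2 z3 z4, cint (I j) z1 -> cint (I k) z2 ->
           cint (I j) z3 -> cint (I k) z4 -> ~ cyc4 z1 z2 z3 z4)].

(* Mon(I, dI): weakly monotone continuous maps I -> I fixing 0 and 1
   (normalised to be the identity outside [0,1]) *)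
Definition MonI (f : R -> R) : Prop :=
  [/\ f 0 = 0, f 1 = 1,
      (forall s t, 0 <= s -> s <= t -> t <= 1 -> f s <= f t),
      {within [set t | 0 <= t <= 1], continuous f} &
      (forall t, t < 0 \/ 1 < t -> f t = t)].

Record fMSraw := FMS { fI : nat -> set R; fmon : R -> R; fz : nat -> R }.

Definition fMS_valid (n : nat) (p : fMSraw) : Prop :=
  match n with
  | 0%N => p = FMS (fun _ => set0) id (fun _ => 0)
  | _ => [/\ Fpart n (fI p), MonI (fmon p),
            (forall j, (j < n)%N -> 0 <= fz p j < 1) &
            (forall j, (n <= j)%N -> fz p j = 0)]
  end.

(* fMS(n) = F(n) x Mon(I,dI) x (S^1)^n  (a point for n = 0) *)
Definition fMS (n : nat) := {p : fMSraw | fMS_valid n p}.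

Definition fMS_dist (n : nat) (p q : fMSraw) : R :=
  \sum_(j < n) fine (lebesgue_measure (fI p j `\` fI q j))
  + sup [set cdist (fmon p t) (fmon q t) | t in [set t | 0 <= t <= 1]]
  + \sum_(j < n) cdist (fz p j) (fz q j).

(* A map S^1 -> (S^1)^N is represented by F : R -> nat -> R, meaning
   [t] |-> ([F t 0], ..., [F t (N-1)]) for t in [0,1). *)
Definition same_map (N : nat) (F G : R -> nat -> R) : Prop :=
  forall t, 0 <= t < 1 -> forall j, (j < N)%N -> fracR (F t j) = fracR (G t j).

(* the embedding c' : fMS(n) -> Coend(S^1)(n):
   component j is  t |-> z_j + pi_j(f(t)),  pi_j(s) = n * l(I_j cap [0,s]) *)
Definition cmap (n : nat) (p : fMS n) : R -> nat -> R :=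
  fun t j => fz (proj1_sig p) j +
    n%:R * fine (lebesgue_measure
                   (fI (proj1_sig p) j `&` [set s | 0 <= s <= fmon (proj1_sig p) t])).

Definition coend_comp (l i : nat) (F G : R -> nat -> R) : R -> nat -> R :=
  fun t j =>
    if (j < i.-1)%N then F t j
    else if (j < i.-1 + l)%N then G (fracR (F t i.-1)) (j - i.-1)%N
    else F t (j - l + 1)%N.

End Circle.

Section Algebra.
Context {R : realType} {O : nat -> topologicalType} (P : cyc_op_mult O).
Local Notation Tot := (@TotT R O P).
Local Notation Totp := (@Totpow R O P).

Variable theta : forall m, @fMS R m -> Totp m -> Tot.

Definition alg_continuous : Prop :=
  forall m (p : fMS m) (xs : Totp m) (W : set Tot),
    nbhs (theta m p xs) W ->
    exists2 d : R, 0 < d &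
    exists2 V : set (Totp m), nbhs xs V &
      forall (q : fMS m) ys, fMS_dist m (proj1_sig p) (proj1_sig q) < d -> V ys ->
        W (theta m q ys).

Definition alg_unit : Prop :=
  forall (e : fMS 1) (xs : Totp 1),
    same_map 1 (cmap 1%N e) (fun t _ => t) -> theta 1%N e xs = xs ord0.

Definition alg_equiv : Prop :=
  forall n (p q : fMS n) (s : 'S_n),
    (forall t, 0 <= t < 1 -> forall j : 'I_n,
        fracR (cmap n q t j) = fracR (cmap n p t (s j))) ->
    forall (xs ys : Totp n), (forall j, ys (s j) = xs j) ->
      theta n q xs = theta n p ys.

Definition alg_comp : Prop :=
  forall k l i (a : fMS k) (b : fMS l) (cc : fMS (k + l - 1)),
    (1 <= i <= k)%N ->
    same_map (k + l - 1) (cmap _ cc) (coend_comp l i (cmap k a) (cmap l b)) ->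
    forall (xs : Totp (k + l - 1)) (ys : Totp k) (zs : Totp l),
      (forall (r : 'I_l) (t : 'I_(k + l - 1)),
          val t = (i.-1 + r)%N -> zs r = xs t) ->
      (forall (s : 'I_k) (t : 'I_(k + l - 1)),
          (val s < i.-1)%N -> val t = val s -> ys s = xs t) ->
      (forall (s : 'I_k) (t : 'I_(k + l - 1)),
          (i.-1 < val s)%N -> val t = (val s + l - 1)%N -> ys s = xs t) ->
      (forall s : 'I_k, val s = i.-1 -> ys s = theta l b zs) ->
      theta _ cc xs = theta k a ys.

Definition fMS_algebra : Prop :=
  [/\ alg_continuous, alg_unit, alg_equiv & alg_comp].

End Algebra.

(* Main.v *)
Require Import Defs.
From HB Require Import structures.
From mathcomp Require Import all_boot all_order all_algebra all_fingroup.
From mathcomp Require Import all_classical all_reals all_analysis.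
From mathcomp Require Import zify ring lra.
Import Order.TTheory GRing.Theory Num.Theory numFieldNormedType.Exports.

Unset Strict Implicit.
Unset Printing Implicit Defensive.

Local Open Scope ring_scope.

(* A point of the totalization assigns an operation to every configuration of
   points of the interval. The multiplication and the cyclic structure extend
   it to cyclic configurations on the circle, one point of which is the output
   and the others the inputs. A spined cactus gives monotone maps of degree one
   from the circle to each lobe; pulling back the families of the arguments
   along these maps produces one cyclic family per lobe, which is degenerate
   wherever the map is constant. A leaf of the cactus moves only on an arc on
   which every other lobe is constant, and two families moving on complementary
   arcs combine through the product at the wedge point. Attaching the lobes leaf
   by leaf yields the action. The result does not depend on the order in which
   leaves are attached, hence equivariance; attaching lobe [i] first allows it
   to be replaced by the inner cactus, hence compatibility with composition.
   Continuity is tested along ultrafilters, along which the order of attachment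
   is eventually constant and the arcs converge by compactness. *)

(** The cosimplicial structure only describes configurations with the output at the base point. In a
    cactus the spine may lie anywhere on its lobe, and a glued family may have its output on any
    lobe; hence the passage to families with the output anywhere on the circle. Such a family is
    determined by its values with the output at one chosen point, so an identity between glued
    families can be tested at a wedge point, where it reduces to associativity and unit laws of the
    product. The maps to the lobes are not injective: two points may agree for one lobe and differ
    for another. Each family therefore carries its own relation of equal points, and gluing
    intersects these relations. Neither the leaf to attach next nor its arc is canonical, and no
    choice of them varies continuously. Gluing is therefore a relation, shown to be functional on
    configurations; existence is needed only for one order of attachment, and each axiom may use the
    order that suits it. Working with lifts to the line turns cyclic order and degree one into
    inequalities. A lift is defined up to an integer, and cyclic families are periodic, so the
    ambiguity is harmless. *)

Notation opel O := {n : nat & Topological.sort (O n)}.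
Notation ar := (@projT1 nat _).

(** * Operadic algebra in the total space of all arities *)

Section OperadElements.
Context {O : nat -> topologicalType} (P : cyc_op_mult O).

Definition ocmp (i : nat) (a b : opel O) : opel O :=
  existT O _ (ocomp P i (projT2 a) (projT2 b)).
Definition orot (a : opel O) : opel O := existT O _ (ocyc P (projT2 a)).
Definition mel : opel O := existT O _ (omul P).
Definition uel : opel O := existT O _ (ou P).
Definition iel : opel O := existT O _ (ounit P).
(** The cup product [m(a, b)]. The second slot of [m] is filled first, so that the first slot keeps
    its index. *)
Definition oprod (a b : opel O) : opel O := ocmp 1 (ocmp 2 mel b) a.

Lemma ar_ocmp i a b : ar (ocmp i a b) = (ar a + ar b - 1)%N.
Proof. by []. Qed.

Lemma ar_orot a : ar (orot a) = ar a. Proof. by []. Qed.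

Lemma ar_iter_orot n a : ar (iter n orot a) = ar a.
Proof. by elim: n. Qed.

Lemma ar_oprod a b : ar (oprod a b) = (ar a + ar b)%N.
Proof. rewrite !ar_ocmp /=; lia. Qed.

End OperadElements.

Section OperadTheory.
Context {O : nat -> topologicalType} {P : cyc_op_mult O}.
Context (HP : is_cyc_op_mult P).
Local Notation "a '\o[' i ] b" := (ocmp P i a b)
  (at level 40, i at level 0, left associativity, format "a  '\o[' i ]  b").
Local Notation t := (orot P).
Local Notation m := (mel P).
Local Notation u := (uel P).
Local Notation id1 := (iel P).
Local Notation "a ⋅ b" := (oprod P a b) (at level 40, left associativity).
Local Notation T := (opel O).

Lemma ocmp_par i j (a b c : T) : (1 <= i)%N -> (i < j)%N -> (j <= ar a)%N ->
  a \o[i] b \o[(j + ar b - 1)%N] c = a \o[j] c \o[i] b.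
Proof. by case: HP => -[_ H _ _] _ *; apply: H. Qed.

Lemma ocmp_seq i j (a b c : T) : (1 <= i <= ar a)%N -> (1 <= j <= ar b)%N ->
  a \o[i] (b \o[j] c) = a \o[i] b \o[(i + j - 1)%N] c.
Proof. by case: HP => -[_ _ H _] _ *; apply: H. Qed.

Lemma ocmp1l (a : T) : id1 \o[1] a = a.
Proof. by case: HP => -[_ _ _ [H _]] _; case: a => n a; apply: H. Qed.

Lemma ocmp1r i (a : T) : (1 <= i <= ar a)%N -> a \o[i] id1 = a.
Proof. by case: HP => -[_ _ _ [_ H]] _; case: a => n a; apply: H. Qed.

Lemma mel_assoc : m \o[1] m = m \o[2] m.
Proof. by case: HP => _ [[H _ _] _ _]; rewrite /ocmp /= H. Qed.

Lemma mel_u1 : m \o[1] u = id1. Proof. by case: HP => _ [[_ H _] _ _]. Qed.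
Lemma mel_u2 : m \o[2] u = id1. Proof. by case: HP => _ [[_ _ H] _ _]. Qed.

Lemma orot_iel : t id1 = id1.
Proof. by case: HP => _ [_ [_ _ _ _ H] _]; rewrite /orot /= H. Qed.

Lemma orot_mel : t m = m.
Proof. by case: HP => _ [_ _ H]; rewrite /orot /= H. Qed.

Lemma iter_orotE n (a : T) :
  iter n t a = existT O (ar a) (iter n (@ocyc O P (ar a)) (projT2 a)).
Proof. by elim: n => [|n /= ->]; first by case: a. Qed.

Lemma orot_order (a : T) : iter (ar a).+1 t a = a.
Proof.
rewrite iter_orotE; case: HP => _ [_ [_ H _ _ _] _].
by rewrite H; case: a.
Qed.

Lemma orot_inj : injective t.
Proof.
move=> a b tab; have arab : ar a = ar b by rewrite -(ar_orot P a) tab.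
by rewrite -(orot_order a) -(orot_order b) !iterSr tab arab.
Qed.

Lemma iter_orot_inj n : injective (iter n t).
Proof. by elim: n => [|n IH] a b //= /orot_inj /IH. Qed.

Lemma orot_ocmp1 (f g : T) : (1 <= ar f)%N -> (1 <= ar g)%N ->
  t (f \o[1] g) = t g \o[(ar g)] t f.
Proof. by case: HP => _ [_ [_ _ H _ _] _]; exact: H. Qed.

Lemma orot_ocmp i (f g : T) : (1 < i <= ar f)%N ->
  t (f \o[i] g) = t f \o[i.-1] g.
Proof. by case: HP => _ [_ [_ _ _ H _] _]; exact: H. Qed.

Lemma iter_orot_ocmp n i (f g : T) : (n < i <= ar f)%N ->
  iter n t (f \o[i] g) = iter n t f \o[(i - n)%N] g.
Proof.
elim: n => [|n IH] in i f g *; first by rewrite subn0.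
move=> ni; rewrite /= IH; last by lia.
by rewrite orot_ocmp ?ar_iter_orot; [congr (ocmp P _ _ _) |]; lia.
Qed.

(* The cyclic axiom for [f o_1 g] does not cover arity zero [g]; that case
   follows from the axiom for [f o_i g] with [1 < i] since [t] has finite
   order. *)
Lemma orot_ocmp1_0 (f g : T) : (1 <= ar f)%N -> ar g = 0%N ->
  t (f \o[1] g) = t (t f) \o[(ar f)] g.
Proof.
move=> f1 g0.
(* These further rotations bring [g] from the last slot back to slot 1 and complete [ar f + 1]
   rotations of [f]. The composite has arity [ar f - 1], so [ar f] rotations fix it. *)
have H : iter (ar f).-1 t (t (t f) \o[(ar f)] g) = f \o[1] g.
  rewrite iter_orot_ocmp ?ar_orot; last by lia.
  rewrite -!iterSr prednK // orot_order.
  by congr (ocmp P _ _ _); lia.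
apply: (@iter_orot_inj (ar f).-1); rewrite H -iterSr.
have e : (ar f).-1.+1 = (ar (f \o[1] g)).+1 by rewrite ar_ocmp; lia.
by rewrite e orot_order.
Qed.

Lemma oprodE (a b : T) : a ⋅ b = m \o[1] a \o[(ar a).+1] b.
Proof.
rewrite /oprod -(@ocmp_par 1 2) //=; congr (ocmp P _ _ _); lia.
Qed.

Lemma oprod_ul (a : T) : u ⋅ a = a.
Proof. by rewrite oprodE /= mel_u1 ocmp1l. Qed.

Lemma oprod_ur (a : T) : a ⋅ u = a.
Proof. by rewrite /oprod mel_u2 ocmp1l. Qed.

Lemma oprod_il (a : T) : id1 ⋅ a = m \o[2] a.
Proof. by rewrite oprodE /= ocmp1r. Qed.

Lemma oprod_ir (a : T) : a ⋅ id1 = m \o[1] a.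
Proof. by rewrite /oprod ocmp1r. Qed.

Lemma oprod_ii : id1 ⋅ id1 = m.
Proof. by rewrite oprod_il ocmp1r. Qed.

Lemma oprod_ocmpl i (a b c : T) : (1 <= i <= ar a)%N ->
  (a ⋅ b) \o[i] c = (a \o[i] c) ⋅ b.
Proof.
move=> ia; rewrite /oprod ocmp_seq //=.
by congr (ocmp P _ _ _); lia.
Qed.

Lemma oprod_ocmpr i (a b c : T) : (1 <= i <= ar b)%N ->
  (a ⋅ b) \o[(ar a + i)%N] c = a ⋅ (b \o[i] c).
Proof.
move=> ib; rewrite !oprodE ocmp_seq //=; try lia.
by congr (ocmp P _ _ _); lia.
Qed.

Lemma oprodA (a b c : T) : a ⋅ (b ⋅ c) = (a ⋅ b) ⋅ c.
Proof.
rewrite /oprod [RHS]ocmp_seq //=; try lia.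
congr (ocmp P _ _ a).
rewrite [LHS]ocmp_seq //=; try lia.
rewrite [RHS]ocmp_seq //=; try lia.
congr (ocmp P _ _ b).
by rewrite -(@ocmp_par 1 2) //= mel_assoc ocmp_seq.
Qed.

Lemma orot_oprod_il (a : T) : t (id1 ⋅ a) = a ⋅ id1.
Proof. by rewrite oprod_il orot_ocmp // orot_mel oprod_ir. Qed.

Lemma oprod_ii_ocmp1 (a : T) : (id1 ⋅ a) \o[1] m = id1 ⋅ (id1 ⋅ a).
Proof. by rewrite oprod_ocmpl // ocmp1l oprodA oprod_ii. Qed.

End OperadTheory.

(** * Cyclic families of operations *)

Section CyclicLists.
Context {R : realType}.
Implicit Types (x y z : R) (s A B : seq R).

(* Weakly increasing lists that wind at most once around [R / Z]. *)
Definition vl s : bool :=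
  if s is x :: s' then pairwise <=%R (x :: s' ++ [:: x + 1]) else false.

Lemma all_ge_trans x y s : all (<=%R x) s -> y <= x -> all (<=%R y) s.
Proof. by move=> xs yx; apply: sub_all xs => z; apply: le_trans. Qed.

Lemma all_le_trans x y s : all (<=%R^~ x) s -> x <= y -> all (<=%R^~ y) s.
Proof. by move=> xs yx; apply: sub_all xs => z /= zx; apply: le_trans zx yx. Qed.

Lemma all_gt_trans x y s : all (<%R x) s -> y <= x -> all (<=%R y) s.
Proof.
by move=> xs yx; apply: sub_all xs => z /ltW; apply: le_trans.
Qed.

Lemma all_lt_trans x y s : all (<%R^~ x) s -> x <= y -> all (<=%R^~ y) s.
Proof.
by move=> xs yx; apply: sub_all xs => z /= /ltW zx; apply: le_trans zx yx.
Qed.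

Lemma allrel_between x A B :
  all (<=%R^~ x) A -> all (<=%R x) B -> allrel <=%R A B.
Proof.
move=> /allP Ax /allP xB; apply/allrelP => a b /Ax /= ax /xB.
exact: le_trans.
Qed.

Lemma all_shift x c A : all (<=%R x) (map (+%R^~ c) A) = all (<=%R (x - c)) A.
Proof. by rewrite all_map; apply: eq_all => z /=; rewrite lerBlDr. Qed.

Lemma all_shift_le x c A :
  all (<=%R^~ x) (map (+%R^~ c) A) = all (<=%R^~ (x - c)) A.
Proof. by rewrite all_map; apply: eq_all => z /=; rewrite lerBrDr. Qed.

Lemma pairwise_shift c A :
  pairwise <=%R (map (+%R^~ c) A) = pairwise <=%R A.
Proof.
elim: A => //= a A ->; rewrite all_shift; congr (all _ _ && _).
by apply: funext => z; rewrite addrK.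
Qed.

End CyclicLists.

Arguments vl : simpl never.

(* Reflection of list expressions, reducing the sortedness of a concatenation
   to comparisons between its parts. *)
Section Reflection.
Context {R : realType}.

Inductive item := IPoint of R | IList of seq R | IShift of seq R & R.

Inductive lexpr := LNil | LCons of R & lexpr | LList of seq R
  | LShift of seq R & R | LCat of lexpr & lexpr.

Fixpoint lden (e : lexpr) : seq R :=
  match e with
  | LNil => [::]
  | LCons x e => x :: lden e
  | LList s => s
  | LShift s c => map (+%R^~ c) s
  | LCat e f => lden e ++ lden f
  end.

Fixpoint litems (e : lexpr) (l : seq item) : seq item :=
  match e with
  | LNil => l
  | LCons x e => IPoint x :: litems e l
  | LList s => IList s :: l
  | LShift s c => IShift s c :: l
  | LCat e f => litems e (litems f l)
  end.

Definition iden (a : item) : seq R :=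
  match a with
  | IPoint x => [:: x]
  | IList s => s
  | IShift s c => map (+%R^~ c) s
  end.

Definition iself (a : item) : Prop :=
  match a with
  | IPoint x => True
  | IList s => pairwise <=%R s
  | IShift s _ => pairwise <=%R s
  end.

Definition irel (a b : item) : Prop :=
  match a, b with
  | IPoint x, IPoint y => x <= y
  | IPoint x, IList s => all (<=%R x) s
  | IPoint x, IShift s c => all (<=%R (x - c)) s
  | IList s, IPoint y => all (<=%R^~ y) s
  | IShift s c, IPoint y => all (<=%R^~ (y - c)) s
  | _, _ => allrel <=%R (iden a) (iden b)
  end.

Fixpoint irels (a : item) (l : seq item) : Prop :=
  if l is b :: l then irel a b /\ irels a l else True.

Fixpoint iconds (l : seq item) : Prop :=
  if l is a :: l then [/\ iself a, irels a l & iconds l] else True.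

Lemma irelP a b : irel a b <-> allrel <=%R (iden a) (iden b).
Proof.
by case: a => [x|s|s c]; case: b => [y|r|r d] //=;
  rewrite ?(allrel1l, allrel1r) ?all_shift ?all_shift_le /= ?andbT.
Qed.

Lemma irelsP a l : irels a l <-> allrel <=%R (iden a) (flatten (map iden l)).
Proof.
elim: l => [|b l IH] /=; first by rewrite allrel0r.
rewrite allrel_catr; split=> [[/irelP -> /IH ->] //|/andP[ab al]].
by split; [apply/irelP|apply/IH].
Qed.

Lemma icondsP l : iconds l <-> pairwise <=%R (flatten (map iden l)).
Proof.
elim: l => [|a l IH] //=; rewrite pairwise_cat.
have sa : iself a <-> pairwise <=%R (iden a).
  by case: a => [x|s|s c] //=; rewrite pairwise_shift.
split=> [[/sa s1 /irelsP s2 /IH s3]|/and3P[s2 s1 s3]].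
  by rewrite s1 s2 s3.
by split; [apply/sa|apply/irelsP|apply/IH].
Qed.

Lemma litemsP e l :
  flatten (map iden (litems e l)) = lden e ++ flatten (map iden l).
Proof. by elim: e l => //= [x e IH|e IHe f IHf] l; rewrite ?IHe ?IHf ?IH ?catA. Qed.

Lemma vl_reflect x e :
  iconds (IPoint x :: litems e [:: IPoint (x + 1)]) <-> vl (x :: lden e).
Proof. by rewrite icondsP /= litemsP. Qed.

Lemma all_ge_reflect x e : irels (IPoint x) (litems e [::]) ->
  all (<=%R x) (lden e).
Proof. by rewrite irelsP litemsP /= cats0 allrel1l. Qed.

Fixpoint irels_le (l : seq item) y : Prop :=
  if l is a :: l then irel a (IPoint y) /\ irels_le l y else True.

Lemma all_le_reflect e y : irels_le (litems e [::]) y ->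
  all (<=%R^~ y) (lden e).
Proof.
have E l : irels_le l y -> all (<=%R^~ y) (flatten (map iden l)).
  elim: l => //= a l IH [/irelP ay /IH ly].
  by rewrite all_cat ly andbT; move: ay; rewrite allrel1r.
by move/E; rewrite litemsP /= cats0.
Qed.

Lemma and_split (b c : bool) : b && c -> b /\ c.
Proof. by move/andP. Qed.

Lemma and_join (b c : bool) : b -> c -> b && c.
Proof. by move=> -> ->. Qed.

End Reflection.

(** * Tactics for the ordering conditions on configurations *)

Ltac lquote s := lazymatch s with
  | nil => lazymatch goal with R' : realType |- _ => constr:(@LNil R') end
  | cons ?x ?r => let e := lquote r in constr:(LCons x e)
  | cat ?a ?b => let e := lquote a in let f := lquote b in constr:(LCat e f)
  | map (fun y => y + ?c) ?r => lquote_shift r c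
  | _ => constr:(LList s) end
with lquote_shift r c := lazymatch r with
  | nil => lazymatch goal with R' : realType |- _ => constr:(@LNil R') end
  | cons ?x ?r => let e := lquote_shift r c in constr:(LCons (x + c) e)
  | cat ?a ?b => let e := lquote_shift a c in let f := lquote_shift b c in
      constr:(LCat e f)
  | _ => constr:(LShift r c) end.

Ltac icompute := cbv [iconds irels irels_le irel iself iden litems].
Ltac vdest := repeat match goal with
  | H : is_true (_ && _) |- _ => destruct (and_split _ _ H); clear H end.
Ltac vsplit_hyp K := lazymatch type of K with
  | and3 _ _ _ => let K1 := fresh in let K2 := fresh in let K3 := fresh in
      destruct K as [K1 K2 K3]; vsplit_hyp K1; vsplit_hyp K2; vsplit_hyp K3
  | and _ _ => let K1 := fresh in let K2 := fresh in
      destruct K as [K1 K2]; vsplit_hyp K1; vsplit_hyp K2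
  | True => clear K
  | _ => idtac end.
Ltac vhyp H := lazymatch type of H with
  | is_true (vl (cons ?x ?s)) => let e := lquote s in
      move/(vl_reflect x e): H => H;
      cbv [iconds irels irels_le irel iself iden litems] in H; vsplit_hyp H
  end.
Ltac vhyps := repeat match goal with
  | H : is_true (vl _) |- _ => vhyp H end; vdest.
Ltac vassumption := match goal with H : ?Q |- ?Q => exact H end.
Ltac vle := first [ vassumption | repeat match goal with
  | H : is_true (all _ _) |- _ => clear H
  | H : is_true (allrel _ _ _) |- _ => clear H
  | H : is_true (pairwise _ _) |- _ => clear H
  end; lra ].
Ltac vall := first [ vassumption | lazymatch goal with
  | |- is_true (all (@Order.le _ _ _) ?A) => match goal with
    | H : is_true (all (@Order.le _ _ _) A) |- _ =>
        apply (all_ge_trans _ _ _ H); solve [vle]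
    | H : is_true (all (@Order.lt _ _ _) A) |- _ =>
        apply (all_gt_trans _ _ _ H); solve [vle] end
  | |- is_true (all (fun z => z <= _) ?A) => match goal with
    | H : is_true (all (fun z => z <= _) A) |- _ =>
        apply (all_le_trans _ _ _ H); solve [vle]
    | H : is_true (all (fun z => z < _) A) |- _ =>
        apply (all_lt_trans _ _ _ H); solve [vle] end end ].
Ltac vall_shift := rewrite ?all_shift ?all_shift_le; vall.
Ltac vatom := lazymatch goal with
  | |- is_true (all _ _) => try vall
  | |- is_true (pairwise _ _) => try vassumption
  | |- is_true (allrel _ _ _) => try first
      [vassumption | match goal with
        | H : is_true (all _ ?A) |- is_true (allrel _ ?A _) =>
          apply (allrel_between _ _ _ H); solve [vall_shift] end
      | match goal with
        | H : is_true (all _ ?B) |- is_true (allrel _ _ ?B) =>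
          eapply allrel_between; [ | exact H]; solve [vall_shift] end]
  | |- is_true (_ <= _) => try vle
  | |- is_true (_ < _) => try vle
  | |- is_true true => exact: isT
  | |- True => exact: I
  | _ => idtac end.
Ltac vsplit := repeat lazymatch goal with
    | |- is_true (_ && _) => apply: and_join
    | |- and _ _ => split
    | |- and3 _ _ _ => split end.
Ltac vgoal := lazymatch goal with
  | |- is_true (vl (cons ?x ?s)) => let e := lquote s in
      apply/(vl_reflect x e); icompute
  | |- is_true (all (@Order.le _ _ ?x) ?s) => let e := lquote s in
      apply: (all_ge_reflect x e); icompute
  | |- is_true (all (fun z => z <= ?y) ?s) => let e := lquote s in
      apply: (all_le_reflect e y); icompute
  | _ => idtac end.
Ltac vtac_all := vhyps; vsplit; vgoal; vsplit; vatom.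
Ltac vtac_first := match reverse goal with
  | H : is_true (vl _) |- _ => move: H;
    repeat match goal with K : is_true (vl _) |- _ => clear K end;
    let K := fresh "K" in move=> K; vtac_all end.
Ltac vtac := first [solve [vtac_first] | vtac_all].

Ltac nlia := repeat match goal with
  | H : is_true (vl _) |- _ => clear H
  | H : is_true (all _ _) |- _ => clear H
  | H : is_true (pairwise _ _) |- _ => clear H
  | H : is_true (@Order.lt ring_display _ _ _) |- _ => clear H
  | H : is_true (@Order.le ring_display _ _ _) |- _ => clear H
  | H : is_true (@Order.le ring_display _ _ _ && _) |- _ => clear H
  end; lia.

Section Cyclic.
Context {R : realType} {O : nat -> topologicalType} {P : cyc_op_mult O}.
Context (HP : is_cyc_op_mult P).
Local Notation "a '\o[' i ] b" := (ocmp P i a b)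
  (at level 40, i at level 0, left associativity, format "a  '\o[' i ]  b").
Local Notation t := (orot P).
Local Notation m := (mel P).
Local Notation u := (uel P).
Local Notation id1 := (iel P).
Local Notation "a ⋅ b" := (oprod P a b) (at level 40, left associativity).
Local Notation T := (opel O).

Implicit Types (x y z : R) (s A B : seq R) (ev : R -> R -> Prop).
Implicit Types G : seq R -> T.

(* [G] sends a cyclic configuration [x :: s] on the circle, based at [x], to
   an operation with [x] as output and [s] as inputs. Points related by [ev]
   count as equal. *)
Record cyclic_family ev G : Prop := CyclicFamily {
  cyc_ar : forall x s, vl (x :: s) -> ar (G (x :: s)) = size s;
  cyc_del1 : forall x z s, vl (x :: z :: s) ->
    G (x :: s) = G (x :: z :: s) \o[1] u;
  cyc_dbl1 : forall x z z' s, vl (x :: z :: z' :: s) -> ev z z' ->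
    G (x :: z :: z' :: s) = G (x :: z :: s) \o[1] m;
  cyc_rot : forall x s, vl (x :: s) -> G (s ++ [:: x + 1]) = t (G (x :: s));
  cyc_triv : forall x, ev x (x + 1) -> G [:: x] = u
}.

Arguments cyc_ar {ev G} _ {x s}.
Arguments cyc_del1 {ev G} _ {x z s}.
Arguments cyc_dbl1 {ev G} _ {x z z' s}.
Arguments cyc_rot {ev G} _ {x s}.
Arguments cyc_triv {ev G} _ {x}.

(* Equivalences on the line that come from monotone maps. *)
Record convex_equiv ev : Prop := ConvexEquiv {
  ev_refl : forall x, ev x x;
  ev_sym : forall x y, ev x y -> ev y x;
  ev_trans : forall y x z, ev x y -> ev y z -> ev x z;
  ev_convex : forall x y z, x <= y -> y <= z -> ev x z -> ev x y;
  ev_shift : forall x y, ev x y <-> ev (x + 1) (y + 1)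
}.

Arguments ev_refl {ev}.
Arguments ev_sym {ev} _ {x y}.
Arguments ev_trans {ev} _ {y x z}.
Arguments ev_convex {ev} _ {x y z}.
Arguments ev_shift {ev} _ {x y}.

Section Theory.
Context {ev : R -> R -> Prop} {G : seq R -> T}.
Context (Hev : convex_equiv ev) (HG : cyclic_family ev G).

(** The axioms speak of the first input only. A rotation turns the first input into the output, so
    induction on [A] brings [z] to the first place. *)
Lemma cyc_del x A z B : vl (x :: A ++ z :: B) ->
  G (x :: A ++ B) = G (x :: A ++ z :: B) \o[(size A).+1] u.
Proof.
elim: A x B => [|a A IH] x B v; first exact (cyc_del1 HG v).
apply: (orot_inj HP); rewrite -(cyc_rot HG); last by vtac.
have v2 : vl (a :: A ++ z :: (B ++ [:: x + 1])) by vtac.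
rewrite (orot_ocmp HP); last first.
  by rewrite (cyc_ar HG v) /= !size_cat /=; lia.
rewrite -(cyc_rot HG) //= -!catA /= (IH _ _ v2) /=.
by [].
Qed.

Lemma cyc_dbl x A z z' B : vl (x :: A ++ z :: z' :: B) -> ev z z' ->
  G (x :: A ++ z :: z' :: B) = G (x :: A ++ z :: B) \o[(size A).+1] m.
Proof.
move=> + zz'; elim: A x B => [|a A IH] x B v.
  exact (cyc_dbl1 HG v zz').
have v1 : vl (x :: (a :: A) ++ z :: B) by vtac.
apply: (orot_inj HP); rewrite -(cyc_rot HG) //.
have v2 : vl (a :: A ++ z :: z' :: (B ++ [:: x + 1])) by vtac.
rewrite (orot_ocmp HP); last first.
  by rewrite (cyc_ar HG v1) /= !size_cat /=; lia.
by rewrite -(cyc_rot HG) //= -!catA /= (IH _ _ v2) /=.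
Qed.

(** If there is a last input [w], the output can be rotated to [w - 1]; then [x] and [z] are the
    first two inputs and the doubling axiom inserts [m]. Rotating back moves [m] to the outside, and
    it is still [m] because the multiplication is cyclically invariant. *)
Lemma cyc_head_dbl x z B : vl (x :: z :: B) -> ev x z ->
  G (x :: z :: B) = id1 ⋅ G (x :: B).
Proof.
move=> v xz; rewrite (oprod_il HP).
have main w B' : vl (x :: z :: B' ++ [:: w]) ->
    G (x :: z :: B' ++ [:: w]) = m \o[2] G (x :: B' ++ [:: w]).
  move=> v'; have v1 : vl (w - 1 :: x :: z :: B'). vtac.
  have v2 : vl (w - 1 :: x :: B') by vtac.
  have := cyc_rot HG v1; rewrite subrK /= => ->.
  have := cyc_rot HG v2; rewrite subrK /= => ->.
  rewrite (cyc_dbl1 HG v1 xz) (orot_ocmp1 HP) ?orot_mel //.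
  by rewrite (cyc_ar HG v2).
elim/last_ind: B v => [|B w _] v; last by rewrite -cats1 in v *; apply: main; vtac.
(* With no other input, [x + 1] is added as a last input and deleted again. *)
have v1 : vl (x :: [:: z] ++ [:: x + 1]) by vtac.
have v2 : vl (x :: [::] ++ [:: x + 1]) by vtac.
rewrite -[[:: x; z]]/(x :: [:: z] ++ [::]) (cyc_del _ _ _ _ v1) /=.
rewrite -[[:: x]]/(x :: [::] ++ [::]) (cyc_del _ _ _ _ v2) /=.
rewrite (main _ [::]) //=; rewrite (ocmp_seq HP) //.
by rewrite (cyc_ar HG v2).
Qed.

(** Insert [z] next to the output as a factor [id1], rotate so that [z] becomes the output and
    [x + 1] the last input, and delete the latter: the factor [id1] becomes a unit. *)
Lemma cyc_head_move x z B : x <= z <= x + 1 -> ev x z -> vl (x :: B) -> vl (z :: B) ->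
  G (x :: B) = G (z :: B).
Proof.
move=> /andP[le_xz le_zx] xz v v'.
have v1 : vl (x :: z :: B) by vtac.
have v2 : vl (z :: B ++ x + 1 :: [::]) by vtac.
rewrite -[in RHS](cats0 B) (cyc_del _ _ _ _ v2).
have -> : z :: B ++ [:: x + 1] = (z :: B) ++ [:: x + 1] by [].
rewrite (cyc_rot HG v1) (cyc_head_dbl _ _ _ v1 xz) (orot_oprod_il HP).
have <- : (ar (G (x :: B)) + 1)%N = (size B).+1.
  by rewrite (cyc_ar HG v) addn1.
by rewrite (oprod_ocmpr HP) // (ocmp1l HP) (oprod_ur HP).
Qed.

Lemma cyc_tail_dbl x z B : vl (x :: B ++ [:: z]) -> ev z (x + 1) ->
  G (x :: B ++ [:: z]) = G (x :: B) ⋅ id1.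
Proof.
move=> v zx.
have e : ev (z - 1) x by apply/(ev_shift Hev); rewrite subrK.
have v1 : vl (z - 1 :: x :: B) by vtac.
have -> : x :: B ++ [:: z] = (x :: B) ++ [:: z - 1 + 1] by rewrite subrK.
rewrite (cyc_rot HG v1) (cyc_head_dbl _ _ _ v1 e) (orot_oprod_il HP).
by congr (_ ⋅ _); apply: cyc_head_move e _ _; vtac.
Qed.

Lemma cyc_rotn x A z B : vl (x :: A ++ z :: B) ->
  iter (size A).+1 t (G (x :: A ++ z :: B)) =
  G (z :: B ++ x + 1 :: map (+%R^~ 1) A).
Proof.
elim: A x B => [|a A IH] x B v; first by rewrite /= -(cyc_rot HG v).
rewrite iterSr -(cyc_rot HG v) /= -catA /= -iterS IH /= -?catA //.
by vtac.
Qed.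

Lemma cyc_shift1 x s : vl (x :: s) ->
  G (map (+%R^~ 1) (x :: s)) = G (x :: s).
Proof.
case: s => [|z s] v.
  have := cyc_rot HG v; rewrite /= => ->.
  by have := orot_order HP (G [:: x]); rewrite (cyc_ar HG v).
elim/last_ind: s v => [|s w _] v.
  have := cyc_rotn x [::] z [::] v => /= /(congr1 t).
  have v1 : vl [:: z; x + 1] by vtac.
  rewrite -(cyc_rot HG v1) /= => <-.
  by have := orot_order HP (G [:: x; z]); rewrite (cyc_ar HG v).
rewrite -cats1 in v *.
have := cyc_rotn x (z :: s) w [::] v => /= /(congr1 t).
have v1 : vl (w :: x + 1 :: z + 1 :: map (+%R^~ 1) s).
  by vtac.
rewrite -(cyc_rot HG v1) /= map_cat /= => <-.
have := orot_order HP (G [:: x, z & s ++ [:: w]]); rewrite (cyc_ar HG v) /=.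
by rewrite size_cat /= addn1.
Qed.

Lemma vl_shift s c : vl (map (+%R^~ c) s) = vl s.
Proof.
case: s => // x s.
have -> : vl (map (+%R^~ c) (x :: s)) =
    pairwise <=%R (map (+%R^~ c) (x :: s ++ [:: x + 1])).
  by rewrite /vl /= map_cat /= addrAC.
by rewrite pairwise_shift.
Qed.

Lemma cyc_shift (n : int) s : vl s ->
  G (map (+%R^~ n%:~R) s) = G s.
Proof.
have pos (k : nat) r : vl r -> G (map (+%R^~ k%:R) r) = G r.
  elim: k => [|k IH] v.
    by congr G; rewrite -[RHS]map_id; apply: eq_map => x /=; rewrite addr0.
  rewrite -(IH v); case: r v {IH} => // x r v.
  have v' : vl (map (+%R^~ k%:R) (x :: r)) by rewrite vl_shift.
  have : G (map (+%R^~ 1) (map (+%R^~ k%:R) (x :: r))) =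
    G (map (+%R^~ k%:R) (x :: r)) by exact: cyc_shift1 v'.
  move=> <-; rewrite -map_comp; congr G.
  by apply: eq_map => y /=; rewrite -natr1 addrA.
move=> v; case: n => n; first exact: pos.
rewrite -(pos n.+1 (map _ s)) ?vl_shift // -map_comp.
congr G; rewrite -[RHS]map_id; apply: eq_map => x /=.
by rewrite NegzE mulrNz subrK.
Qed.

End Theory.
End Cyclic.

Arguments cyc_del {R O P} HP {ev G} HG {x A z B} _.
Arguments cyc_dbl {R O P} HP {ev G} HG {x A z z' B} _ _.
Arguments cyc_head_dbl {R O P} HP {ev G} HG {x z B} _ _.
Arguments cyc_head_move {R O P} HP {ev G} HG {x z B} _ _ _ _.
Arguments cyc_tail_dbl {R O P} HP {ev G} Hev HG {x z B} _ _.
Arguments cyc_rotn {R O P ev G} HG {x A z B} _.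
Arguments cyc_shift {R O P} HP {ev G} HG n {s} _.
Arguments cyc_ar {R O P ev G} _ {x s}.
Arguments cyc_del1 {R O P ev G} _ {x z s}.
Arguments cyc_dbl1 {R O P ev G} _ {x z z' s}.
Arguments cyc_rot {R O P ev G} _ {x s}.
Arguments cyc_triv {R O P ev G} _ {x}.
Arguments ev_refl {R ev}.
Arguments ev_sym {R ev} _ {x y}.
Arguments ev_trans {R ev} _ {y x z}.
Arguments ev_convex {R ev} _ {x y z}.
Arguments ev_shift {R ev} _ {x y}.

(** * Extension from the interval to the circle *)

Section Extension.
Context {R : realType} {O : nat -> topologicalType} {P : cyc_op_mult O}.
Context (HP : is_cyc_op_mult P).
Local Notation "a '\o[' i ] b" := (ocmp P i a b)
  (at level 40, i at level 0, left associativity, format "a  '\o[' i ]  b").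
Local Notation t := (orot P).
Local Notation m := (mel P).
Local Notation u := (uel P).
Local Notation id1 := (iel P).
Local Notation "a ⋅ b" := (oprod P a b) (at level 40, left associativity).
Local Notation T := (opel O).
Local Notation cyclic_family := (@cyclic_family R O P).

Implicit Types (x y z : R) (s A C : seq R) (ev : R -> R -> Prop).
Implicit Types G : seq R -> T.

Lemma map_shift0 s : map (+%R^~ 0) s = s.
Proof. by rewrite -[RHS]map_id; apply: eq_map => z /=; rewrite addr0. Qed.

Lemma map_shiftD c d s :
  map (+%R^~ c) (map (+%R^~ d) s) = map (+%R^~ (d + c)) s.
Proof. by rewrite -map_comp; apply: eq_map => z /=; rewrite addrA. Qed.

Lemma map_shiftK c s : map (+%R^~ c) (map (+%R^~ (- c)) s) = s.
Proof. by rewrite map_shiftD addNr map_shift0. Qed.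

Lemma sorted_split c s : pairwise <=%R s ->
  exists A C, [/\ s = A ++ C, all (<%R^~ c) A & all (<=%R c) C].
Proof.
elim: s => [|z s IH] /=; first by exists [::], [::].
move=> /andP[zs ps]; have [zc|cz] := ltP z c.
  have [A [C [-> Ac Cc]]] := IH ps.
  by exists (z :: A), C; split=> //=; rewrite zc.
by exists [::], (z :: s); split=> //=; rewrite cz (all_ge_trans _ _ _ zs cz).
Qed.

Lemma vl_split c x s : vl (x :: s) ->
  exists A C, [/\ s = A ++ C, all (<%R^~ c) A & all (<=%R c) C].
Proof. by move=> v; apply: sorted_split; vtac. Qed.

(* Rotate an extra point to the base, then delete it. *)
Lemma cyclic_ext x0 ev ev' G G' : cyclic_family ev G -> cyclic_family ev' G' ->
  (forall s, vl (x0 :: s) -> G (x0 :: s) = G' (x0 :: s)) ->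
  forall s, vl s -> G s = G' s.
Proof.
move=> HG HG' E [//|x s] v.
set n := Num.floor (x - x0).
have n1 : x0 + n%:~R <= x by have := floor_le (x - x0); rewrite -/n; lra.
have n2 : x < x0 + n%:~R + 1.
  by have := floorD1_gt (x - x0); rewrite intrD -/n; lra.
set b := x0 + (n + 1)%:~R; have eb : b = x0 + n%:~R + 1.
  by rewrite /b intrD addrA.
have Eb r : vl (b :: r) -> G (b :: r) = G' (b :: r).
  move=> vr; have vr' : vl (map (+%R^~ (- (n + 1)%:~R)) (b :: r)).
    by rewrite vl_shift.
  rewrite -(map_shiftK (n + 1)%:~R (b :: r)).
  rewrite (cyc_shift HP HG) // (cyc_shift HP HG') //.
  by rewrite /= /b addrK; apply: E; rewrite /= /b addrK in vr'.
have [A [C [sE Ab Cb]]] := vl_split b _ _ v.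
have v1 : vl (x :: A ++ b :: C) by rewrite sE in v; vtac.
have v2 : vl (b :: C ++ x + 1 :: map (+%R^~ 1) A).
  rewrite sE in v; vtac.
rewrite sE (cyc_del HP HG v1) (cyc_del HP HG' v1); congr (_ \o[_] _).
apply: (@iter_orot_inj _ _ HP (size A).+1).
by rewrite (cyc_rotn HG v1) (cyc_rotn HG' v1) Eb.
Qed.

Lemma iter_orot_prod_id n (a : T) : (0 < n <= ar a)%N ->
  iter n t (a ⋅ id1) = iter n t a \o[((ar a).+1 - n)%N] m.
Proof.
case: n => // n /andP[_ na].
rewrite !iterSr (oprod_ir HP) (orot_ocmp1 HP) //; last by nlia.
rewrite orot_mel // (iter_orot_ocmp HP) ?ar_orot; last by nlia.
by congr (_ \o[_] _); nlia.
Qed.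

Lemma ocmp_par0 i j (a b c : T) : ar b = 0%N -> (1 <= i < j)%N ->
  (j <= ar a)%N -> a \o[i] b \o[j.-1] c = a \o[j] c \o[i] b.
Proof.
move=> b0 /andP[i1 ij] ja; rewrite -[RHS](ocmp_par HP) // b0.
by congr (_ \o[_] _); nlia.
Qed.

(** The part of a cyclic family visible with the output fixed at 0. An input equal to 0 or to 1
    meets the output from one of its two sides: [bas_first] and [bas_last] are the two outer
    cofaces. *)
Record based_family ev (B : seq R -> T) : Prop := BasedFamily {
  bas_ar : forall s, vl (0 :: s) -> ar (B s) = size s;
  bas_del : forall A z C, vl (0 :: A ++ z :: C) ->
    B (A ++ C) = B (A ++ z :: C) \o[(size A).+1] u;
  bas_dbl : forall A z z' C, vl (0 :: A ++ z :: z' :: C) -> ev z z' ->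
    B (A ++ z :: z' :: C) = B (A ++ z :: C) \o[(size A).+1] m;
  bas_first : forall z C, vl (0 :: z :: C) -> ev 0 z ->
    B (z :: C) = id1 ⋅ B C;
  bas_last : forall A z, vl (0 :: A ++ [:: z]) -> ev z 1 ->
    B (A ++ [:: z]) = B A ⋅ id1;
  bas_triv : ev 0 1 -> B [::] = u
}.
Arguments bas_ar {ev B} _ {s}.
Arguments bas_del {ev B} _ {A z C}.
Arguments bas_dbl {ev B} _ {A z z' C}.
Arguments bas_first {ev B} _ {z C}.
Arguments bas_last {ev B} _ {A z}.
Arguments bas_triv {ev B} _.

(* The value at [x :: s] inserts the base point [1] of [B] between the points
   below and above it, rotates the output of [B] to [x], and forgets [1]. *)
Definition ext0 (B : seq R -> T) (y : seq R) : T :=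
  if y is x :: s then
    let A := [seq z <- s | z < 1] in
    let C := [seq z <- s | 1 <= z] in
    iter (size C).+1 t (B (map (+%R^~ (- 1)) C ++ x :: A)) \o[(size A).+1] u
  else u.

(** Subtracting the floor of the output makes periodicity automatic, so that every axiom needs
    checking only for an output in [[0, 1)]. *)
Definition ext B (y : seq R) : T :=
  ext0 B (map (+%R^~ (- (Num.floor (head 0 y))%:~R)) y).

Lemma ext_shift B (n : int) s : ext B (map (+%R^~ n%:~R) s) = ext B s.
Proof.
rewrite /ext map_shiftD; case: s => // x s; congr (ext0 B (map _ _)).
apply: funext => z /=; rewrite floorDrz ?intr_int // intrKfloor intrD; lra.
Qed.

Lemma ext_shiftB1 B s : ext B s = ext B (map (+%R^~ (- 1)) s).
Proof. by rewrite -(ext_shift B (-1)). Qed.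

Lemma extE B x A C : 0 <= x < 1 -> all (<%R^~ 1) A -> all (<=%R 1) C ->
  ext B (x :: A ++ C) =
  iter (size C).+1 t (B (map (+%R^~ (- 1)) C ++ x :: A)) \o[(size A).+1] u.
Proof.
move=> x01 A1 C1; have fx : Num.floor x = 0 by apply: floor_def; rewrite add0r.
rewrite /ext /= fx oppr0 map_shift0 addr0 !filter_cat.
have -> : [seq z <- A | z < 1] = A by apply/all_filterP.
have -> : [seq z <- C | 1 <= z] = C by apply/all_filterP.
have -> : [seq z <- A | 1 <= z] = [::].
  rewrite -(filter_pred0 A); apply: eq_in_filter => z /(allP A1) /= z1.
  by rewrite leNgt z1.
have -> : [seq z <- C | z < 1] = [::].
  rewrite -(filter_pred0 C); apply: eq_in_filter => z /(allP C1) /= z1.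
  by rewrite ltNge z1.
by rewrite cats0.
Qed.

Section ExtCyclic.
Context {ev : R -> R -> Prop} {B : seq R -> T}.
Context (Hev : convex_equiv ev) (HB : based_family ev B).

Lemma ev_shift_int (n : int) x y : ev x y -> ev (x + n%:~R) (y + n%:~R).
Proof.
have pos (k : nat) x' y' : ev x' y' <-> ev (x' + k%:R) (y' + k%:R).
  elim: k => [|k IH]; first by rewrite !addr0.
  by rewrite IH (ev_shift Hev) -!addrA natr1.
case: n => n exy; first exact: (pos n x y).1 exy.
by apply/(pos n.+1); rewrite NegzE mulrNz -pmulrn !subrK.
Qed.

Lemma vl_cut x A C : vl (x :: A ++ C) -> 0 <= x < 1 ->
  all (<%R^~ 1) A -> all (<=%R 1) C ->
  vl (0 :: map (+%R^~ (- 1)) C ++ x :: A).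
Proof. by move=> v /andP[x0 x1] A1 C1; vtac. Qed.

Lemma ext_ar x s : 0 <= x < 1 -> vl (x :: s) -> ar (ext B (x :: s)) = size s.
Proof.
move=> x01 v; have [A [C [sE A1 C1]]] := vl_split 1 _ _ v.
rewrite {s}sE in v *; rewrite extE // ar_ocmp ar_iter_orot.
rewrite (bas_ar HB); last exact: vl_cut.
by rewrite !size_cat size_map /=; nlia.
Qed.

Lemma ext_del1 x z s : 0 <= x < 1 -> vl (x :: z :: s) ->
  ext B (x :: s) = ext B (x :: z :: s) \o[1] u.
Proof.
move=> x01 v; have [[|z' A] [C [sE A1 C1]]] := vl_split 1 _ _ v.
  move: sE C1 => /= <- {C} zs1; have /andP[z1 s1] : (1 <= z) && all (<=%R 1) s := zs1.
  have vb := vl_cut _ [::] (z :: s) v x01 isT zs1.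
  rewrite (extE B x [::] s) // (extE B x [::] (z :: s)) //=.
  have arf := bas_ar HB vb.
  rewrite (bas_del HB (A := [::]) vb) /=.
  set f := B _ in arf *; have {}arf : ar f = (size s).+2.
    by rewrite arf /= size_cat size_map /= addn1.
  (* The deleted input sits in slot 1 of [B], so the first rotation needs the rule for [o_1] with an
     operation of arity zero. *)
  rewrite -!iterS [X in X \o[1] _ = _]iterSr (orot_ocmp1_0 HP) ?arf //.
  rewrite (iter_orot_ocmp HP) ?ar_orot ?arf; last by nlia.
  have -> : ((size s).+2 - size s = 2)%N by nlia.
  by rewrite -!iterSr -(@ocmp_par0 1 2) // ar_iter_orot arf.
have [zE sE'] : z = z' /\ s = A ++ C by case: sE.
rewrite {s sE}sE' {z}zE in v *; have /andP[z1 A1'] : (z' < 1) && all (<%R^~ 1) A := A1.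
have v0 : vl (x :: A ++ C) by vtac.
have vb := vl_cut _ (z' :: A) C v x01 A1 C1.
have arf := bas_ar HB vb.
rewrite extE // (extE B x (z' :: A)) //= in arf *.
have vb' : vl (0 :: (map (+%R^~ (- 1)) C ++ [:: x]) ++ z' :: A).
  by rewrite -catA.
rewrite -[map _ C ++ x :: A]/(map _ C ++ [:: x] ++ A) catA (bas_del HB vb').
rewrite -[(_ ++ [:: x]) ++ _]catA /=; set f := B _ in arf *.
have {}arf : ar f = (size C + (size A).+2)%N.
  by rewrite arf size_cat size_map.
rewrite -iterS (iter_orot_ocmp HP); last first.
  by rewrite arf size_cat size_map /=; nlia.
rewrite size_cat size_map /= addn1 -[((_).+2 - _)%N]/(_ - _)%N.
have -> : ((size C).+2 - (size C).+1 = 1)%N by nlia.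
rewrite -(@ocmp_par0 1 (size A).+2) //.
by rewrite ar_orot ar_iter_orot arf; nlia.
Qed.

End ExtCyclic.
End Extension.

Arguments bas_ar {R O P ev B} _ {s}.
Arguments bas_del {R O P ev B} _ {A z C}.
Arguments bas_dbl {R O P ev B} _ {A z z' C}.
Arguments bas_first {R O P ev B} _ {z C}.
Arguments bas_last {R O P ev B} _ {A z}.
Arguments bas_triv {R O P ev B} _.
Arguments ext {R O} P B y.
Arguments ext_del1 {R O P} HP {ev B} HB {x z s} _ _.
Arguments ext_ar {R O P ev B} HB {x s} _ _.
Arguments ev_shift_int {R ev} Hev n {x y} _.
Arguments vl_split {R} c {x s} _.
Arguments vl_cut {R} x A C _ _ _ _.
Arguments cyclic_ext {R O P} HP x0 {ev ev' G G'} HG HG' _ {s} _.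

Section ExtensionTheory.
Context {R : realType} {O : nat -> topologicalType} {P : cyc_op_mult O}.
Context (HP : is_cyc_op_mult P).
Local Notation "a '\o[' i ] b" := (ocmp P i a b)
  (at level 40, i at level 0, left associativity, format "a  '\o[' i ]  b").
Local Notation t := (orot P).
Local Notation m := (mel P).
Local Notation u := (uel P).
Local Notation id1 := (iel P).
Local Notation "a ⋅ b" := (oprod P a b) (at level 40, left associativity).
Local Notation T := (opel O).
Local Notation cyclic_family := (@cyclic_family R O P).

Implicit Types (x y z : R) (s A C : seq R) (ev : R -> R -> Prop).
Implicit Types G : seq R -> T.

Local Notation ext := (ext P).

Context {ev : R -> R -> Prop} {B : seq R -> T}.
Context (Hev : convex_equiv ev) (HB : @based_family R O P ev B).

Lemma ext_dbl1 x z z' s : 0 <= x < 1 -> vl (x :: z :: z' :: s) -> ev z z' ->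
  ext B (x :: z :: z' :: s) = ext B (x :: z :: s) \o[1] m.
Proof.
move=> x01 v zz'.
have [A [C [sE A1 C1]]] := vl_split 1 v.
case: A sE A1 => [|a [|a' A]] sE A1.
- move: sE C1 => /= <- {C} zs1.
  have /and3P[z1 z1' s1] : [&& 1 <= z, 1 <= z' & all (<=%R 1) s] := zs1.
  have v0 : vl (x :: z :: s) by vtac.
  have vb := vl_cut x [::] (z :: z' :: s) v x01 isT zs1.
  have zs1' : all (<=%R 1) (z :: s) by rewrite /= z1.
  have vb' := vl_cut x [::] (z :: s) v0 x01 isT zs1'.
  rewrite (extE _ x [::] (z :: z' :: s)) // (extE _ x [::] (z :: s)) //=.
  have e : ev (z - 1) (z' - 1) by exact: (ev_shift_int Hev (-1) zz').
  have arf := bas_ar HB vb'.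
  rewrite (bas_dbl HB (A := [::]) vb e) /= in arf *; set f := B _ in arf *.
  have {}arf : ar f = (size s).+2 by rewrite arf size_cat size_map /= addn1.
  rewrite -!iterS iterSr (orot_ocmp1 HP) ?arf // (orot_mel HP).
  rewrite -(oprod_il HP) iterSr (orot_oprod_il HP).
  rewrite (iter_orot_prod_id HP) ?ar_orot ?arf; last by nlia.
  have -> : ((size s).+3 - (size s).+1 = 2)%N by nlia.
  rewrite -!iterSr -(@ocmp_par0 _ _ HP 1 2) //.
  by rewrite ar_iter_orot arf.
(* The base point 1 separates [z] from [z']. By convexity both are equal to it, so one is a right
   and the other a left factor [id1] of the same operation. *)
- case: sE C1 => <- <- {a C} zs1 in A1 *.
  have /andP[z1' s1] : (1 <= z') && all (<=%R 1) s := zs1.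
  have /andP[z1 _] : (z < 1) && true := A1.
  have v0 : vl (x :: [:: z] ++ s) by vtac.
  have vb := vl_cut x [:: z] (z' :: s) v x01 A1 zs1.
  have vb' := vl_cut x [:: z] s v0 x01 A1 s1.
  have E1 : ext B (x :: [:: z] ++ z' :: s) = iter (size s).+2 t
      (B (z' - 1 :: (map (+%R^~ (- 1)) s ++ [:: x]) ++ [:: z])) \o[2] u.
    by rewrite -catA; apply: (extE B x [:: z] (z' :: s)).
  have E2 : ext B (x :: [:: z] ++ s) = iter (size s).+1 t
      (B ((map (+%R^~ (- 1)) s ++ [:: x]) ++ [:: z])) \o[2] u.
    by rewrite -catA; apply: (extE B x [:: z] s).
  rewrite -[x :: z :: z' :: s]/(x :: [:: z] ++ z' :: s) {}E1.
  rewrite -[x :: z :: s]/(x :: [:: z] ++ s) {}E2.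
  have ez1 : ev z 1 by apply: (ev_convex Hev) zz'; rewrite // ltW.
  have e1z : ev 1 z' by apply: (ev_trans Hev) zz'; apply: ev_sym ez1.
  have e0 : ev 0 (z' - 1).
    by have := ev_shift_int Hev (-1) e1z; rewrite /= subrr.
  have vf : vl (0 :: (map (+%R^~ (- 1)) s ++ [:: x]) ++ [:: z]).
    by rewrite -catA.
  have vg : vl (0 :: map (+%R^~ (- 1)) s ++ [:: x]) by vtac.
  have vb2 : vl (0 :: z' - 1 :: (map (+%R^~ (- 1)) s ++ [:: x]) ++ [:: z]).
    by rewrite -catA.
  rewrite (bas_first HB vb2 e0).
  rewrite (bas_last HB vf ez1); have arg := bas_ar HB vg.
  set g := B _ in arg *.
  have {}arg : ar g = (size s).+1 by rewrite arg size_cat size_map /= addn1.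
  rewrite iterSr (orot_oprod_il HP).
  rewrite (iter_orot_prod_id HP _ (g ⋅ id1)); last first.
    by rewrite ar_oprod arg /=; nlia.
  rewrite (iter_orot_prod_id HP _ g) ?arg; last by nlia.
  rewrite ar_oprod arg /= addn1.
  have -> : ((size s).+3 - (size s).+1 = 2)%N by nlia.
  have -> : ((size s).+2 - (size s).+1 = 1)%N by nlia.
  set h := iter (size s).+1 t g; have arh : ar h = (size s).+1 by rewrite ar_iter_orot.
  have mu (k : T) : (2 <= ar k)%N -> k \o[2] m \o[2] u = k.
    move=> k2; rewrite -[X in _ \o[X] u]/(2 + 1 - 1)%N -(ocmp_seq HP) //.
    by rewrite (mel_u1 HP) (ocmp1r HP).
  rewrite mu ?ar_ocmp ?arh /=; last by nlia.
  rewrite -[X in _ \o[X] u]/(1 + 2 - 1)%N -(ocmp_seq HP) ?arh //.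
  by rewrite (mel_u2 HP) (ocmp1r HP) ?ar_orot ?ar_iter_orot ?arg.
- move: sE => [za za' sE]; rewrite -{a}za -{a'}za' in A1 *; rewrite {s}sE in v *.
  have /and3P[z1 z1' A1'] : [&& z < 1, z' < 1 & all (<%R^~ 1) A] := A1.
  have v0 : vl (x :: (z :: A) ++ C) by vtac.
  have A1'' : all (<%R^~ 1) (z :: A) by rewrite /= z1.
  have vb := vl_cut x (z :: z' :: A) C v x01 A1 C1.
  have vb' := vl_cut x (z :: A) C v0 x01 A1'' C1.
  rewrite (extE _ x (z :: z' :: A)) // (extE _ x (z :: A)) //=.
  have arf := bas_ar HB vb'.
  have v2 : vl (0 :: (map (+%R^~ (- 1)) C ++ [:: x]) ++ z :: z' :: A).
    by rewrite -catA.
  have := bas_dbl HB v2 zz'; rewrite -!catA /= => ->.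
  set f := B _ in arf *.
  have {}arf : ar f = (size C + (size A).+2)%N.
    by rewrite arf size_cat size_map.
  rewrite size_cat size_map /= addn1 -!iterS (iter_orot_ocmp HP); last first.
    by rewrite arf; nlia.
  have -> : ((size C).+2 - (size C).+1 = 1)%N by nlia.
  have := @ocmp_par _ _ HP 1 (size A).+2 (iter (size C).+1 t f) m u isT isT.
  rewrite ar_iter_orot arf => /(_ _) <-; last by nlia.
  by congr (_ \o[_] _) => /=; nlia.
Qed.

Lemma ext_rot x s : 0 <= x < 1 -> vl (x :: s) ->
  ext B (s ++ [:: x + 1]) = t (ext B (x :: s)).
Proof.
move=> x01 v; have [x0 x1] := andP x01.
have [[|z A] [C [sE A1 C1]]] := vl_split 1 v.
  (* All inputs lie past the cut: the rotated list starts at 1 or later, is translated by -1, and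
     then lies entirely below the cut. *)
  move: sE => /= <- in C1 *; case: s v C1 {C} => [|z s] v C1.
    rewrite ext_shiftB1 /= addrK.
    by have := orot_order HP (ext B [:: x]); rewrite (ext_ar HB).
  have vb := vl_cut x [::] (z :: s) v x01 isT C1.
  have /andP[z1 s1] : (1 <= z) && all (<=%R 1) s := C1.
  rewrite (extE _ x [::] (z :: s)) // ext_shiftB1.
  have v2 : vl (z - 1 :: (map (+%R^~ (- 1)) s ++ [:: x]) ++ [::]).
    by rewrite cats0; vtac.
  have -> : map (+%R^~ (- 1)) ((z :: s) ++ [:: x + 1]) =
    z - 1 :: (map (+%R^~ (- 1)) s ++ [:: x]) ++ [::].
    by rewrite cats0 /= map_cat /= addrK.
  rewrite extE //; first last.
  - rewrite all_cat /= x1 !andbT all_map.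
    have : all (<=%R^~ (x + 1)) s by vtac.
    by apply: sub_all => y /=; lra.
  - by vtac.
  have arf := bas_ar HB vb.
  pose f := B (z - 1 :: map (+%R^~ (- 1)) s ++ [:: x]).
  have {}arf : ar f = (size s).+2 by rewrite arf /= size_cat size_map /= addn1.
  transitivity (t f \o[(size s).+2] u).
    by rewrite size_cat size_map addn1.
  transitivity (t (iter (size s).+2 t f \o[1] u)); last by [].
  rewrite (orot_ocmp1_0 HP) ?ar_iter_orot ?arf // -!iterS.
  by have := orot_order HP f; rewrite arf !iterS => ->.
rewrite {s}sE in v *.
have vb := vl_cut x (z :: A) C v x01 A1 C1.
have /andP[z1 A1'] : (z < 1) && all (<%R^~ 1) A := A1.
have v2 : vl (z :: A ++ (C ++ [:: x + 1])) by vtac.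
have -> : ((z :: A) ++ C) ++ [:: x + 1] = z :: A ++ (C ++ [:: x + 1]).
  by rewrite /= catA.
rewrite extE //; first last.
- by rewrite all_cat C1 /=; lra.
- by rewrite z1 andbT; vtac.
rewrite (extE _ x (z :: A)) // map_cat -catA /= addrK.
have arf := bas_ar HB vb.
set f := B _ in arf *.
have {}arf : ar f = (size C + (size A).+2)%N.
  by rewrite arf size_cat size_map.
rewrite (orot_ocmp HP) ?ar_orot ?ar_iter_orot ?arf /=; last by nlia.
by rewrite size_cat /= addn1.
Qed.

Lemma ext_triv x : 0 <= x < 1 -> ev x (x + 1) -> ext B [:: x] = u.
Proof.
move=> x01 xx; have [x0 x1] := andP x01.
have ex1 : ev x 1 by apply: (ev_convex Hev) xx; lra.
have e1x : ev 1 (x + 1) by apply: (ev_trans Hev) xx; apply: ev_sym ex1.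
have e0x : ev 0 x.
  by have := ev_shift_int Hev (-1) e1x; rewrite /= subrr addrK.
rewrite -[[:: x]]/(x :: [::] ++ [::]) extE //= (bas_first HB _ e0x); last first.
  by vtac; lra.
rewrite (bas_triv HB (ev_trans Hev e0x ex1)) (oprod_ur HP) orot_iel //.
by rewrite ocmp1l.
Qed.

Lemma ext_cyclic : cyclic_family ev (ext B).
Proof.
have norm x : exists n : int, 0 <= x - n%:~R < 1.
  exists (Num.floor x); have := floor_itv x; rewrite intrD; lra.
have ev_sub n x y : ev x y -> ev (x - n%:~R) (y - n%:~R).
  by move=> /(ev_shift_int Hev (- n)); rewrite mulrNz.
have exts n s : ext B s = ext B (map (+%R^~ (- n%:~R)) s).
  by rewrite -(ext_shift B (- n)) mulrNz.
split.
- move=> x s v; have [n xn] := norm x; rewrite (exts n) (ext_ar HB) ?size_map //.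
  by rewrite -(vl_shift _ (- n%:~R)) in v.
- move=> x z s v; have [n xn] := norm x; rewrite (exts n) [in RHS](exts n).
  apply: (ext_del1 HP HB) => //.
  by rewrite -(vl_shift _ (- n%:~R)) in v.
- move=> x z z' s v e; have [n xn] := norm x.
  rewrite (exts n) [in RHS](exts n).
  apply: ext_dbl1 => //; last exact: ev_sub.
  by rewrite -(vl_shift _ (- n%:~R)) in v.
- move=> x s v; have [n xn] := norm x.
  rewrite (exts n) [in RHS](exts n) /= map_cat /= addrAC.
  apply: ext_rot => //.
  by rewrite -(vl_shift _ (- n%:~R)) in v.
- move=> x e; have [n xn] := norm x.
  rewrite (exts n) /= ext_triv // addrAC; exact: ev_sub.
Qed.

(** [ext] counts inputs equal to 1 as lying past the cut, although they are genuine inputs of [B].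
    They are stripped off one at a time as right factors [id1]. *)
Lemma ext_base s : vl (0 :: s) -> ext B (0 :: s) = B s.
Proof.
move=> v; have [A [C [sE A1 C1]]] := vl_split 1 v.
rewrite {s}sE in v *.
elim/last_ind: C v C1 => [|C z IH] v C1.
  rewrite extE // ?lexx ?ltr01 //= (bas_first HB); last 2 first.
  - by rewrite cats0 in v; vtac.
  - exact: ev_refl.
  have vA : vl (0 :: A) by vtac.
  rewrite cats0 (orot_oprod_il HP) -[(size A).+1]addn1 -(bas_ar HB vA).
  by rewrite (oprod_ocmpr HP) // (ocmp1l HP) (oprod_ur HP).
rewrite -cats1 in v C1 *.
have [z1 C1'] : 1 <= z /\ all (<=%R 1) C.
  by move: C1; rewrite all_cat /= andbT => /andP[].
have zE : z = 1 by vtac; apply/eqP; rewrite eq_le z1 andbT; lra.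
rewrite zE in v *; rewrite !catA in v *.
rewrite (cyc_tail_dbl HP Hev ext_cyclic v); last by rewrite add0r; apply: ev_refl.
rewrite (bas_last HB v); last exact: ev_refl.
by rewrite IH //; vtac.
Qed.

End ExtensionTheory.

Arguments ext_cyclic {R O P} HP {ev B} Hev HB.
Arguments ext_base {R O P} HP {ev B} Hev HB {s} _.

(** * Joins of families on complementary arcs *)

Section Joins.
Context {R : realType} {O : nat -> topologicalType} {P : cyc_op_mult O}.
Context (HP : is_cyc_op_mult P).
Local Notation "a '\o[' i ] b" := (ocmp P i a b)
  (at level 40, i at level 0, left associativity, format "a  '\o[' i ]  b").
Local Notation u := (uel P).
Local Notation id1 := (iel P).
Local Notation "a ⋅ b" := (oprod P a b) (at level 40, left associativity).
Local Notation T := (opel O).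
Local Notation cyclic_family := (@cyclic_family R O P).

Implicit Types (x y z : R) (s A C : seq R) (ev : R -> R -> Prop).
Implicit Types G : seq R -> T.

(* A lift to the line of a weakly monotone map of degree one of the circle. *)
Record circle_lift (f : R -> R) : Prop := Lift {
  lift_le : forall x y, x <= y -> f x <= f y;
  lift1 : forall x, f (x + 1) = f x + 1;
  lift_onto : forall y, exists x, f x = y
}.

Lemma lift_shift c : circle_lift (+%R^~ c).
Proof.
split=> [x y|x|y]; first by rewrite lerD2r.
- by rewrite addrAC.
- by exists (y - c); rewrite subrK.
Qed.

Lemma lift_comp f g : circle_lift f -> circle_lift g -> circle_lift (f \o g).
Proof.
move=> [f1 f2 f3] [g1 g2 g3]; split=> [x y xy|x|y] /=.
- exact/f1/g1.
- by rewrite g2 f2.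
- by have [x <-] := f3 y; have [z <-] := g3 x; exists z.
Qed.

Lemma lift_vl f s : circle_lift f -> vl s -> vl (map f s).
Proof.
move=> Hf; case: s => // x s; rewrite /vl /= -(lift1 _ Hf).
have -> : map f s ++ [:: f (x + 1)] = map f (s ++ [:: x + 1]).
  by rewrite map_cat.
rewrite all_map => /andP[xs ps]; apply/andP; split.
  by apply: sub_all xs => y; apply: lift_le.
by rewrite pairwise_map; apply: sub_pairwise ps => y z; apply: lift_le.
Qed.

Lemma cyclic_pull ev G f : cyclic_family ev G -> circle_lift f ->
  cyclic_family (fun x y => ev (f x) (f y)) (fun s => G (map f s)).
Proof.
move=> HG Hf; split=> [x s|x z s|x z z' s|x s|x].
- by move=> /(lift_vl f _ Hf) v; rewrite (cyc_ar HG v) size_map.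
- by move=> /(lift_vl f _ Hf) v; apply: (cyc_del1 HG v).
- by move=> /(lift_vl f _ Hf) v; apply: (cyc_dbl1 HG v).
- move=> /(lift_vl f _ Hf) v; rewrite map_cat /= lift1 //.
  exact: (cyc_rot HG v).
- by rewrite lift1 //; apply: (cyc_triv HG).
Qed.

Lemma cyclic_sub ev ev' G : (forall x y, ev' x y -> ev x y) ->
  cyclic_family ev G -> cyclic_family ev' G.
Proof.
move=> sub HG; split=> [x s|x z s|x z z' s v /sub|x s|x /sub].
- by move=> v; exact (cyc_ar HG v).
- by move=> v; exact (cyc_del1 HG v).
- by move=> e; exact (cyc_dbl1 HG v e).
- by move=> v; exact (cyc_rot HG v).
- by move=> e; exact (cyc_triv HG e).
Qed.

Lemma convex_equiv_lift f : circle_lift f -> convex_equiv (fun x y => f x = f y).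
Proof.
move=> Hf; split=> [//|x y -> //|y x z -> //|x y z xy yz xz|x y].
- apply/eqP; rewrite eq_le (lift_le _ Hf) //= xz; exact: lift_le Hf _ _ yz.
- by rewrite !lift1 //; split=> [->//|/addIr].
Qed.

Lemma convex_equiv_pull f ev : circle_lift f -> convex_equiv ev ->
  convex_equiv (fun x y => ev (f x) (f y)).
Proof.
move=> Hf [r s tr c sh]; split=> [x|x y|y x z|x y z xy yz|x y].
- exact: r.
- exact: s.
- exact: tr.
- by apply: c; apply: lift_le.
- by rewrite !lift1.
Qed.

Lemma convex_equivI ev1 ev2 : convex_equiv ev1 -> convex_equiv ev2 ->
  convex_equiv (fun x y => ev1 x y /\ ev2 x y).
Proof.
move=> [r s tr c sh] [r' s' tr' c' sh']; split=> [x|x y|y x z|x y z xy yz|x y].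
- by split.
- by move=> [/s ? /s' ?].
- by move=> [a b] [/(tr _ _ _ a) ? /(tr' _ _ _ b) ?].
- by move=> [/(c _ _ _ xy yz) ? /(c' _ _ _ xy yz) ?].
- split=> -[a b]; split; [exact: (sh x y).1 a|exact: (sh' x y).1 b|exact: (sh x y).2 a|exact: (sh' x y).2 b].
Qed.

(** The iterated multiplication, that is, the image of the point of [Ass]: the family of a lobe that
    never moves, and the unit for gluing. *)
Definition const_family (y : seq R) : T := iter (size y).-1 (oprod P id1) u.

Lemma const_cyclic ev : cyclic_family ev const_family.
Proof.
have arc n : ar (iter n (oprod P id1) u : T) = n.
  by elim: n => // n IH; rewrite iterS ar_oprod IH.
have comm n : iter n (oprod P id1) u ⋅ id1 = iter n.+1 (oprod P id1) u.
  elim: n => [|n IH]; first by rewrite /= (oprod_ul HP) (oprod_ur HP).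
  by rewrite [in LHS]/= -(oprodA HP) IH.
split=> [x s _|x z s _|x z z' s _ _|x s _|//]; rewrite /const_family /=.
- exact: arc.
- by rewrite (oprod_ocmpl HP) // (ocmp1l HP) (oprod_ul HP).
- by rewrite (oprod_ii_ocmp1 HP).
rewrite size_cat addn1 /=; elim: (size s) => [|n IH] /=.
  by have := orot_order HP u.
by rewrite (orot_oprod_il HP) comm.
Qed.

(* [G] is glued from [G2], which only moves on the arc [[p, q]], and [G1],
   which only moves on the complementary arc [[q, p + 1]]: based at the wedge
   point [p], it is the cup product of [G2] and [G1]. *)
Definition is_join ev G1 G2 p q G : Prop := cyclic_family ev G /\
  forall A C, vl (p :: A ++ C) -> all (<=%R^~ q) A -> all (<=%R q) C ->
    G (p :: A ++ C) = G2 (p :: A) ⋅ G1 (p :: C).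

Section JoinExists.
Context {ev1 ev2 : R -> R -> Prop} {G1 G2 : seq R -> T} {q : R}.
Context (H1 : convex_equiv ev1) (H2 : convex_equiv ev2).
Context (HG1 : cyclic_family ev1 G1) (HG2 : cyclic_family ev2 G2).
Context (q0 : 0 <= q) (q1 : q <= 1) (e1 : ev1 0 q) (e2 : ev2 q 1).
Let ev x y := ev1 x y /\ ev2 x y.

Let cup s := G2 (0 :: [seq z <- s | z < q]) ⋅ G1 (0 :: [seq z <- s | q <= z]).

Let cupE A C : all (<%R^~ q) A -> all (<=%R q) C ->
  cup (A ++ C) = G2 (0 :: A) ⋅ G1 (0 :: C).
Proof.
move=> Aq qC; rewrite /cup !filter_cat.
have -> : [seq z <- A | z < q] = A by apply/all_filterP.
have -> : [seq z <- C | q <= z] = C by apply/all_filterP.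
have -> : [seq z <- A | q <= z] = [::].
  rewrite -(filter_pred0 A); apply: eq_in_filter => z /(allP Aq) /= z1.
  by rewrite leNgt z1.
have -> : [seq z <- C | z < q] = [::].
  rewrite -(filter_pred0 C); apply: eq_in_filter => z /(allP qC) /= z1.
  by rewrite ltNge z1.
by rewrite cats0.
Qed.

Let cup_based : @based_family R O P ev cup.
Proof.

split.
- move=> s v; have [A [C [sE Aq qC]]] := vl_split q v.
  rewrite {s}sE in v *; rewrite cupE // ar_oprod size_cat.
  have v2 : vl (0 :: A) by vtac.
  have v1 : vl (0 :: C) by vtac.
  by rewrite (cyc_ar HG1 v1) (cyc_ar HG2 v2).
- move=> A z C v; have [zq|qz] := ltP z q.
    have vC : vl (0 :: C) by vtac.
    have [C1 [C2 [CE C1q qC2]]] := vl_split q vC.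
    have Aq : all (<%R^~ q) A.
      have : all (<=%R^~ z) A by vtac.
      by apply: sub_all => y /=; lra.
    rewrite {}CE in v vC *.
    have Aq1 : all (<%R^~ q) (A ++ C1) by rewrite all_cat Aq.
    have Aq2 : all (<%R^~ q) (A ++ z :: C1) by rewrite all_cat Aq /= zq.
    rewrite catA cupE // -[A ++ z :: C1 ++ C2]/(A ++ (z :: C1) ++ C2) catA cupE //.
    have v2 : vl (0 :: A ++ z :: C1) by vtac.
    rewrite (oprod_ocmpl HP) -?(cyc_del HP HG2 v2) //.
    by rewrite (cyc_ar HG2 v2) size_cat /=; nlia.
  have vA : vl (0 :: A) by vtac.
  have [A1 [A2 [AE A1q qA2]]] := vl_split q vA.
  have qC : all (<=%R q) C by vtac.
  rewrite {}AE in v vA *.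
  have qC1 : all (<=%R q) (A2 ++ C) by rewrite all_cat qA2.
  have qC2 : all (<=%R q) (A2 ++ z :: C) by rewrite all_cat qA2 /= qz.
  rewrite -!catA !cupE //.
  have v1 : vl (0 :: A2 ++ z :: C) by vtac.
  have v2 : vl (0 :: A1) by vtac.
  rewrite (cyc_del HP HG1 v1) -(oprod_ocmpr HP); last first.
    by rewrite (cyc_ar HG1 v1) size_cat /=; nlia.
  by rewrite (cyc_ar HG2 v2) size_cat; congr (_ \o[_] _); nlia.
- move=> A z z' C v [e1z e2z].
  have zz' : z <= z' by vtac.
  have z0 : 0 <= z by vtac.
  have z1 : z' <= 1 by vtac.
  have [zq'|qz'] := ltP z' q.
    have vC : vl (0 :: C) by vtac.
    have [C1 [C2 [CE C1q qC2]]] := vl_split q vC.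
    have zq : z < q by lra.
    have Aq : all (<%R^~ q) A.
      have : all (<=%R^~ z) A by vtac.
      by apply: sub_all => y /=; lra.
    rewrite {}CE in v vC *.
    have Aq1 : all (<%R^~ q) (A ++ z :: C1) by rewrite all_cat Aq /= zq.
    have Aq2 : all (<%R^~ q) (A ++ z :: z' :: C1).
      by rewrite all_cat Aq /= zq zq'.
    rewrite -[A ++ z :: C1 ++ C2]/(A ++ (z :: C1) ++ C2).
    rewrite -[A ++ z :: z' :: C1 ++ C2]/(A ++ (z :: z' :: C1) ++ C2).
    rewrite !catA !cupE //.
    have v2 : vl (0 :: A ++ z :: z' :: C1) by vtac.
    have v3 : vl (0 :: A ++ z :: C1) by vtac.
    rewrite (oprod_ocmpl HP) -?(cyc_dbl HP HG2 v2) //.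
    by rewrite (cyc_ar HG2 v3) size_cat /=; nlia.
  have vA : vl (0 :: A) by vtac.
  (* When [q] separates [z] from [z'], the former is equal to 1 for [G2] and the latter to 0 for
     [G1]. Each contributes a factor [id1], and [id1 ⋅ id1 = m]. *)
  have [zq|qz] := ltP z q.
    have Aq : all (<%R^~ q) A.
      have : all (<=%R^~ z) A by vtac.
      by apply: sub_all => y /=; lra.
    have qC : all (<=%R q) C by vtac.
    have Aq1 : all (<%R^~ q) (A ++ [:: z]) by rewrite all_cat Aq /= zq.
    have qC1 : all (<=%R q) (z' :: C) by rewrite /= qz'.
    rewrite -[A ++ z :: z' :: C]/(A ++ [:: z] ++ (z' :: C)).
    rewrite -[A ++ z :: C]/(A ++ [:: z] ++ C) !catA !cupE //.
    have v2 : vl (0 :: A ++ [:: z]) by vtac.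
    have v1 : vl (0 :: z' :: C) by vtac.
    have ez1 : ev2 z (0 + 1).
      rewrite add0r; apply: (ev_trans H2) e2.
      by apply: (ev_convex H2) e2z => //; exact: ltW.
    have e0z' : ev1 0 z'.
      by apply: (ev_trans H1) e1z; apply: (ev_convex H1) e1 => //; exact: ltW.
    rewrite (cyc_tail_dbl HP H2 HG2 v2 ez1) (cyc_head_dbl HP HG1 v1 e0z').
    have <- : (ar (G2 (0%R :: A)) + 1)%N = (size A).+1.
      by rewrite (cyc_ar HG2 vA) addn1.
    rewrite (oprod_ocmpl HP); last by rewrite ar_oprod addn1 /= ?addn1.
    rewrite (oprod_ocmpr HP) // (ocmp1l HP).
    by rewrite -(oprod_ii HP) !(oprodA HP).
  have [A1 [A2 [AE A1q qA2]]] := vl_split q vA.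
  have qC : all (<=%R q) C by vtac.
  rewrite {}AE in v vA *.
  have qC1 : all (<=%R q) (A2 ++ z :: C) by rewrite all_cat qA2 /= qz.
  have qC2 : all (<=%R q) (A2 ++ z :: z' :: C).
    by rewrite all_cat qA2 /= qz qz'.
  rewrite -!catA !cupE //.
  have v1 : vl (0 :: A2 ++ z :: z' :: C) by vtac.
  have v3 : vl (0 :: A2 ++ z :: C) by vtac.
  have v2 : vl (0 :: A1) by vtac.
  rewrite (cyc_dbl HP HG1 v1 e1z) -(oprod_ocmpr HP); last first.
    by rewrite (cyc_ar HG1 v3) size_cat /=; nlia.
  by rewrite (cyc_ar HG2 v2) size_cat; congr (_ \o[_] _); nlia.
- move=> z C v [e1z e2z].
  have z0 : 0 <= z by vtac.
  have vC : vl (0 :: C) by vtac.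
  have [zq|qz] := ltP z q.
    have [C1 [C2 [CE C1q qC2]]] := vl_split q vC.
    rewrite {}CE in v vC *.
    have zC1 : all (<%R^~ q) (z :: C1) by rewrite /= zq.
    rewrite -[z :: C1 ++ C2]/((z :: C1) ++ C2) !cupE //.
    have v2 : vl (0 :: z :: C1) by vtac.
    by rewrite (cyc_head_dbl HP HG2 v2 e2z) -(oprodA HP).
  have zC : all (<=%R q) (z :: C) by rewrite /= qz; vtac.
  have /andP[_ qC] : (q <= z) && all (<=%R q) C := zC.
  have := cupE [::] (z :: C) isT zC; have := cupE [::] C isT qC.
  rewrite !cat0s => -> ->; rewrite (cyc_head_dbl HP HG1 v e1z).
  rewrite (cyc_triv HG2) ?(oprod_ul HP) // add0r.
  by apply: (ev_trans H2) e2; apply: (ev_convex H2) e2z.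
- move=> A z v [e1z e2z].
  have z1 : z <= 1 by vtac.
  have z0 : 0 <= z by vtac.
  have vA : vl (0 :: A) by vtac.
  have [zq|qz] := ltP z q.
    have Aq : all (<%R^~ q) A.
      have : all (<=%R^~ z) A by vtac.
      by apply: sub_all => y /=; lra.
    have Az : all (<%R^~ q) (A ++ [:: z]) by rewrite all_cat Aq /= zq.
    have := cupE (A ++ [:: z]) [::] Az isT; have := cupE A [::] Aq isT.
    rewrite !cats0 => -> ->; rewrite (cyc_tail_dbl HP H2 HG2 v) ?add0r //.
    rewrite (cyc_triv HG1) ?(oprod_ur HP) // add0r.
    by apply: (ev_trans H1) e1z; apply: (ev_convex H1) e1 => //; exact: ltW.
  have [A1 [A2 [AE A1q qA2]]] := vl_split q vA.
  rewrite {}AE in v vA *.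
  have zA2 : all (<=%R q) (A2 ++ [:: z]) by rewrite all_cat qA2 /= qz.
  rewrite -catA !cupE //.
  have v1 : vl (0 :: A2 ++ [:: z]) by vtac.
  by rewrite (cyc_tail_dbl HP H1 HG1 v1) ?add0r // (oprodA HP).
- move=> [e1' e2']; have := cupE [::] [::] isT isT => /= ->.
  by rewrite (cyc_triv HG1) ?(cyc_triv HG2) ?(oprod_ul HP) // add0r.
Qed.

(** [cup] hands inputs equal to [q] to [G1], whereas [is_join] allows them on either side. On both
    sides such an input is a factor [id1] in the middle of the product, so they can be moved across
    one by one. *)
Lemma join_exists0 : exists G, is_join ev G1 G2 0 q G.
Proof.

have Hev := convex_equivI _ _ H1 H2.
exists (ext P cup); split; first exact: (ext_cyclic HP Hev cup_based).
move=> A C v Aq qC; rewrite (ext_base HP Hev cup_based) //.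
have vA : vl (0 :: A) by vtac.
have [A1 [A2 [AE A1q qA2]]] := vl_split q vA.
rewrite {A}AE in v vA Aq *.
have {Aq qA2}A2q : all (pred1 q) A2.
  have : all (<=%R^~ q) A2 by move: Aq; rewrite all_cat => /andP[].
  move=> /allP A2q'; apply/allP => y yA2 /=.
  by rewrite eq_le (allP qA2 _ yA2) (A2q' _ yA2).
elim/last_ind: A2 A2q C v vA qC => [|A2 z IH] A2q C v vA qC.
  by rewrite cats0 cupE.
rewrite -cats1 in A2q v vA *.
have [zq A2q'] : z = q /\ all (pred1 q) A2.
  by move: A2q; rewrite all_cat /= andbT => /andP[? /eqP].
rewrite {z}zq in v vA A2q *; rewrite -!catA -?[[:: q] ++ C]/(q :: C) in v vA *.
rewrite catA IH //; [|by vtac|by vtac|by rewrite /= lexx].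
have v1 : vl (0 :: q :: C) by vtac.
have v2 : vl (0 :: (A1 ++ A2) ++ [:: q]) by vtac.
rewrite (cyc_head_dbl HP HG1 v1 e1) !catA.
by rewrite (cyc_tail_dbl HP H2 HG2 v2) ?add0r // (oprodA HP).
Qed.

End JoinExists.

Lemma join_exists ev1 ev2 G1 G2 p q :
  convex_equiv ev1 -> convex_equiv ev2 ->
  cyclic_family ev1 G1 -> cyclic_family ev2 G2 ->
  p <= q <= p + 1 -> ev1 p q -> ev2 q (p + 1) ->
  exists G, is_join (fun x y => ev1 x y /\ ev2 x y) G1 G2 p q G.
Proof.
move=> H1 H2 HG1 HG2 /andP[pq qp] e1 e2.
have Hp := lift_shift p; have Hp' := lift_shift (- p).
have K1 := convex_equiv_pull _ _ Hp H1; have K2 := convex_equiv_pull _ _ Hp H2.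
have [| | |G [HG GE]] := join_exists0 (q := q - p) K1 K2
  (cyclic_pull _ _ _ HG1 Hp) (cyclic_pull _ _ _ HG2 Hp);
  try by rewrite ?subr_ge0 ?lerBlDl ?add0r ?subrK // addrC.
exists (fun s => G (map (+%R^~ (- p)) s)); split.
  apply: (cyclic_sub _ _ _ _ (cyclic_pull _ _ _ HG Hp')) => x y.
  by rewrite !subrK.
move=> A C v Aq qC; rewrite /= subrr map_cat GE; first last.
- by rewrite all_shift opprK subrK.
- by rewrite all_shift_le opprK subrK.
- by have := lift_vl _ _ Hp' v; rewrite /= subrr map_cat.
by rewrite /= add0r -!map_comp; congr (G2 (_ :: _) ⋅ G1 (_ :: _));
  rewrite -[RHS]map_id; apply: eq_map => y /=; rewrite subrK.
Qed.

End Joins.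

Arguments lift_le {R f} _ {x y} _.
Arguments lift1 {R f} _ x.
Arguments lift_onto {R f} _ y.
Arguments lift_vl {R f s} _ _.
Arguments cyclic_pull {R O P ev G f} _ _.
Arguments cyclic_sub {R O P ev ev' G} _ _.
Arguments convex_equiv_lift {R f} _.
Arguments convex_equiv_pull {R f ev} _ _.
Arguments convex_equivI {R ev1 ev2} _ _.
Arguments const_family {R O} P y.
Arguments const_cyclic {R O P} HP ev.
Arguments is_join {R O} P ev G1 G2 p q G.
Arguments join_exists {R O P} HP {ev1 ev2 G1 G2 p q} _ _ _ _ _ _ _.

(** * Uniqueness, symmetry, shrinking and commutation of joins *)

Section JoinTheory.
Context {R : realType} {O : nat -> topologicalType} {P : cyc_op_mult O}.
Context (HP : is_cyc_op_mult P).
Local Notation "a '\o[' i ] b" := (ocmp P i a b)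
  (at level 40, i at level 0, left associativity, format "a  '\o[' i ]  b").
Local Notation "a ⋅ b" := (oprod P a b) (at level 40, left associativity).
Local Notation T := (opel O).
Local Notation cyclic_family := (@cyclic_family R O P).

Implicit Types (x y z : R) (s A C : seq R) (ev : R -> R -> Prop).
Implicit Types G : seq R -> T.

Local Notation is_join := (is_join P).

Lemma join_unique ev ev' G1 G2 G1' G2' p q G G' :
  is_join ev G1 G2 p q G -> is_join ev' G1' G2' p q G' ->
  p <= q <= p + 1 ->
  (forall s, vl s -> G1 s = G1' s) -> (forall s, vl s -> G2 s = G2' s) ->
  forall s, vl s -> G s = G' s.
Proof.
move=> [HG GE] [HG' GE'] /andP[pq qp] E1 E2.
apply: (cyclic_ext HP p HG HG') => s v.
have [A [C [sE Aq qC]]] := vl_split q v; rewrite {s}sE in v *.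
have Aq' : all (<=%R^~ q) A by apply: sub_all Aq => y /ltW.
rewrite GE // GE' //.
have v1 : vl (p :: A) by vtac.
have v2 : vl (p :: C) by vtac.
by rewrite E1 // E2.
Qed.

Lemma join_congr ev G1 G2 G1' G2' p q G : is_join ev G1 G2 p q G ->
  (forall s, vl s -> G1 s = G1' s) -> (forall s, vl s -> G2 s = G2' s) ->
  is_join ev G1' G2' p q G.
Proof.
move=> [HG GE] E1 E2; split=> // A C v Aq qC; rewrite GE // E1 ?E2 //.
  by vtac.
by vtac.
Qed.

Lemma join_pull ev G1 G2 p q p' q' G f : is_join ev G1 G2 p q G -> circle_lift f ->
  f p' = p -> f q' = q ->
  is_join (fun x y => ev (f x) (f y)) (G1 \o map f) (G2 \o map f) p' q'
    (G \o map f).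
Proof.
move=> [HG GE] Hf fp fq; split; first exact: cyclic_pull HG Hf.
move=> A C v Aq qC /=; rewrite fp map_cat GE //.
- by have := lift_vl Hf v; rewrite /= fp map_cat.
- by rewrite all_map; apply: sub_all Aq => y /= /(lift_le Hf); rewrite fq.
- by rewrite all_map; apply: sub_all qC => y /= /(lift_le Hf); rewrite fq.
Qed.

Lemma join_shift ev G1 G2 p q G (n : int) :
  (exists ev1, cyclic_family ev1 G1) -> (exists ev2, cyclic_family ev2 G2) ->
  is_join ev G1 G2 p q G -> is_join ev G1 G2 (p + n%:~R) (q + n%:~R) G.
Proof.
move=> [ev1 HG1] [ev2 HG2] [HG GE]; split=> // A C v Aq qC.
have e s : p + n%:~R :: s =
    map (+%R^~ n%:~R) (p :: map (+%R^~ (- n%:~R)) s) by rewrite /= map_shiftK.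
have v' : vl (p :: map (+%R^~ (- n%:~R)) A ++ map (+%R^~ (- n%:~R)) C).
  by move: v; rewrite -(vl_shift _ (- n%:~R)) /= addrK map_cat.
have v1 : vl (p :: map (+%R^~ (- n%:~R)) A).
  have : vl (p + n%:~R :: A) by vtac.
  by rewrite -(vl_shift _ (- n%:~R)) /= addrK.
have v2 : vl (p :: map (+%R^~ (- n%:~R)) C).
  have : vl (p + n%:~R :: C) by vtac.
  by rewrite -(vl_shift _ (- n%:~R)) /= addrK.
rewrite (e (A ++ C)) (e A) (e C) map_cat (cyc_shift HP HG) //.
rewrite (cyc_shift HP HG1) // (cyc_shift HP HG2) // GE //.
- by rewrite all_shift_le opprK.
- by rewrite all_shift opprK.
Qed.

(** Seen from an output outside the arc, the wedge point is an input of [G1] into which the leaf is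
    plugged. To deduce this from the cup product, [p] is added as an input and rotated to the base;
    a second copy of [p] in [G1] then turns the product into an insertion, and the added input is
    deleted at the end. *)
Lemma join_insert ev ev1 G1 G2 p q G x A B C :
  convex_equiv ev1 -> cyclic_family ev1 G1 -> is_join ev G1 G2 p q G ->
  vl (x :: A ++ p :: B ++ q :: C) ->
  G (x :: A ++ B ++ C) = G1 (x :: A ++ p :: C) \o[(size A).+1] G2 (p :: B).
Proof.
move=> H1 HG1 [HG GE] v.
have v1 : vl (x :: A ++ p :: p :: C) by vtac.
have v1' : vl (x :: A ++ p :: C) by vtac.
have v2 : vl (x :: A ++ p :: (B ++ C)) by vtac.
have v3 : vl (p :: B) by vtac.
have v4 : vl (p :: B ++ (C ++ x + 1 :: map (+%R^~ 1) A)) by vtac.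
have v5 : vl (p :: p :: C ++ x + 1 :: map (+%R^~ 1) A) by vtac.
have Bq : all (<=%R^~ q) B by vtac.
have qC : all (<=%R q) (C ++ x + 1 :: map (+%R^~ 1) A) by vtac.
have main : G (x :: A ++ p :: (B ++ C)) =
    G1 (x :: A ++ p :: p :: C) \o[(size A).+2] G2 (p :: B).
  apply: (@iter_orot_inj _ _ HP (size A).+1).
  rewrite (cyc_rotn HG v2) -catA GE //.
  rewrite (iter_orot_ocmp HP); last first.
    by rewrite (cyc_ar HG1 v1) size_cat /=; nlia.
  rewrite (cyc_rotn HG1 v1) -[p :: C ++ _]/(p :: C ++ _).
  have -> : ((size A).+2 - (size A).+1 = 1)%N by nlia.
  rewrite (cyc_head_dbl HP HG1 v5); last exact: (ev_refl H1).
  by rewrite (oprod_ocmpl HP) // (ocmp1l HP).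
rewrite (cyc_del HP HG v2) main -(ocmp_par0 HP) ?ltnS ?leqnn //; last first.
  by rewrite (cyc_ar HG1 v1) size_cat /=; nlia.
by rewrite /= -(cyc_del HP HG1 v1).
Qed.

Section TwoFamilies.
Context {ev1 ev2 : R -> R -> Prop} {G1 G2 : seq R -> T} {p q : R}.
Context (H1 : convex_equiv ev1) (H2 : convex_equiv ev2).
Context (HG1 : cyclic_family ev1 G1) (HG2 : cyclic_family ev2 G2).
Context (pq : p <= q) (qp : q <= p + 1) (e1 : ev1 p q) (e2 : ev2 q (p + 1)).

Let ev_2pred : ev2 (q - 1) p.
Proof. by apply/(ev_shift H2); rewrite subrK. Qed.

(** The two sides of a wedge play the same role. This exchanges an arc for its complement when the
    output lies inside the arc. *)
Lemma join_sym G : is_join (fun x y => ev1 x y /\ ev2 x y) G1 G2 p q G ->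
  is_join (fun x y => ev2 x y /\ ev1 x y) G2 G1 (q - 1) p G.
Proof.
move=> J; have [HG GE] := J; split.
  by apply: cyclic_sub HG => x y [].
move=> A C v Ap pC.
have lepq := pq; have leqp := qp.
have v1 : vl (q - 1 :: A ++ p :: C ++ q :: [::]) by vtac.
have v2 : vl (q - 1 :: A ++ [:: p]) by vtac.
have v3 : vl (q - 1 :: A) by vtac.
have v4 : vl (q - 1 :: C) by vtac.
have v5 : vl (p :: C) by vtac.
have := join_insert _ _ _ _ _ _ _ _ _ _ _ H1 HG1 J v1; rewrite cats0 => ->.
rewrite (cyc_tail_dbl HP H1 HG1 v2); last by rewrite subrK.
have <- : (ar (G1 ((q - 1)%R :: A)) + 1)%N = (size A).+1.
  by rewrite (cyc_ar HG1 v3) addn1.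
rewrite (oprod_ocmpr HP) // (ocmp1l HP); congr (_ ⋅ _); apply/esym.
by apply: (cyc_head_move HP HG2) => //; apply/andP; split; lra.
Qed.

(** Neither family moves on the parts of the arc that are cut off. The join over the smaller arc is
    compared with [G] at the output [p], after merging the inputs that lie in those parts. *)
Lemma join_shrink p' q' G :
  is_join (fun x y => ev1 x y /\ ev2 x y) G1 G2 p q G ->
  p <= p' -> p' <= q' -> q' <= q -> ev2 p p' -> ev2 q' q ->
  is_join (fun x y => ev1 x y /\ ev2 x y) G1 G2 p' q' G.
Proof.
have lepq := pq; have leqp := qp; move=> [HG GE] pp' pq' qq' e2p e2q.
have e1' x y : p <= x -> x <= y -> y <= q -> ev1 x y.
  move=> px xy yq; have px1 : ev1 p x by apply: (ev_convex H1) e1; lra.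
  have py1 : ev1 p y by apply: (ev_convex H1) e1; lra.
  exact: (ev_trans H1 (ev_sym H1 px1) py1).
have e2' : ev2 q' (p' + 1).
  apply: (ev_trans H2) e2q _; apply: (ev_trans H2) e2 _.
  exact: (ev_shift H2).1 e2p.
have pq1' : p' <= q' <= p' + 1 by apply/andP; split; lra.
have [G' J'] := join_exists HP H1 H2 HG1 HG2 pq1' (e1' _ _ pp' pq' qq') e2'.
have [HG' GE'] := J'.
suff E s : vl s -> G s = G' s.
  split=> // A C v Aq qC; rewrite E // GE' //.
move: s; apply: (cyclic_ext HP p HG HG') => s v.
have [A [s1 [sE Ap ps1]]] := vl_split p' v; rewrite {s}sE in v *.
(* Inputs before [p'] are equal to the output and split off as factors [id1]. *)
elim: A Ap v => [|a A IH] Ap v; last first.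
  have ap' : a < p' by move: Ap => /= /andP[].
  have pa : p <= a by vtac.
  have epa : ev1 p a /\ ev2 p a.
    split; first by apply: e1'; lra.
    by apply: (ev_convex H2) e2p; lra.
  rewrite (cyc_head_dbl HP HG v) // (cyc_head_dbl HP HG' v) //.
  by rewrite IH //; [move: Ap => /= /andP[]|vtac].
rewrite cat0s in v *; clear Ap.
have [B [s2 [sE Bq qs2]]] := vl_split q' v; rewrite {s1}sE in v ps1 *.
have v2' : vl (p :: s2) by vtac.
have [C [D [sE Cq qD]]] := vl_split q v2'; rewrite {s2 v2'}sE in v ps1 qs2 *.
have Bq' : all (<=%R^~ q') B by apply: sub_all Bq => y /ltW.
have pB : all (<=%R p') B by move: ps1; rewrite all_cat => /andP[].
(* Inputs between [q'] and [q] are equal to each other, so doubling removes all but one of them. *)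
have [n] := ubnP (size C).
elim: n C Cq qs2 v ps1 => // n IH [|c C] Cq qs2 v ps1 leC.
  rewrite cat0s in v *.
  have vJ : vl (p :: [::] ++ p' :: B ++ q' :: D) by vtac.
  have v1 : vl (p :: p' :: D) by vtac.
  have v3 : vl (p :: B) by vtac.
  have v4 : vl (p' :: B) by vtac.
  rewrite GE //; last by apply: sub_all Bq' => y yq'; exact: le_trans yq' qq'.
  rewrite -[B ++ D]/([::] ++ B ++ D).
  rewrite (join_insert _ _ _ _ _ _ _ _ _ _ _ H1 HG1 J' vJ) /=.
  rewrite (cyc_head_dbl HP HG1 v1); last by apply: e1'; lra.
  rewrite (oprod_ocmpl HP) // (ocmp1l HP); congr (_ ⋅ _).
  by apply: (cyc_head_move HP HG2) => //; apply/andP; split; lra.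
have cq : c < q by move: Cq => /= /andP[].
have Cq' : all (<%R^~ q) C by move: Cq => /= /andP[].
have q'c : q' <= c by move: qs2 => /= /andP[].
(* The one that remains belongs to the leaf for [G] and to the other side for [G']. In both it is a
   factor [id1] between the two families. *)
case: C leC Cq Cq' qs2 v ps1 => [|c' C] leC Cq Cq' qs2 v ps1.
  have vJ : vl (p :: [::] ++ p' :: B ++ q' :: (c :: D)) by vtac.
  have v1 : vl (p :: p' :: c :: D) by vtac.
  have v1' : vl (p :: c :: D) by vtac.
  have v3 : vl (p :: B) by vtac.
  have v3' : vl (p :: B ++ [:: c]) by vtac.
  have v4 : vl (p' :: B) by vtac.
  have -> : B ++ [:: c] ++ D = (B ++ [:: c]) ++ D by rewrite catA.
  have vG : vl (p :: (B ++ [:: c]) ++ D) by vtac.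
  rewrite GE //; last first.
    rewrite all_cat /= (ltW cq) !andbT.
    by apply: sub_all Bq' => y yq'; exact: le_trans yq' qq'.
  rewrite -catA -[B ++ [:: c] ++ D]/([::] ++ B ++ (c :: D)).
  rewrite (join_insert _ _ _ _ _ _ _ _ _ _ _ H1 HG1 J' vJ) /=.
  rewrite (cyc_head_dbl HP HG1 v1); last by apply: e1'; lra.
  rewrite (cyc_head_dbl HP HG1 v1'); last by apply: e1'; lra.
  rewrite (oprod_ocmpl HP) // (ocmp1l HP).
  rewrite (cyc_tail_dbl HP H2 HG2 v3'); last first.
    apply: (ev_trans H2) e2; apply: (ev_trans H2) (e2q).
    by apply: (ev_sym H2); apply: (ev_convex H2) e2q => //; exact: ltW.
  rewrite -(oprodA HP); congr (_ ⋅ _).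
  by apply: (cyc_head_move HP HG2) => //; apply/andP; split; lra.
have c'q : c' < q by move: Cq' => /= /andP[].
have cc' : c <= c' by vtac.
have ecc : ev1 c c' /\ ev2 c c'.
  split; first by apply: e1'; lra.
  apply: (ev_trans H2) (_ : ev2 q' c').
    by apply: (ev_sym H2); apply: (ev_convex H2) e2q => //; exact: ltW.
  by apply: (ev_convex H2) e2q; lra.
have v2 : vl (p :: B ++ (c' :: C) ++ D) by vtac.
rewrite -[B ++ [:: c, c' & C] ++ D]/(B ++ c :: c' :: (C ++ D)).
have Es : G (p :: B ++ c :: C ++ D) = G' (p :: B ++ c :: C ++ D).
  apply: (IH (c :: C)) => //.
  - by move: Cq => /= /and3P[-> _ ->].
  - by move: qs2 => /= /and3P[-> _ ->].
  - by vtac.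
  - move: ps1; rewrite !all_cat => /andP[-> /andP[/= /and3P[-> _ ->] ->]].
    by [].
by rewrite (cyc_dbl HP HG) // (cyc_dbl HP HG') // Es.
Qed.

End TwoFamilies.

(** At the wedge point of the first leaf, both sides are the product of [G1] with the family
    obtained by plugging [G2] into [G0]: inserting into the right factor commutes with multiplying
    on the left. *)
Lemma join_comm ev0 ev1 ev2 G0 G1 G2 J1 J2 L M p q p' q' :
  convex_equiv ev0 -> convex_equiv ev1 -> convex_equiv ev2 ->
  cyclic_family ev0 G0 -> cyclic_family ev1 G1 -> cyclic_family ev2 G2 ->
  is_join (fun x y => ev0 x y /\ ev1 x y) G0 G1 p q J1 ->
  is_join (fun x y => ev0 x y /\ ev2 x y) G0 G2 p' q' J2 ->
  (exists ev, is_join ev J1 G2 p' q' L) ->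
  (exists ev, is_join ev J2 G1 p q M) ->
  p <= q -> q <= p' -> p' <= q' -> q' <= p + 1 ->
  forall s, vl s -> L s = M s.
Proof.
move=> H0 H1 H2 HG0 HG1 HG2 HJ1 HJ2 [evL HL] [evM HM] pq qp' pq' qp.
have [HGL _] := HL; have [HGM ME] := HM.
apply: (cyclic_ext HP p HGL HGM) => s v.
have [A [s1 [sE Aq qs1]]] := vl_split q v; rewrite {s}sE in v *.
have v1 : vl (p :: s1) by vtac.
have [B [s2 [sE Bp ps2]]] := vl_split p' v1; rewrite {s1 v1}sE in v qs1 *.
have v1 : vl (p :: s2) by vtac.
have [C [D [sE Cq qD]]] := vl_split q' v1; rewrite {s2 v1}sE in v ps2 qs1 *.
have Aq' : all (<=%R^~ q) A by apply: sub_all Aq => y /ltW.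
have pC : all (<=%R p') C by move: ps2; rewrite all_cat => /andP[].
have qB : all (<=%R q) B by move: qs1; rewrite all_cat => /andP[].
have vL : vl (p :: (A ++ B) ++ p' :: C ++ q' :: D) by vtac.
have vJ : vl (p :: B ++ p' :: C ++ q' :: D) by vtac.
have vJ1 : vl (p :: A ++ (B ++ p' :: D)) by vtac.
have vA : vl (p :: A) by vtac.
have vB : vl (p :: B ++ p' :: D) by vtac.
have HJ1c := HJ1.1; have H01 := convex_equivI H0 H1.
rewrite ME // catA.
rewrite (join_insert _ _ _ _ _ _ _ _ _ _ _ H01 HJ1c HL vL).
rewrite (join_insert _ _ _ _ _ _ _ _ _ _ _ H0 HG0 HJ2 vJ).
rewrite -catA HJ1.2 //; last by rewrite all_cat qB /= qp'; vtac.
rewrite -(oprod_ocmpr HP); last first.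
  by rewrite (cyc_ar HG0 vB) size_cat /=; nlia.
by rewrite (cyc_ar HG1 vA) size_cat; congr (_ \o[_] _); nlia.
Qed.

(** [G2] is constant on the complementary arc, so each input there is a right factor [id1] of [G2],
    just as it is in the constant family. *)
Lemma join_const ev ev2 G1 G2 p q G : convex_equiv ev2 ->
  cyclic_family ev2 G2 -> p <= q <= p + 1 -> ev2 q (p + 1) ->
  (forall s, vl s -> G1 s = const_family P s) -> is_join ev G1 G2 p q G ->
  forall s, vl s -> G s = G2 s.
Proof.
move=> H2 HG2 /andP[pq qp] e2 E [HG GE].
apply: (cyclic_ext HP p HG HG2) => s v.
have [A [C [sE Aq qC]]] := vl_split q v; rewrite {s}sE in v *.
have Aq' : all (<=%R^~ q) A by apply: sub_all Aq => y /ltW.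
rewrite GE // E; last by vtac.
elim/last_ind: C qC v => [|C z IH] qC v.
  by rewrite cats0 /const_family /= (oprod_ur HP).
rewrite -cats1 in v qC *.
have [qC' qz] : all (<=%R q) C /\ q <= z.
  by move: qC; rewrite all_cat /= andbT => /andP.
have v' : vl (p :: (A ++ C) ++ [:: z]) by rewrite -catA.
rewrite catA (cyc_tail_dbl HP H2 HG2 v'); last first.
  have zp : z <= p + 1 by vtac.
  apply: (ev_trans H2) (e2); apply: (ev_sym H2).
  exact: (ev_convex H2) e2.
have vAC : vl (p :: A ++ C) by vtac.
rewrite -(IH qC' vAC).
rewrite -(oprodA HP); congr (_ ⋅ _); rewrite /const_family /= size_cat addn1 /=.
elim: (size C) => [|n IHn] /=; first by rewrite (oprod_ul HP) (oprod_ur HP).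
by rewrite -(oprodA HP) IHn.
Qed.

End JoinTheory.

Arguments join_unique {R O P} HP {ev ev' G1 G2 G1' G2' p q G G'} _ _ _ _ _ {s} _.
Arguments join_congr {R O P ev G1 G2 G1' G2' p q G} _ _ _.
Arguments join_pull {R O P ev G1 G2 p q} p' q' {G f} _ _ _ _.
Arguments join_shift {R O P} HP {ev G1 G2 p q G} n _ _ _.
Arguments join_insert {R O P} HP {ev ev1 G1 G2 p q G x A B C} _ _ _ _.
Arguments join_sym {R O P} HP {ev1 ev2 G1 G2 p q} _ _ _ _ _ _ _ _ {G} _.
Arguments join_shrink {R O P} HP {ev1 ev2 G1 G2 p q} _ _ _ _ _ _ _ _ p' q' {G}.
Arguments join_comm {R O P} HP {ev0 ev1 ev2 G0 G1 G2 J1 J2 L M p q p' q'}.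
Arguments join_const {R O P} HP {ev ev2 G1 G2 p q G}.

(** * Gluing the lobes of a cactus *)

Section LiftTheory.
Context {R : realType}.
Implicit Types (x y z c : R) (f : R -> R).

Lemma lift_shift_int f (n : int) x : circle_lift f ->
  f (x + n%:~R) = f x + n%:~R.
Proof.
move=> Hf.
have pos (k : nat) y : f (y + k%:R) = f y + k%:R.
  elim: k => [|k IH]; first by rewrite !addr0.
  by rewrite -natr1 !addrA (lift1 Hf) IH.
case: n => n; first exact: pos.
by apply: (addIr n.+1%:R); rewrite -pos NegzE mulrNz !subrK.
Qed.

Lemma lift_lt f x y : circle_lift f -> f x < f y -> x < y.
Proof. by move=> Hf; rewrite !ltNge; apply: contra => /(lift_le Hf). Qed.

Lemma lift_between f x y z : circle_lift f -> x <= y -> y <= z ->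
  f x = f z -> f y = f x.
Proof.
move=> Hf xy yz xz; apply/eqP; rewrite eq_le (lift_le Hf xy) andbT xz.
exact: (lift_le Hf yz).
Qed.

(** A monotone surjection has no jump: a value strictly between [c] and [f (sup E)] would be
    attained below [sup E]. So the fibre contains its supremum. *)
Lemma lift_fiber_max f c : circle_lift f ->
  exists x, f x = c /\ forall y, x < y -> c < f y.
Proof.
move=> Hf; have [x0 fx0] := lift_onto Hf c.
have [x1 fx1] := lift_onto Hf (c + 1).
pose E : set R := fun x => f x <= c.
have E0 : (E !=set0)%classic by exists x0; rewrite /E /= fx0.
have Eb : has_ubound E.
  exists x1; move=> y fy0; have fy : f y <= c := fy0; rewrite leNgt; apply/negP => /ltW.
  by move=> /(lift_le Hf); rewrite fx1; lra.
have sE : has_sup E by split.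
have gt y : sup E < y -> c < f y.
  move=> sy; rewrite ltNge; apply/negP => fy.
  by have := sup_upper_bound sE fy; rewrite leNgt sy.
exists (sup E); split=> //; apply/eqP; rewrite eq_le; apply/andP; split.
  rewrite leNgt; apply/negP => fs.
  have [y fy] := lift_onto Hf ((c + f (sup E)) / 2).
  have ys : y < sup E by apply: (lift_lt _ _ _ Hf); lra.
  have e0 : 0 < sup E - y by lra.
  have [z zE] := sup_adherent e0 sE; rewrite subKr => yz.
  have fz : f z <= c := zE.
  by have := lift_le Hf (ltW yz); lra.
have : x0 <= sup E by apply: (sup_upper_bound sE); rewrite /E /= fx0.
by move=> /(lift_le Hf); rewrite fx0.
Qed.

Lemma lift_opp f : circle_lift f -> circle_lift (fun x => - f (- x)).
Proof.
move=> Hf; split=> [x y xy|x|y].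
- by rewrite lerN2; apply: lift_le => //; rewrite lerN2.
- have := lift1 Hf (- (x + 1)); rewrite opprD subrK => ->; lra.
- have [x fx] := lift_onto Hf (- y); exists (- x); rewrite opprK fx; lra.
Qed.

Lemma lift_fiber_min f c : circle_lift f ->
  exists x, f x = c /\ forall y, y < x -> f y < c.
Proof.
move=> /lift_opp Hf; have [x [fx xP]] := lift_fiber_max _ (- c) Hf.
exists (- x); split; first by lra.
by move=> y yx; have := xP (- y); rewrite opprK; lra.
Qed.

(* Two lobes are separated when each is constant on an arc carrying all
   moves of the other. *)
Definition separated_lifts f (g : R -> R) : Prop :=
  exists p q, [/\ p <= q <= p + 1, f p = f q & g (p + 1) = g q].

(** Cut the circle at a point [x0]. Each lobe [k] then has a smallest arc from [pk k] to [qk k] that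
    carries its full turn. Of two lobes, one rests on the arc of the other, so arcs are nested or
    disjoint in effect, and a lobe other than [i] with a shortest arc is a leaf. *)
Lemma leaf_exists (phi : nat -> R -> R) (S : seq nat) i :
  (forall j, circle_lift (phi j)) ->
  {in S &, forall j k, j != k -> separated_lifts (phi j) (phi k)} ->
  i \in S -> has (predC1 i) S ->
  exists k p q, [/\ k \in S, k != i, p <= q <= p + 1, phi k q = phi k p + 1 &
    {in S, forall l, l != k -> phi l p = phi l q}].
Proof.
move=> Hphi Hsep iS /hasP[k0 k0S /= k0i].
(* Cutting where lobe [i] is about to move ensures that [i] rests on the arcs of all other lobes, so
   that [i] acts as the root. *)
have [x0 x0P] : exists x0, forall y, x0 < y -> phi i x0 < phi i y.
  by have [x [<- xP]] := lift_fiber_max _ (phi i 0) (Hphi i); exists x.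
have [pk pkP] := choice (fun k => lift_fiber_max _ (phi k x0) (Hphi k)).
have [qk qkP] := choice (fun k => lift_fiber_min _ (phi k x0 + 1) (Hphi k)).
have phi1 k : phi k (x0 + 1) = phi k x0 + 1 by rewrite lift1.
have px0 k : x0 <= pk k.
  rewrite leNgt; apply/negP => /(proj2 (pkP k)); lra.
have qx0 k : qk k <= x0 + 1.
  rewrite leNgt; apply/negP => /(proj2 (qkP k)); rewrite phi1; lra.
have pq k : pk k < qk k.
  apply: (lift_lt _ _ _ (Hphi k)); rewrite (pkP k).1 (qkP k).1; lra.
have sep0 j k : j \in S -> k \in S -> j != k -> exists r s,
    [/\ x0 <= r, r < x0 + 1, r <= s <= r + 1, phi j r = phi j s &
      phi k (r + 1) = phi k s].
  move=> jS kS jk; have [r [s [/andP[rs sr] fjr fks]]] := Hsep _ _ jS kS jk.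
  pose n := - Num.floor (r - x0).
  have := floor_itv (r - x0); rewrite intrD => /andP[n1 n2].
  exists (r + n%:~R), (s + n%:~R); rewrite /n mulrNz.
  split; rewrite -?mulrNz ?lift_shift_int // ?fjr //; rewrite ?mulrNz; try lra.
  by rewrite addrAC -mulrNz lift_shift_int // fks -lift_shift_int.
have fix_i k : k \in S -> k != i -> phi i (pk k) = phi i (qk k).
  move=> kS ki; rewrite eq_sym in ki.
  have [r [s [xr rx /andP[rs sr] ir ks]]] := sep0 _ _ iS kS ki.
  have sx : s <= x0 + 1.
    rewrite leNgt; apply/negP => xs.
    have h1 : phi i (s - 1) > phi i x0 by apply: x0P; lra.
    have h2 := lift1 (Hphi i) (s - 1); rewrite subrK in h2.
    have := lift_le (Hphi i) (ltW rx); rewrite phi1; lra.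
  have ks1 : phi k (x0 + 1) = phi k s.
    by apply: (lift_between _ _ _ (r + 1)) => //; lra.
  have qs : qk k <= s.
    rewrite leNgt; apply/negP => /(proj2 (qkP k)); rewrite -ks1 phi1; lra.
  have rp : r <= pk k.
    rewrite leNgt; apply/negP => /(proj2 (pkP k)).
    have := lift1 (Hphi k) r; rewrite ks -ks1 phi1; lra.
  have h := ltW (pq k).
  rewrite (lift_between _ r _ s) //; last by lra.
  by rewrite [RHS](lift_between _ r _ s) //; lra.
(* The separating arc either does not cross the cut [x0 + 1], and then contains the arc of [l], or
   crosses it, and then its complement contains the arc of [k]. *)
have fix_or k l : k \in S -> l \in S -> k != l ->
    phi k (pk l) = phi k (qk l) \/ phi l (pk k) = phi l (qk k).
  move=> kS lS kl.
  have [r [s [xr rx /andP[rs sr] kr ls]]] := sep0 _ _ kS lS kl.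
  have [sx|xs] := leP s (x0 + 1).
    left.
    have ls1 : phi l (x0 + 1) = phi l s.
      by apply: (lift_between _ _ _ (r + 1)) => //; lra.
    have qs : qk l <= s.
      rewrite leNgt; apply/negP => /(proj2 (qkP l)); rewrite -ls1 phi1; lra.
    have rp : r <= pk l.
      rewrite leNgt; apply/negP => /(proj2 (pkP l)).
      have := lift1 (Hphi l) r; rewrite ls -ls1 phi1; lra.
    have h := ltW (pq l).
    rewrite (lift_between _ r _ s) //; last by lra.
    by rewrite [RHS](lift_between _ r _ s) //; lra.
  right.
  have kr1 : phi k (x0 + 1) = phi k r.
    by apply: (lift_between _ _ _ s) => //; lra.
  have qr : qk k <= r.
    rewrite leNgt; apply/negP => /(proj2 (qkP k)); rewrite -kr1 phi1; lra.
  have sp : s - 1 <= pk k.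
    rewrite leNgt; apply/negP => /(proj2 (pkP k)).
    have := lift1 (Hphi k) (s - 1); rewrite subrK -kr -kr1 phi1; lra.
  have ls' : phi l (s - 1) = phi l r.
    have := lift1 (Hphi l) (s - 1); have := lift1 (Hphi l) r.
    rewrite subrK ls; lra.
  have h := ltW (pq k).
  rewrite (lift_between _ (s - 1) _ r) //; last by lra.
  by rewrite [RHS](lift_between _ (s - 1) _ r) //; lra.
have [k [kS ki kmin]] : exists k, [/\ k \in S, k != i &
    {in S, forall l, l != i -> qk k - pk k <= qk l - pk l}].
  pose S' := [seq k <- S | k != i].
  have k0S' : k0 \in S' by rewrite mem_filter k0i.
  suff [k] : exists2 k, k \in S' & {in S', forall l, qk k - pk k <= qk l - pk l}.
    rewrite mem_filter => /andP[ki kS] kmin; exists k; split=> // l lS li.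
    by apply: kmin; rewrite mem_filter li.
  move: S' k0S' => S' k0S'; clear k0i k0S; elim: S' k0 k0S' => // a s IH k0 _.
  case: s IH => [|b s] IH.
    by exists a; rewrite ?mem_head // => l; rewrite inE => /eqP ->.
  have [k ks kmin] := IH b (mem_head _ _).
  have [le|lt] := leP (qk a - pk a) (qk k - pk k).
    exists a; rewrite ?mem_head // => l; rewrite inE => /predU1P[->//|/kmin].
    exact: le_trans.
  exists k; first by rewrite inE ks orbT.
  by move=> l; rewrite inE => /predU1P[->|/kmin//]; exact: ltW.
have [pkE pkgt] := pkP k; have [qkE qklt] := qkP k.
exists k, (pk k), (qk k); split=> //.
- by apply/andP; split; [exact: ltW|have := px0 k; have := qx0 k; lra].
- by rewrite qkE pkE.
move=> l lS lk; have [->|li] := eqVneq l i; first exact: fix_i.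
rewrite eq_sym in lk; have [kpl|//] := fix_or k l kS lS lk.
have h := pq l; have h1 := px0 l; have h2 := qx0 l; have h3 := pq k.
have [plE plgt] := pkP l; have [qlE qllt] := qkP l.
have ge0 : phi k x0 <= phi k (pk l) by apply: lift_le.
have le1 : phi k (qk l) <= phi k x0 + 1 by rewrite -phi1; apply: lift_le.
(* Lobe [k] rests on the arc of [l]. If it rests there at an end value, the arc of [l] lies wholly
   before or after that of [k], and [l] rests on the latter. Otherwise the arc of [l] is strictly
   inside that of [k], against minimality. *)
have [e0|g0] := eqVneq (phi k (pk l)) (phi k x0).
  have qp : qk l <= pk k.
    by rewrite leNgt; apply/negP => /pkgt; rewrite -kpl e0; lra.
  have a1 : phi l (qk l) <= phi l (pk k) by apply: lift_le.
  have a2 : phi l (pk k) <= phi l (qk k) by apply: lift_le => //; lra.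
  have a3 : phi l (qk k) <= phi l (x0 + 1) by apply: lift_le.
  by rewrite phi1 in a3; lra.
have [e1|g1] := eqVneq (phi k (pk l)) (phi k x0 + 1).
  have qp : qk k <= pk l.
    by rewrite leNgt; apply/negP => /qklt; rewrite e1; lra.
  have a1 : phi l x0 <= phi l (pk k) by apply: lift_le.
  have a2 : phi l (pk k) <= phi l (qk k) by apply: lift_le => //; lra.
  have a3 : phi l (qk k) <= phi l (pk l) by apply: lift_le.
  lra.
have g0' : phi k x0 < phi k (pk l) by rewrite lt_neqAle eq_sym g0.
have g1' : phi k (qk l) < phi k x0 + 1 by rewrite lt_neqAle -kpl g1 kpl.
have pp : pk k < pk l by apply: (lift_lt _ _ _ (Hphi k)); rewrite pkE.
have qq : qk l < qk k by apply: (lift_lt _ _ _ (Hphi k)); rewrite qkE.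
by have := kmin l lS li; lra.
Qed.

End LiftTheory.

Arguments lift_shift_int {R f} n x _.
Arguments lift_lt {R f x y} _ _.
Arguments lift_between {R f} x {y} z _ _ _ _.

(** * Gluings and their independence of choices *)

Arguments leaf_exists {R phi S i} _ _ _ _.

Section Gluing.
Context {R : realType} {O : nat -> topologicalType} {P : cyc_op_mult O}.
Context (HP : is_cyc_op_mult P).
Local Notation T := (opel O).
Local Notation cyclic_family := (@cyclic_family R O P).

Implicit Types (x y z : R) (s A C : seq R) (ev : R -> R -> Prop).
Implicit Types G : seq R -> T.

Implicit Types (phi : nat -> R -> R) (Gam : nat -> seq R -> T) (S : seq nat).

Definition same_points phi S x y : Prop :=
  {in S, forall j, phi j x = phi j y}.

(** Since [j] makes its full turn on the arc, it rests on the complement [[q, p + 1]], while the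
    lobes of [S] rest on the arc: the two conditions under which a join exists. *)
Definition leaf phi S j p q : Prop :=
  [/\ p <= q <= p + 1, phi j q = phi j p + 1 &
    {in S, forall k, phi k p = phi k q}].

(* [glued phi Gam S G]: the family [G] is obtained from the lobes in [S], lobe
   [j] carrying [Gam j] along [phi j], by attaching them one leaf at a time. *)
Inductive glued phi Gam : seq nat -> (seq R -> T) -> Prop :=
| glue_nil G : cyclic_family (same_points phi [::]) G ->
    (forall s, vl s -> G s = const_family P s) -> glued phi Gam [::] G
| glue_cons j S p q G' G : glued phi Gam S G' -> leaf phi S j p q ->
    is_join P (same_points phi (j :: S)) G' (Gam j) p q G ->
    glued phi Gam (j :: S) G.

Lemma same_points_convex phi S : (forall j, circle_lift (phi j)) ->
  convex_equiv (same_points phi S).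
Proof.
move=> Hphi; split=> [x j //|x y xy j jS|y x z xy yz j jS|x y z xy yz xz j jS|x y].
- by rewrite xy.
- by rewrite xy ?yz.
- by apply/esym/(lift_between _ z) => //; apply: xz.
- split=> xy j jS; have := xy j jS; rewrite !(lift1 (Hphi j)).
    by move=> ->.
  by move=> /addIr.
Qed.

Lemma join_sub ev ev' G1 G2 p q G : (forall x y, ev' x y -> ev x y) ->
  is_join P ev G1 G2 p q G -> is_join P ev' G1 G2 p q G.
Proof. by move=> sub [HG GE]; split=> //; exact: (cyclic_sub sub HG). Qed.

Lemma cyclic_congr ev G G' : (forall s, vl s -> G s = G' s) ->
  cyclic_family ev G -> cyclic_family ev G'.
Proof.
move=> E HG; split=> [x s v|x z s v|x z z' s v e|x s v|x e].
- by rewrite -E // (cyc_ar HG v).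
- have v' : vl (x :: s) by vtac.
  by rewrite -(E _ v') -(E _ v) (cyc_del1 HG v).
- have v' : vl (x :: z :: s) by vtac.
  by rewrite -(E _ v') -(E _ v) (cyc_dbl1 HG v e).
- have v' : vl (s ++ [:: x + 1]) by case: s v => [|z s] v /=; vtac.
  by rewrite -(E _ v') -(E _ v) (cyc_rot HG v).
- have v' : vl [:: x] by vtac.
  by rewrite -(E _ v') (cyc_triv HG e).
Qed.

Section Fixed.
Context {phi : nat -> R -> R} {Gam : nat -> seq R -> T}.
Context (Hphi : forall j, circle_lift (phi j)).
Context (HGam : forall j,
  cyclic_family (fun x y => phi j x = phi j y) (Gam j)).

Lemma glue_cyclic S G : glued phi Gam S G ->
  cyclic_family (same_points phi S) G.
Proof. by case=> [G0 ? ?|j S0 p q G' G0 _ _ [? _]]. Qed.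

Lemma glue_congr S G G' : (forall s, vl s -> G s = G' s) ->
  glued phi Gam S G -> glued phi Gam S G'.
Proof.
move=> E H; case: H E => [G0 HG0 G0E|j S0 p q G1 G0 H1 L [HG0 G0E]] E.
  by constructor; [exact: (cyclic_congr _ _ _ E HG0)|move=> s v; rewrite -E ?G0E].
apply: (glue_cons _ _ _ _ p q G1) => //; split.
  exact: (cyclic_congr _ _ _ E HG0).
by move=> A C v Aq qC; rewrite -E ?G0E.
Qed.

Lemma leaf_join S j p q G1 : cyclic_family (same_points phi S) G1 ->
  leaf phi S j p q ->
  exists G, is_join P (same_points phi (j :: S)) G1 (Gam j) p q G.
Proof.
move=> HG1 [pq jq Sq].
have [| |G J] := join_exists HP (same_points_convex phi S Hphi)
  (convex_equiv_lift (Hphi j)) HG1 (HGam j) pq.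
- exact: Sq.
- by rewrite jq (lift1 (Hphi j)).
exists G; apply: join_sub J => x y xy; split; last by apply: xy; rewrite mem_head.
by move=> k kS; apply: xy; rewrite inE kS orbT.
Qed.

Lemma glue_attach S j p q G1 : glued phi Gam S G1 -> leaf phi S j p q ->
  exists G, glued phi Gam (j :: S) G /\
    is_join P (same_points phi (j :: S)) G1 (Gam j) p q G.
Proof.
move=> H1 L; have [G J] := leaf_join _ _ _ _ _ (glue_cyclic _ _ H1) L.
by exists G; split=> //; exact: (glue_cons _ _ _ _ p q G1).
Qed.

Lemma leaf_subset S S' j p q : {subset S' <= S} -> leaf phi S j p q ->
  leaf phi S' j p q.
Proof. by move=> sub [pq jq Sq]; split=> // k /sub /Sq. Qed.

(** A leaf of a set of lobes is also a leaf of every smaller set, so the attachments made after [j]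
    can be repeated without it. *)
Lemma glue_rem S G j : glued phi Gam S G ->
  exists G', glued phi Gam (rem j S) G'.
Proof.
elim=> [G0 HG0 G0E|i S0 p q G1 G0 H1 [G2 H2] L _] /=.
  by exists G0; constructor.
case: eqP => [_|_]; first by exists G1.
have L' : leaf phi (rem j S0) i p q by apply: leaf_subset L => k /mem_rem.
by have [G3 [H3 _]] := glue_attach _ _ _ _ _ H2 L'; exists G3.
Qed.

Lemma leaf_shift S j p q (n : int) : leaf phi S j p q ->
  leaf phi S j (p + n%:~R) (q + n%:~R).
Proof.
move=> [/andP[pq qp] jq Sq]; split.
- by apply/andP; split; lra.
- by rewrite !(lift_shift_int _ _ (Hphi j)) jq addrAC.
- by move=> k kS; rewrite !(lift_shift_int _ _ (Hphi k)) Sq.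
Qed.

Lemma leaf_shrink S j p q p' q' G1 G : cyclic_family (same_points phi S) G1 ->
  leaf phi S j p q ->
  is_join P (same_points phi (j :: S)) G1 (Gam j) p q G ->
  p <= p' -> p' <= q' -> q' <= q -> phi j p = phi j p' -> phi j q' = phi j q ->
  leaf phi S j p' q' /\
  is_join P (same_points phi (j :: S)) G1 (Gam j) p' q' G.
Proof.
move=> HG1 [/andP[pq qp] jq Sq] J pp' pq' qq' e1 e2; split.
  split; first by apply/andP; split; lra.
    by rewrite e2 jq e1.
  move=> k kS; have e := Sq k kS.
  rewrite (lift_between p q (Hphi k) pp' _ e); last by lra.
  by rewrite (lift_between p q (Hphi k) _ qq' e) //; lra.
have J' : is_join P (fun x y => same_points phi S x y /\ phi j x = phi j y)
    G1 (Gam j) p q G.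
  apply: join_sub J => x y [xS xj] k; rewrite inE => /predU1P[->//|]; exact: xS.
have ejq : phi j q = phi j (p + 1) by rewrite jq (lift1 (Hphi j)).
have eSq : same_points phi S p q by [].
have J'' := join_shrink HP (same_points_convex phi S Hphi)
  (convex_equiv_lift (Hphi j)) HG1 (HGam j) pq qp eSq ejq p' q' J' pp' pq' qq' e1 e2.
apply: join_sub J'' => x y xy; split; last by apply: xy; rewrite mem_head.
by move=> k kS; apply: xy; rewrite inE kS orbT.
Qed.

Section TwoLeaves.
Context {S : seq nat} {i j : nat} {G0 Gi Gj L M : seq R -> T}.
Context (HG0 : cyclic_family (same_points phi S) G0).

Let joins p q p' q' : Prop :=
  [/\ is_join P (same_points phi (i :: S)) G0 (Gam i) p q Gi,
      is_join P (same_points phi (j :: S)) G0 (Gam j) p' q' Gj,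
      is_join P (same_points phi (i :: j :: S)) Gj (Gam i) p q M &
      is_join P (same_points phi (j :: i :: S)) Gi (Gam j) p' q' L].

Let joinI k p q G : is_join P (same_points phi (k :: S)) G0 (Gam k) p q G ->
  is_join P (fun x y => same_points phi S x y /\ phi k x = phi k y)
    G0 (Gam k) p q G.
Proof.
apply: join_sub => x y [xS xk] l; rewrite inE => /predU1P[->//|]; exact: xS.
Qed.

Lemma leaves_comm_disjoint p q p' q' : joins p q p' q' ->
  p <= q -> q <= p' -> p' <= q' -> q' <= p + 1 ->
  forall s, vl s -> L s = M s.
Proof.
move=> [/joinI Ji /joinI Jj JM JL].
by apply: (join_comm HP (same_points_convex phi S Hphi)
  (convex_equiv_lift (Hphi i)) (convex_equiv_lift (Hphi j))
  HG0 (HGam i) (HGam j) Ji Jj); [exists (same_points phi (j :: i :: S))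
  |exists (same_points phi (i :: j :: S))].
Qed.

(* The arcs of two leaves may overlap where no lobe moves; shrinking them
   makes them disjoint. *)
Lemma leaves_comm p q p' q' :
  leaf phi (j :: S) i p q -> leaf phi (i :: S) j p' q' -> joins p q p' q' ->
  forall s, vl s -> L s = M s.
Proof.
move=> Li Lj [Ji Jj JM JL].
have HGi := Ji.1; have HGj := Jj.1.
have [n np np1] : exists2 n : int, p <= p' + n%:~R & p' + n%:~R < p + 1.
  exists (- Num.floor (p' - p)); rewrite mulrNz;
  by have := floor_itv (p' - p); rewrite intrD; lra.
have exj : exists ev, cyclic_family ev (Gam j) by eexists; exact: HGam.
have {}Lj := leaf_shift _ _ _ _ n Lj.
have {}Jj := join_shift HP n (ex_intro _ _ HG0) exj Jj.
have {}JL := join_shift HP n (ex_intro _ _ HGi) exj JL.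
move: {p' q' n}(p' + n%:~R) (q' + n%:~R) => p' q' in np np1 Lj Jj JL *.
have subi : {subset S <= i :: S} by move=> k kS; rewrite inE kS orbT.
have subj : {subset S <= j :: S} by move=> k kS; rewrite inE kS orbT.
have [p1 [qp1 p1q {}Lj {}Jj {}JL]] : exists p1, [/\ q <= p1, p1 <= p + 1,
    leaf phi (i :: S) j p1 q',
    is_join P (same_points phi (j :: S)) G0 (Gam j) p1 q' Gj &
    is_join P (same_points phi (j :: i :: S)) Gi (Gam j) p1 q' L].
  have [qp'|p'q] := leP q p'; first by exists p'; split=> //; exact: ltW.
  have [/andP[pq qp] iq Sq] := Li; have [/andP[pq' qp'] jq' Sq'] := Lj.
  have jpq : phi j p = phi j q by apply: Sq; rewrite mem_head.
  have qq' : q <= q'.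
    rewrite leNgt; apply/negP => q'q.
    have := lift_le (Hphi j) np; have := lift_le (Hphi j) (ltW q'q); lra.
  have jp'q : phi j p' = phi j q.
    by rewrite -jpq; apply: (lift_between p q) => //; exact: ltW.
  exists q; split=> //.
  - exact: (leaf_shrink _ _ _ _ q q' _ _ HGi Lj JL (ltW p'q) qq' (lexx _)
      jp'q erefl).1.
  - exact: (leaf_shrink _ _ _ _ q q' _ _ HG0 (leaf_subset _ _ _ _ _ subi Lj) Jj
      (ltW p'q) qq' (lexx _) jp'q erefl).2.
  - exact: (leaf_shrink _ _ _ _ q q' _ _ HGi Lj JL (ltW p'q) qq' (lexx _)
      jp'q erefl).2.
have [/andP[pq qp] iq Sq] := Li; have [/andP[pq' qp'] jq' Sq'] := Lj.
(* The arcs may still overlap on the other side of the circle. Lobe [i] rests on the overlap, so its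
   arc can be shortened to start at [q' - 1]. *)
have [qp1'|p1q'] := leP q' (p + 1).
  exact: (leaves_comm_disjoint p q p1 q').
have ipq : phi i p1 = phi i q' by apply: Sq'; rewrite mem_head.
have ip : phi i p = phi i (q' - 1).
  apply: (addIr 1); rewrite -!(lift1 (Hphi i)) subrK.
  rewrite (lift_between p1 q') //; exact: ltW.
have q1 : q' - 1 <= q.
  rewrite leNgt; apply/negP => h.
  by have := lift_le (Hphi i) (ltW h); rewrite -ip iq; lra.
apply: (leaves_comm_disjoint (q' - 1) q p1 q') => //; last by rewrite subrK.
have ppq : p <= q' - 1 by lra.
split=> //.
  exact: (leaf_shrink _ _ _ _ (q' - 1) q _ _ HG0 (leaf_subset _ _ _ _ _ subj Li)
    Ji ppq q1 (lexx _) ip erefl).2.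
exact: (leaf_shrink _ _ _ _ (q' - 1) q _ _ HGj Li JM ppq q1 (lexx _) ip erefl).2.
Qed.

End TwoLeaves.

Lemma glue_nil_const G : glued phi Gam [::] G ->
  forall s, vl s -> G s = const_family P s.
Proof. by move H0: [::] => S0 H; case: H H0. Qed.

(* Two arcs for the same leaf meet in a common arc, unless no other lobe is
   left to pin them down. *)
Lemma leaf_arc_unique S i p q p' q' G1 G G' : glued phi Gam S G1 ->
  leaf phi S i p q -> leaf phi S i p' q' ->
  is_join P (same_points phi (i :: S)) G1 (Gam i) p q G ->
  is_join P (same_points phi (i :: S)) G1 (Gam i) p' q' G' ->
  forall s, vl s -> G s = G' s.
Proof.
move=> H1 Li Li' J J'; have HG1 := glue_cyclic _ _ H1.
have [n cc' c'c] : exists2 n : int, phi i p <= phi i (p' + n%:~R) &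
    phi i (p' + n%:~R) < phi i p + 1.
  exists (- Num.floor (phi i p' - phi i p)); rewrite (lift_shift_int _ _ (Hphi i));
  by rewrite mulrNz; have := floor_itv (phi i p' - phi i p); rewrite intrD; lra.
have exi : exists ev, cyclic_family ev (Gam i) by eexists; exact: HGam.
have {}Li' := leaf_shift _ _ _ _ n Li'.
have {}J' := join_shift HP n (ex_intro _ _ HG1) exi J'.
move: {p' q' n}(p' + n%:~R) (q' + n%:~R) => p' q' in cc' c'c Li' J' *.
have [/andP[pq qp] iq Sq] := Li; have [/andP[pq' qp'] iq' Sq'] := Li'.
(* When lobe [i] starts its turn at the same value on both arcs, the intersection of the arcs still
   carries the full turn, and both joins shrink to it. *)
have [c_eq|c_ne] := eqVneq (phi i p) (phi i p').
  pose p1 := Num.max p p'; pose q1 := Num.min q q'.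
  have [pp1 p'p1] : p <= p1 /\ p' <= p1 by rewrite /p1 !le_max !lexx orbT.
  have [qq1 q'q1] : q1 <= q /\ q1 <= q' by rewrite /q1 !ge_min !lexx orbT.
  have ip1 : phi i p1 = phi i p by rewrite /p1; case: (leP p p') => //.
  have iq1 : phi i q1 = phi i q.
    by rewrite /q1; case: (leP q q') => // _; rewrite iq' iq c_eq.
  have pq1 : p1 <= q1 by apply/ltW/(lift_lt (Hphi i)); rewrite ip1 iq1 iq; lra.
  have [_ K] := leaf_shrink _ _ _ _ p1 q1 _ _ HG1 Li J pp1 pq1 qq1
    (esym ip1) iq1.
  have iq1' : phi i q1 = phi i q' by rewrite iq1 iq iq' c_eq.
  have ip1' : phi i p' = phi i p1 by rewrite ip1.
  have [[pq1' _ _] K'] := leaf_shrink _ _ _ _ p1 q1 _ _ HG1 Li' J' p'p1 pq1 q'q1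
    ip1' iq1'.
  exact: (join_unique HP K K' pq1').
(* Otherwise the two arcs overlap and together cover a full turn of the circle, on which any other
   lobe would have to be constant; so there is none. *)
have {cc' c_ne}cc' : phi i p < phi i p' by rewrite lt_neqAle c_ne.
have pp' := lift_lt (Hphi i) cc'.
have p'q : p' < q by apply: (lift_lt (Hphi i)); lra.
have p1q' : p + 1 < q' by apply: (lift_lt (Hphi i)); rewrite (lift1 (Hphi i)); lra.
case: S H1 {Li Li'} HG1 J J' Sq Sq' => [|k S] H1 HG1 J J' Sq Sq'; last first.
  have e1 := Sq k (mem_head _ _); have e2 := Sq' k (mem_head _ _).
  have e3 := lift_between p q (Hphi k) (ltW pp') (ltW p'q) e1.
  have := lift_between p' q' (Hphi k) (_ : p' <= p + 1) (ltW p1q') e2.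
  by rewrite (lift1 (Hphi k)); move=> /(_ _); lra.
have G1E := glue_nil_const _ H1.
have e : phi i q = phi i (p + 1) by rewrite (lift1 (Hphi i)) iq.
have e' : phi i q' = phi i (p' + 1) by rewrite (lift1 (Hphi i)) iq'.
have pq1 : p <= q <= p + 1 by rewrite pq.
have pq1' : p' <= q' <= p' + 1 by rewrite pq'.
have C := join_const HP (convex_equiv_lift (Hphi i)) (HGam i) pq1 e G1E J.
have C' := join_const HP (convex_equiv_lift (Hphi i)) (HGam i) pq1' e' G1E J'.
by move=> s v; rewrite C ?C'.
Qed.

(** A confluence argument. If both gluings attach the same lobe last, the arc does not matter. If
    they end with different lobes [i] and [j], both are leaves over the remaining lobes; by
    induction each gluing may be replaced by one that attaches [i] and [j] last, and these two
    attachments commute. *)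
Lemma glue_unique S S' G G' : glued phi Gam S G -> glued phi Gam S' G' ->
  uniq S -> perm_eq S S' -> forall s, vl s -> G s = G' s.
Proof.
have [n] := ubnP (size S); elim: n => // n IH in S S' G G' *.
move=> leS H H' uS SS'.
case: H leS uS SS' => [G0 _ G0E|i S1 p q G1 {}G H1 Li J] leS uS SS'.
  have S'0 : S' = [::] by apply/perm_nilP; rewrite perm_sym.
  by rewrite S'0 in H'; move=> s v; rewrite G0E // (glue_nil_const _ H').
have iS' : i \in S' by rewrite -(perm_mem SS') mem_head.
case: H' iS' SS' => [//|j S1' p' q' G1' {}G' H1' Lj J' iS' SS'].
have /andP[iS1 uS1] : (i \notin S1) && uniq S1 := uS.
have uS' : uniq (j :: S1') by rewrite -(perm_uniq SS').
have /andP[jS1' uS1'] := uS'.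
have [ij|ij] := eqVneq i j.
  clear iS'; rewrite -{j}ij in Lj J' SS' uS' jS1'.
  have S11' : perm_eq S1 S1' by move: SS'; rewrite perm_cons.
  have E := IH _ _ _ _ leS H1 H1' uS1 S11'.
  have Li' : leaf phi S1 i p' q'.
    by apply: leaf_subset Lj => k; rewrite (perm_mem S11').
  have J1 : is_join P (same_points phi (i :: S1)) G1 (Gam i) p' q' G'.
    apply: join_sub (join_congr J' _ _) => [x y xy k|s v //|//].
      by rewrite -(perm_mem SS'); exact: xy.
    by rewrite E.
  exact: (leaf_arc_unique _ _ _ _ _ _ _ _ _ H1 Li Li' J J1).
have jS1 : j \in S1.
  have : j \in i :: S1 by rewrite (perm_mem SS') mem_head.
  by rewrite inE eq_sym (negPf ij).
have iS1' : i \in S1' by move: iS'; rewrite inE (negPf ij).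
have [G2 H2] := glue_rem _ _ j H1; set S2 := rem j S1 in H2.
have S1E : perm_eq S1 (j :: S2) by exact: perm_to_rem.
have S1'E : perm_eq S1' (i :: S2).
  rewrite -(perm_cons j) perm_sym; apply: perm_trans SS'.
  have -> : [:: j, i & S2] = [:: j] ++ [:: i] ++ S2 by [].
  by rewrite perm_catCA /= perm_cons perm_sym.
have sub2 : {subset S2 <= S1} by move=> k /mem_rem.
have sub2' : {subset S2 <= S1'}.
  by move=> k kS; rewrite (perm_mem S1'E) inE kS orbT.
have HG2 := glue_cyclic _ _ H2.
have [Gi [Hi Ji]] := glue_attach _ _ _ _ _ H2 (leaf_subset _ _ _ _ _ sub2 Li).
have [Gj [Hj Jj]] := glue_attach _ _ _ _ _ H2 (leaf_subset _ _ _ _ _ sub2' Lj).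
have E1 : forall s, vl s -> G1 s = Gj s by apply: (IH _ _ _ _ leS H1 Hj uS1 S1E).
have leS1' : (size S1' < n)%N.
  have := perm_size SS' => /= /eqP; rewrite eqSS => /eqP <-; exact: leS.
have E1' : forall s, vl s -> G1' s = Gi s.
  by apply: (IH _ _ _ _ leS1' H1' Hi uS1' S1'E).
have M1 := join_congr J E1 (fun s _ => erefl).
have M2 := join_congr J' E1' (fun s _ => erefl).
move=> s v; apply/esym; move: s v.
apply: (@leaves_comm S2 i j G2 Gi Gj G' G HG2 p q p' q').
- by apply: leaf_subset Li => k; rewrite (perm_mem S1E).
- by apply: leaf_subset Lj => k; rewrite (perm_mem S1'E).
split=> //.
- by apply: join_sub M1 => x y xy k; rewrite inE (perm_mem S1E) -in_cons; exact: xy.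
- by apply: join_sub M2 => x y xy k; rewrite inE (perm_mem S1'E) -in_cons; exact: xy.
Qed.

(** [leaf_exists] never selects the prescribed lobe [i], so peeling off leaves ends with [i] alone.
    As [glued] lists the lobes with the last attached in front, [i] stands at the end of the
    list. *)
Lemma glue_exists S i : i \in S -> uniq S ->
  {in S &, forall j k, j != k -> separated_lifts (phi j) (phi k)} ->
  exists S' G, perm_eq (rcons S' i) S /\ glued phi Gam (rcons S' i) G.
Proof.
have [n] := ubnP (size S); elim: n => // n IH in S *.
move=> leS iS uS sep; have [h|h] := boolP (has (predC1 i) S).
  have [k [p [q [kS ki pq kq Sk]]]] := leaf_exists Hphi sep iS h.
  have sub : {subset rem k S <= S} by move=> l /mem_rem.
  have leS1 : (size (rem k S) < n)%N.
    by rewrite size_rem //; move: leS; case: (S) kS => //= a s _; rewrite ltnS.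
  have iS1 : i \in rem k S by rewrite mem_rem_uniq // inE eq_sym ki.
  have [||S' [G [SE H]]] := IH _ leS1 iS1; first exact: rem_uniq.
    by move=> a b /sub aS /sub bS; exact: sep.
  have L : leaf phi (rcons S' i) k p q.
    split=> // l; rewrite (perm_mem SE) mem_rem_uniq // inE => /andP[lk lS].
    exact: Sk.
  have [G' [H' _]] := glue_attach _ _ _ _ _ H L.
  exists (k :: S'), G'; split=> //.
  rewrite rcons_cons perm_sym; apply: perm_trans (perm_to_rem kS) _.
  by rewrite perm_cons perm_sym.
have SE : S = [:: i].
  have aS : {in S, forall k, k = i}.
    by move=> k kS; apply/eqP; move/hasPn: h => /(_ k kS); rewrite /= negbK.
  clear leS sep h; case: S iS uS aS => [|a s] iS uS aS; first by [].
  clear iS.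
  have aE := aS a (mem_head _ _).
  case: s uS aS => [|b s] uS aS; first by rewrite aE.
  have bE : b = i by apply: aS; rewrite !inE eqxx orbT.
  by move: uS; rewrite /= inE aE bE eqxx.
have H0 : glued phi Gam [::] (const_family P).
  by constructor=> //; apply: const_cyclic.
(* A single lobe makes a full turn on every interval of length one; the start 0 is arbitrary. *)
have L : leaf phi [::] i 0 1.
  split; [by rewrite add0r ler01 lexx| |by []].
  by rewrite -(lift1 (Hphi i)) add0r.
have [G [H _]] := glue_attach _ _ _ _ _ H0 L.
by exists [::], G; rewrite SE.
Qed.

End Fixed.
End Gluing.

Arguments same_points {R} phi S x y.
Arguments leaf {R} phi S j p q.
Arguments glued {R O} P phi Gam S G.
Arguments glue_nil {R O P phi Gam G} _ _.
Arguments glue_cons {R O P phi Gam j S p q G' G} _ _ _.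
Arguments same_points_convex {R phi} S _.
Arguments join_sub {R O P ev ev' G1 G2 p q G} _ _.
Arguments cyclic_congr {R O P ev G G'} _ _.
Arguments glue_cyclic {R O P phi Gam S G} _.
Arguments glue_congr {R O P phi Gam S G G'} _ _.
Arguments leaf_join {R O P} HP {phi Gam} _ _ {S j p q G1} _ _.
Arguments glue_nil_const {R O P phi Gam G} _ {s} _.
Arguments glue_unique {R O P} HP {phi Gam} _ _ {S S' G G'} _ _ _ _ {s} _.
Arguments glue_exists {R O P} HP {phi Gam} _ _ {S i} _ _ _.
Arguments leaf_subset {R phi S S' j p q} _ _.

(** * Pullback, relabelling and composition of gluings *)

Section GluingOperations.
Context {R : realType} {O : nat -> topologicalType} {P : cyc_op_mult O}.
Context (HP : is_cyc_op_mult P).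
Local Notation T := (opel O).
Local Notation cyclic_family := (@cyclic_family R O P).

Implicit Types (x y z : R) (s A C : seq R) (ev : R -> R -> Prop).
Implicit Types G : seq R -> T.

Local Notation glued := (glued P).

Implicit Types (phi : nat -> R -> R) (Gam : nat -> seq R -> T) (S : seq nat).

Lemma leaf_pull phi f S j p q : (forall j, circle_lift (phi j)) ->
  circle_lift f -> leaf phi S j p q ->
  exists p' q', [/\ f p' = p, f q' = q &
    leaf (fun k => phi k \o f) S j p' q'].
Proof.
move=> Hphi Hf [/andP[pq qp] jq Sq].
have [p' fp] := lift_onto Hf p.
have pq' : p < q by apply: (lift_lt (Hphi j)); rewrite jq; lra.
(* An arbitrary preimage of [q] may lie beyond [p' + 1] when [q = p + 1]; in that case [p' + 1]
   itself is chosen. *)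
have [q' fq qp'] : exists2 q', f q' = q & q' <= p' + 1.
  have [qp1|qp1] := eqVneq q (p + 1).
    by exists (p' + 1); rewrite // (lift1 Hf) fp.
  have [q' fq] := lift_onto Hf q; exists q' => //.
  apply/ltW/(lift_lt Hf); rewrite (lift1 Hf) fp fq.
  by rewrite lt_neqAle qp1.
exists p', q'; split=> //; split=> [||k kS] /=; rewrite ?fp ?fq //; last exact: Sq.
rewrite qp' andbT; apply/ltW/(lift_lt Hf); rewrite fp fq //.
Qed.

Lemma glue_pull phi Gam f S G : (forall j, circle_lift (phi j)) ->
  circle_lift f -> glued phi Gam S G ->
  glued (fun j => phi j \o f) (fun j s => Gam j (map f s)) S
    (fun s => G (map f s)).
Proof.
move=> Hphi Hf; elim=> [G0 HG0 G0E|j S0 p q G1 G0 _ IH L J].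
  constructor; first exact: (cyclic_pull HG0 Hf).
  by move=> s v; rewrite G0E ?(lift_vl Hf) // /const_family size_map.
have [p' [q' [fp fq L']]] := leaf_pull _ _ _ _ _ _ Hphi Hf L.
exact: (glue_cons IH L' (join_pull p' q' J Hf fp fq)).
Qed.

Lemma glue_relabel phi Gam (pi : nat -> nat) S G :
  glued (fun j => phi (pi j)) (fun j => Gam (pi j)) S G ->
  glued phi Gam (map pi S) G.
Proof.
have sub S0 x y : same_points phi (map pi S0) x y ->
    same_points (fun j => phi (pi j)) S0 x y.
  by move=> xy j jS; apply: xy; exact: map_f.
elim=> [G0 HG0 G0E|j S0 p q G1 G0 _ IH [pq jq Sq] J].
  by constructor=> //; apply: cyclic_sub HG0.
apply: (glue_cons (p := p) (q := q) IH); last first.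
  by apply: join_sub J => x y /(sub (j :: S0)).
by split=> // _ /mapP[k kS ->]; exact: Sq.
Qed.

(** Only differences of values of a lift enter into [same_points] and [leaf], so each lift may be
    changed by a constant as long as the families along it agree. *)
Lemma glue_ext phi phi' Gam Gam' S G :
  {in S, forall j, exists c, forall x, phi' j x = phi j x + c} ->
  {in S, forall j s, vl s -> Gam j s = Gam' j s} ->
  glued phi Gam S G -> glued phi' Gam' S G.
Proof.
move=> Hc HG H; elim: H Hc HG => [G0 HG0 G0E|j S0 p q G1 G0 _ IH [pq jq Sq] J] Hc HG.
  by constructor=> //; apply: cyclic_sub HG0.
have inS k : k \in S0 -> k \in j :: S0 by rewrite inE orbC => ->.
apply: (glue_cons (p := p) (q := q) (G' := G1)).
- by apply: IH => k /inS; [exact: Hc|exact: HG].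
- split=> // [|k kS].
    by have [c E] := Hc j (mem_head _ _); rewrite !E jq addrAC.
  by have [c E] := Hc k (inS _ kS); rewrite !E Sq.
apply: join_congr (join_sub _ J) _ _ => // [x y xy k kS|].
  by have [c E] := Hc k kS; have := xy k kS; rewrite !E => /addIr.
by move=> s v; apply: HG => //; exact: mem_head.
Qed.

Section Composition.
Context {phia phib phic : nat -> R -> R} {Gama Gamb Gamc : nat -> seq R -> T}.
Context {al be : nat -> nat} {i : nat} {Sb : seq nat} {Gb : seq R -> T}.
Context (Ha : forall j, circle_lift (phia j)).
Context (Hb : forall j, circle_lift (phib j)).
Context (Hc : forall j, circle_lift (phic j)).
Context (HGa : forall j,
  cyclic_family (fun x y => phia j x = phia j y) (Gama j)).
Context (HGc : forall j,
  cyclic_family (fun x y => phic j x = phic j y) (Gamc j)).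
Context (Hglue : glued phib Gamb Sb Gb).
Context (HGb : forall s, vl s -> Gama i s = Gb (map (phia i) s)).
Context (phi_be : {in Sb, forall r x, phic (be r) x = phib r (phia i x)}).
Context (Gam_be : {in Sb, forall r s, vl s ->
  Gamc (be r) s = Gamb r (map (phia i) s)}).

(* Lobe [i] of the outer cactus is attached first, so it can be replaced by
   the inner cactus at the start. *)
Lemma glue_comp S G : glued phia Gama (rcons S i) G ->
  {in S, forall k x, phic (al k) x = phia k x} ->
  {in S, forall k s, vl s -> Gamc (al k) s = Gama k s} ->
  exists G', glued phic Gamc (map al S ++ map be Sb) G' /\
    forall s, vl s -> G s = G' s.
Proof.
move SE : (rcons S i) => Si H.
elim: H S SE => [G0 _ _ [//|//]|j S0 p q G1 G0 H1 IH L J] [|k S] /=.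
  (* Lobe [i] is attached to nothing, so by [join_const] the gluing so far is the family of lobe
     [i], which [HGb] identifies with the pulled-back inner gluing. *)
  case=> ji S0E phi_al Gam_al; clear IH; rewrite -{S0}S0E -{j}ji in H1 L J *.
  have [pq jq _] := L.
  exists (fun s => Gb (map (phia i) s)); split.
    apply: glue_relabel; apply: glue_ext (glue_pull _ _ _ _ _ Hb (Ha i) Hglue).
      by move=> r rS; exists 0 => x; rewrite addr0 phi_be.
    by move=> r rS s v; rewrite Gam_be.
  move=> s v; rewrite -HGb //.
  apply: (join_const HP (convex_equiv_lift (Ha i)) (HGa i) pq _ _ J s v).
    by rewrite jq (lift1 (Ha i)).
  exact: (@glue_nil_const _ _ _ _ _ _ H1).
case=> kj S0E phi_al Gam_al; rewrite -{j}kj in L J *.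
have inS l : l \in S -> l \in k :: S by rewrite inE orbC => ->.
have [G1' [H1' E1]] := IH S S0E (fun l lS => phi_al l (inS l lS))
  (fun l lS => Gam_al l (inS l lS)).
have [pq jq Sq] := L.
(* An outer leaf remains a leaf after the replacement: on its arc [phia i] is constant, and the
   inner lobes factor through [phia i]. *)
have L' : leaf phic (map al S ++ map be Sb) (al k) p q.
  split=> // [|l]; first by rewrite !phi_al ?mem_head.
  rewrite mem_cat => /orP[/mapP[r rS ->]|/mapP[r rS ->]].
    rewrite !phi_al ?inS //; apply: Sq.
    by rewrite -S0E mem_rcons inE rS orbT.
  by rewrite !phi_be // Sq // -S0E mem_rcons mem_head.
have [G' J'] := leaf_join HP Hc HGc (glue_cyclic H1') L'.
exists G'; split; first exact: (glue_cons H1' L' J').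
apply: (join_unique HP J J' pq E1) => s v.
by rewrite Gam_al ?mem_head.
Qed.

End Composition.
End GluingOperations.

Arguments glue_relabel {R O P phi Gam} pi {S G} _.
Arguments glue_ext {R O P phi phi' Gam Gam' S G} _ _ _.
Arguments glue_pull {R O P phi Gam f S G} _ _ _.

Local Open Scope classical_set_scope.

(** * Limits along ultrafilters *)

Section UltraLimits.
Context {I : Type} {F : set_system I} (FU : UltraFilter F).

Lemma ultra_or (B : set I) : F B \/ F (~` B).
Proof. exact: in_ultra_setVsetC. Qed.

(** The pigeonhole principle for an ultrafilter. It makes discrete choices constant, such as which
    lobe is attached last or how many inputs precede a cut. *)
Lemma ultra_pick n (r : I -> nat) : (\forall a \near F, (r a < n)%N) ->
  exists2 k, (k < n)%N & \forall a \near F, r a = k.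
Proof.
elim: n => [|n IH] rn.
  by have [a] := filter_ex rn.
have [h|h] := ultra_or [set a | r a = n]; first by exists n.
have [|k kn rk] := IH.
  near=> a; have h1 : (r a < n.+1)%N by near: a.
  have h2 : r a <> n by near: a.
  by rewrite ltnS leq_eqVlt in h1; case/orP: h1 => // /eqP.
by exists k => //; exact: ltnW.
Unshelve. all: by end_near. Qed.

Lemma ultra_compact_cvg (X : topologicalType) (K : set X) (f : I -> X) :
  compact K -> (\forall a \near F, K (f a)) -> exists2 p, K p & f @ F --> p.
Proof.
move=> cK FK; have [p [Kp clp]] := cK (f @ F) _ FK.
exists p => // B pB; have [//|h] := ultra_or (f @^-1` B).
have fC : (f @ F) (~` B) by [].
by have [x [nBx Bx]] := clp _ _ fC pB.
Qed.

Context {R : realType}.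
Implicit Types (f g : I -> R) (x y : R).

Definition rcvg f x : Prop :=
  forall e, 0 < e -> \forall a \near F, `|f a - x| < e.

Lemma rcvgP f x : f @ F --> x <-> rcvg f x.
Proof.
split=> [/cvgrPdist_lt h e e0|h].
  by have := h e e0; apply: filterS => a; rewrite distrC.
apply/cvgrPdist_lt => e e0; have := h e e0.
by apply: filterS => a; rewrite distrC.
Qed.

Lemma rcvg_cst x : rcvg (fun=> x) x.
Proof. by move=> e e0; near=> a; rewrite subrr normr0. Unshelve. all: by end_near. Qed.

Lemma rcvgD f g x y : rcvg f x -> rcvg g y -> rcvg (fun a => f a + g a) (x + y).
Proof.
move=> fx gy e e0; have e2 : 0 < e / 2 by lra.
near=> a; have h1 : `|f a - x| < e / 2 by near: a; exact: fx.
have h2 : `|g a - y| < e / 2 by near: a; exact: gy.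
rewrite opprD addrACA; apply: le_lt_trans (ler_normD _ _) _; lra.
Unshelve. all: by end_near. Qed.

Lemma rcvg_le f g x y : rcvg f x -> rcvg g y ->
  (\forall a \near F, f a <= g a) -> x <= y.
Proof.
move=> fx gy fg; rewrite leNgt; apply/negP => yx.
have e0 : 0 < (x - y) / 2 by lra.
have [a [[h1 h2] h3]] := filter_ex (filterI (filterI (fx _ e0) (gy _ e0)) fg).
by move: h1 h2 h3; rewrite /= !ltr_norml => /andP[? ?] /andP[? ?]; lra.
Qed.

Lemma rcvg_eq f g x y : rcvg f x -> rcvg g y ->
  (\forall a \near F, f a = g a) -> x = y.
Proof.
move=> fx gy fg; apply/eqP; rewrite eq_le.
by rewrite (rcvg_le _ _ _ _ fx gy) ?(rcvg_le _ _ _ _ gy fx) //;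
  apply: filterS fg => a ->.
Qed.

Lemma rcvg_bounded f l u : (\forall a \near F, l <= f a <= u) ->
  exists2 x, l <= x <= u & rcvg f x.
Proof.
move=> h; have [x xlu /rcvgP fx] := ultra_compact_cvg _ _ f (@segment_compact R l u) h.
by exists x.
Qed.

(* Points of a configuration moving with [I], paired with their limits. *)
Fixpoint mcvg (s : seq ((I -> R) * R)) : Prop :=
  if s is p :: s then rcvg p.1 p.2 /\ mcvg s else True.

Definition mval (s : seq ((I -> R) * R)) (a : I) : seq R :=
  [seq p.1 a | p <- s].

Definition mlim (s : seq ((I -> R) * R)) : seq R := [seq p.2 | p <- s].

Lemma mcvg_cat s s' : mcvg (s ++ s') <-> mcvg s /\ mcvg s'.
Proof.
elim: s => [|p s IH] /=; first by split=> [|[]].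
by rewrite IH; split=> [[? []]|[[? ?] ?]].
Qed.

Lemma mlim_sorted s : mcvg s -> (\forall a \near F, pairwise <=%R (mval s a)) ->
  pairwise <=%R (mlim s).
Proof.
elim: s => //= p s IH [ps ss] h; apply/andP; split; last first.
  by apply: IH => //; apply: filterS h => a /andP[].
elim: s ss {IH} h => //= p' s IH [ps' ss] h; apply/andP; split.
  by apply: rcvg_le ps ps' _; apply: filterS h => a /andP[/andP[]].
by apply: IH => //; apply: filterS h => a /andP[/andP[_ ->]] /andP[_ ->].
Qed.

Lemma mlim_vl s : mcvg s -> (\forall a \near F, vl (mval s a)) -> vl (mlim s).
Proof.
case: s => [|p s] ps h; first by have [a] := filter_ex h.
have := mlim_sorted (p :: s ++ [:: (fun a => p.1 a + 1, p.2 + 1)]).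
rewrite /mlim /= map_cat; apply.
  split; [exact: ps.1|apply/mcvg_cat; split; [exact: ps.2|split=> //]].
  by apply: rcvgD; [exact: ps.1|exact: rcvg_cst].
by apply: filterS h => a; rewrite /vl /mval /= map_cat.
Qed.

End UltraLimits.

Section OperadLimits.
Context {O : nat -> topologicalType} {P : cyc_op_mult O}.
Context (HP : is_cyc_op_mult P).
Context {I : Type} {F : set_system I} {FF : Filter F}.
Local Notation T := (opel O).

(* Convergence in the disjoint union of the spaces [O k]. *)
Definition ocvg (f : I -> T) (v : T) : Prop :=
  forall W : set (O (ar v)), nbhs (projT2 v) W ->
  \forall a \near F, exists2 w, W w & f a = existT O (ar v) w.

Lemma ocvg_cst v : ocvg (fun=> v) v.
Proof.
move=> W nW; near=> a; exists (projT2 v); first exact: nbhs_singleton.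
by case: v W nW.
Unshelve. all: by end_near. Qed.

Lemma ocvg_ext f g v : (\forall a \near F, f a = g a) -> ocvg f v -> ocvg g v.
Proof.
move=> fg fv W nW; near=> a.
have <- : f a = g a by near: a.
by near: a; exact: fv.
Unshelve. all: by end_near. Qed.

Lemma ocvg_ocmp i f g v w : (1 <= i <= ar v)%N -> ocvg f v -> ocvg g w ->
  ocvg (fun a => ocmp P i (f a) (g a)) (ocmp P i v w).
Proof.
move=> iv fv gw W /= nW.
have [[cont _ _ _] _] := HP.
have [[B1 B2] /= [nB1 nB2] sub] := cont _ _ _ iv (projT2 v, projT2 w) W nW.
near=> a.
have [x B1x ->] : exists2 x, B1 x & f a = existT O (ar v) x by near: a; exact: fv.
have [y B2y ->] : exists2 y, B2 y & g a = existT O (ar w) y by near: a; exact: gw.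
by exists (ocomp P i x y) => //; apply: (sub (x, y)); split.
Unshelve. all: by end_near. Qed.

Lemma ocvg_orot f v : ocvg f v -> ocvg (fun a => orot P (f a)) (orot P v).
Proof.
move=> fv W /= nW; have [_ [_ [cont _ _ _ _] _]] := HP.
have nB := cont _ (projT2 v) W nW.
near=> a; have [x Bx ->] : exists2 x, (@ocyc _ P _ @^-1` W) x &
  f a = existT O (ar v) x by near: a; exact: fv.
by exists (ocyc P x).
Unshelve. all: by end_near. Qed.

Lemma ocvg_iter_orot n f v : ocvg f v ->
  ocvg (fun a => iter n (orot P) (f a)) (iter n (orot P) v).
Proof. by elim: n => [|n IH] //= /IH; exact: ocvg_orot. Qed.

End OperadLimits.

(** * Limits of joins *)

Section FamilyLimits.
Context {R : realType} {O : nat -> topologicalType} {P : cyc_op_mult O}.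
Context (HP : is_cyc_op_mult P).
Context {I : Type} {F : set_system I} (FU : UltraFilter F).
Local Notation T := (opel O).
Local Notation cyclic_family := (@cyclic_family R O P).

Implicit Types (x y z : R) (s A C : seq R) (ev : R -> R -> Prop).
Implicit Types G : seq R -> T.

Local Notation ocvg := (@ocvg O I F).
Local Notation rcvg := (@rcvg I F R).
Local Notation mcvg := (@mcvg I F R).

(** Continuous convergence: the configuration moves together with the family. For a constant
    sequence of families this is continuity in the configuration. *)
Definition fcvg (G : I -> seq R -> T) (G0 : seq R -> T) : Prop :=
  forall y : seq ((I -> R) * R), mcvg y -> (\forall a \near F, vl (mval y a)) ->
  ocvg (fun a => G a (mval y a)) (G0 (mlim y)).

Lemma vl_cut2 x (p q : R) s : vl (x :: s) -> x <= p -> p <= q -> q <= x + 1 ->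
  exists n1 n2, [/\ (n1 <= size s)%N, (n2 <= size s)%N &
    vl (x :: take n1 s ++ p :: take n2 (drop n1 s) ++
      q :: drop n2 (drop n1 s))].
Proof.
move=> v xp pq qx; have [A [s1 [sE Ap ps1]]] := vl_split p v.
have v1 : vl (x :: s1) by rewrite sE in v; vtac.
have [B [C [s1E Bq qC]]] := vl_split q v1.
exists (size A), (size B); rewrite sE take_size_cat // drop_size_cat //.
rewrite s1E take_size_cat // drop_size_cat // !size_cat.
split; [by nlia|by nlia|].
rewrite sE s1E in v; rewrite s1E all_cat in ps1; have /andP[pB pC] := ps1.
by clear v1; vtac.
Qed.

(** With the output outside the arc, [join_insert] writes the join as one operadic composition,
    which is continuous. The same formula with the same cuts holds in the limit because all
    conditions on the points are closed. *)
Lemma join_fcvg (G1 G2 G : I -> seq R -> T) G10 G20 G0 (p q : I -> R) p0 q0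
    (y : seq ((I -> R) * R)) :
  (\forall a \near F, exists ev ev1, [/\ convex_equiv ev1,
    cyclic_family ev1 (G1 a) & is_join P ev (G1 a) (G2 a) (p a) (q a) (G a)]) ->
  (exists ev ev1, [/\ convex_equiv ev1, cyclic_family ev1 G10 &
    is_join P ev G10 G20 p0 q0 G0]) ->
  fcvg G1 G10 -> fcvg G2 G20 -> rcvg p p0 -> rcvg q q0 -> mcvg y ->
  (\forall a \near F, vl (mval y a)) ->
  (\forall a \near F, [/\ head 0 (mval y a) <= p a, p a <= q a &
     q a <= head 0 (mval y a) + 1]) ->
  ocvg (fun a => G a (mval y a)) (G0 (mlim y)).
Proof.
case: y => [|x s]; first by move=> _ _ _ _ _ _ _ h; have [a] := filter_ex h.
move=> HJ HJ0 G1c G2c pc qc /= [xc sc] v pq.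
have cut a : exists n : nat * nat, vl (mval (x :: s) a) ->
    [/\ x.1 a <= p a, p a <= q a & q a <= x.1 a + 1] ->
    [/\ (n.1 <= size s)%N, (n.2 <= size s)%N &
     vl (x.1 a :: mval (take n.1 s) a ++ p a :: mval (take n.2 (drop n.1 s)) a ++
       q a :: mval (drop n.2 (drop n.1 s)) a)].
  have [va|nva] := boolP (vl (mval (x :: s) a)); last by exists (0, 0)%N.
  have [[xp pq' qx]|nn] := pselect [/\ x.1 a <= p a, p a <= q a & q a <= x.1 a + 1];
    last by exists (0, 0)%N.
  have [n1 [n2 [h1 h2 h3]]] := vl_cut2 _ _ _ _ va xp pq' qx.
  rewrite size_map in h1 h2.
  by exists (n1, n2) => _ _; split=> //; rewrite /mval !map_take !map_drop.
have {cut}[n cut] := choice cut.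
have {v pq}cutF : \forall a \near F, [/\ ((n a).1 < (size s).+1)%N,
    ((n a).2 < (size s).+1)%N &
     vl (x.1 a :: mval (take (n a).1 s) a ++
       p a :: mval (take (n a).2 (drop (n a).1 s)) a ++
       q a :: mval (drop (n a).2 (drop (n a).1 s)) a)].
  near=> a; apply: (cut a); first by near: a.
  by near: a.
have [|k1 _ n1E] := ultra_pick FU (size s).+1 (fun a => (n a).1).
  by apply: filterS cutF => a [].
have [|k2 _ n2E] := ultra_pick FU (size s).+1 (fun a => (n a).2).
  by apply: filterS cutF => a [].
pose A := take k1 s; pose B := take k2 (drop k1 s); pose C := drop k2 (drop k1 s).
have sE : s = A ++ B ++ C by rewrite /A /B /C !cat_take_drop.
have {cutF}vF : \forall a \near F, vl (mval (x :: A ++ (p, p0) :: B ++ (q, q0) :: C) a).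
  near=> a; have e1 : (n a).1 = k1 by near: a.
  have e2 : (n a).2 = k2 by near: a.
  have : [/\ ((n a).1 < (size s).+1)%N,
    ((n a).2 < (size s).+1)%N &
     vl (x.1 a :: mval (take (n a).1 s) a ++
       p a :: mval (take (n a).2 (drop (n a).1 s)) a ++
       q a :: mval (drop (n a).2 (drop (n a).1 s)) a)] by near: a.
  by rewrite e1 e2 => -[_ _]; rewrite /mval /= !map_cat /= map_cat.
rewrite sE in sc *; have /mcvg_cat[Ac /mcvg_cat[Bc Cc]] := sc.
have c1 : mcvg (x :: A ++ (p, p0) :: C).
  by split=> //; apply/mcvg_cat.
have c2 : mcvg ((p, p0) :: B) by split.
have c3 : mcvg (x :: A ++ (p, p0) :: B ++ (q, q0) :: C).
  by split=> //; apply/mcvg_cat; split=> //; split=> //; apply/mcvg_cat.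
have v0 := mlim_vl FU _ c3 vF.
have [ev0 [ev10 [H10 HG10 J0]]] := HJ0.
have mE (l1 l2 l3 : seq ((I -> R) * R)) (z1 z2 z3 : (I -> R) * R) (a : I) :
    mval (z1 :: l1 ++ z2 :: l2 ++ z3 :: l3) a =
    z1.1 a :: mval l1 a ++ z2.1 a :: mval l2 a ++ z3.1 a :: mval l3 a :> seq R.
  by rewrite /mval /= map_cat /= map_cat.
have lE (l1 l2 l3 : seq ((I -> R) * R)) (z1 z2 z3 : (I -> R) * R) :
    mlim (z1 :: l1 ++ z2 :: l2 ++ z3 :: l3) =
    z1.2 :: mlim l1 ++ z2.2 :: mlim l2 ++ z3.2 :: mlim l3.
  by rewrite /mlim /= map_cat /= map_cat.
rewrite lE /= in v0.
have v10 : vl (x.2 :: mlim A ++ p0 :: mlim C) by vtac.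
have e0 : mlim (x :: A ++ B ++ C) = x.2 :: mlim A ++ mlim B ++ mlim C.
  by rewrite /mlim /= !map_cat.
change (ocvg (fun a => G a (mval (x :: A ++ B ++ C) a))
  (G0 (mlim (x :: A ++ B ++ C)))).
rewrite e0 (join_insert HP H10 HG10 J0 v0).
have lim : ocvg (fun a => ocmp P (size A).+1
      (G1 a (mval (x :: A ++ (p, p0) :: C) a)) (G2 a (mval ((p, p0) :: B) a)))
    (ocmp P (size (mlim A)).+1 (G10 (x.2 :: mlim A ++ p0 :: mlim C))
      (G20 (p0 :: mlim B))).
  rewrite size_map; apply: (ocvg_ocmp HP).
  - by rewrite (cyc_ar HG10 v10) size_cat !size_map /=; nlia.
  - have -> : x.2 :: mlim A ++ p0 :: mlim C = mlim (x :: A ++ (p, p0) :: C).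
      by rewrite /mlim /= map_cat.
    apply: G1c => //; apply: filterS vF => a va; rewrite mE /= in va.
    by rewrite /mval /= map_cat /=; rewrite -/(mval A a) -/(mval C a); vtac.
  - apply: (G2c _ c2); apply: filterS vF => a va; rewrite mE /= in va.
    by rewrite /mval /= -/(mval B a); vtac.
apply: ocvg_ext lim; near=> a.
have va : vl (mval (x :: A ++ (p, p0) :: B ++ (q, q0) :: C) a) by near: a.
have [ev [ev1 [H1 HG1 J]]] : exists ev ev1, [/\ convex_equiv ev1,
    cyclic_family ev1 (G1 a) & is_join P ev (G1 a) (G2 a) (p a) (q a) (G a)].
  by near: a.
rewrite mE /= in va.
have -> : mval (x :: A ++ B ++ C) a = x.1 a :: mval A a ++ mval B a ++ mval C a.
  by rewrite /mval /= !map_cat.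
rewrite (join_insert HP H1 HG1 J va) /mval size_map.
by rewrite /= map_cat.
Unshelve. all: by end_near. Qed.

End FamilyLimits.

Arguments ultra_or {I F} FU B.
Arguments ultra_pick {I F} FU {n r} _.
Arguments ultra_compact_cvg {I F} FU {X K f} _ _.
Arguments rcvg {I F R} f x.
Arguments rcvgP {I F} FU {R} f x.
Arguments rcvg_cst {I F} FU {R} x.
Arguments rcvgD {I F} FU {R f g x y} _ _.
Arguments rcvg_le {I F} FU {R f g x y} _ _ _.
Arguments rcvg_eq {I F} FU {R f g x y} _ _ _.
Arguments rcvg_bounded {I F} FU {R f l u} _.
Arguments mcvg {I F R} s.
Arguments mval {I R} s a.
Arguments mlim {I R} s.
Arguments mcvg_cat {I F R} s s'.
Arguments mlim_vl {I F} FU {R s} _ _.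
Arguments ocvg {O I F} f v.
Arguments ocvg_cst {O I F FF} v.
Arguments ocvg_ext {O I F FF f g v} _ _.
Arguments ocvg_ocmp {O P} HP {I F FF i f g v w} _ _ _.
Arguments ocvg_iter_orot {O P} HP {I F FF} n {f v} _.
Arguments fcvg {R O I F} G G0.
Arguments join_fcvg {R O P} HP {I F} FU {G1 G2 G G10 G20 G0 p q p0 q0 y}.

(** * Limits of gluings *)

Section GluingLimits.
Context {R : realType} {O : nat -> topologicalType} {P : cyc_op_mult O}.
Context (HP : is_cyc_op_mult P).
Local Notation m := (mel P).
Local Notation T := (opel O).
Local Notation cyclic_family := (@cyclic_family R O P).

Implicit Types (x y z : R) (s A C : seq R) (ev : R -> R -> Prop).
Implicit Types G : seq R -> T.

Lemma leaf_join_sym (phi : nat -> R -> R) (Gj : seq R -> T) (S : seq nat) j p q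
    G1 G : (forall j, circle_lift (phi j)) ->
  cyclic_family (fun x y => phi j x = phi j y) Gj ->
  cyclic_family (same_points phi S) G1 -> leaf phi S j p q ->
  is_join P (same_points phi (j :: S)) G1 Gj p q G ->
  is_join P (fun x y => phi j x = phi j y /\ same_points phi S x y)
    Gj G1 (q - 1) p G.
Proof.
move=> Hphi HGj HG1 [/andP[pq qp] jq Sq] J.
apply: (join_sym HP (same_points_convex S Hphi) (convex_equiv_lift (Hphi j))
  HG1 HGj pq qp Sq).
  by rewrite jq (lift1 (Hphi j)).
apply: join_sub J => x y [xS xj] k; rewrite inE => /predU1P[->//|]; exact: xS.
Qed.

Context {I : Type} {F : set_system I} (FU : UltraFilter F).
Local Notation rcvg := (@rcvg I F R).
Local Notation mcvg := (@mcvg I F R).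

Context {phi : I -> nat -> R -> R} {phi0 : nat -> R -> R}.
Context {Gam : I -> nat -> seq R -> T} {Gam0 : nat -> seq R -> T}.
Context (Hphi : forall a j, circle_lift (phi a j)).
Context (Hphi0 : forall j, circle_lift (phi0 j)).
Context (HGam : forall a j,
  cyclic_family (fun x y => phi a j x = phi a j y) (Gam a j)).
Context (HGam0 : forall j,
  cyclic_family (fun x y => phi0 j x = phi0 j y) (Gam0 j)).
Context (phi_cvg : forall j (x : I -> R) x0, rcvg x x0 ->
  rcvg (fun a => phi a j (x a)) (phi0 j x0)).
Context (Gam_cvg : forall j, fcvg (F := F) (fun a => Gam a j) (Gam0 j)).

Lemma leaf_limit (S : seq nat) j (p q : I -> R) p0 q0 :
  rcvg p p0 -> rcvg q q0 -> (\forall a \near F, leaf (phi a) S j (p a) (q a)) ->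
  leaf phi0 S j p0 q0.
Proof.
move=> pc qc L; split.
- apply/andP; split; [apply: (rcvg_le FU pc qc)|
    apply: (rcvg_le FU qc (rcvgD FU pc (rcvg_cst FU 1)))];
  by apply: filterS L => a [/andP[]].
- apply: (rcvg_eq FU (phi_cvg j _ _ qc)
    (rcvgD FU (phi_cvg j _ _ pc) (rcvg_cst FU 1))).
  by apply: filterS L => a [].
- move=> k kS; apply: (rcvg_eq FU (phi_cvg k _ _ pc) (phi_cvg k _ _ qc)).
  by apply: filterS L => a [_ _]; exact.
Qed.

(** The orders of attachment may vary with the index and differ from that of the limit. By induction
    it is enough to follow the last leaf and its arc to the limit, since the leaf conditions are
    closed. *)
Lemma glued_fcvg (S : seq nat) (G : I -> seq R -> T) G0 : uniq S ->
  (\forall a \near F, exists2 S', perm_eq S' S &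
    glued P (phi a) (Gam a) S' (G a)) ->
  (exists2 S', perm_eq S' S & glued P phi0 Gam0 S' G0) ->
  fcvg (F := F) G G0.
Proof.
have [n] := ubnP (size S); elim: n => // n IH in S G G0 *.
case: S => [|i0 S] leS uS HG [S0 S0E HG0] y yc vy.
  have v0 := mlim_vl FU yc vy.
  have S00 : S0 = [::] by apply/perm_nilP.
  rewrite S00 in HG0; rewrite (glue_nil_const HG0) //.
  apply: ocvg_ext (ocvg_cst _); near=> a.
  have [S' /perm_nilP S'0 H] : exists2 S', perm_eq S' [::] &
    glued P (phi a) (Gam a) S' (G a) by near: a.
  rewrite S'0 in H; rewrite (glue_nil_const H); last by near: a.
  by rewrite /const_family !size_map.
move: (i0 :: S) leS uS HG S0E (mem_head i0 S) => {}S leS uS HG S0E i0S.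
case: y yc vy => [|x s] yc vy; first by have [a] := filter_ex vy.
have [xc sc] := yc.
have data a : exists d : nat * (R * R * (seq R -> T)),
    (exists2 S', perm_eq S' S & glued P (phi a) (Gam a) S' (G a)) ->
    let: (j, (p, q, G1)) := d in
    [/\ j \in S, (exists2 S', perm_eq S' (rem j S) &
          glued P (phi a) (Gam a) S' G1),
        leaf (phi a) (rem j S) j p q, x.1 a <= p < x.1 a + 1 &
        is_join P (same_points (phi a) (j :: rem j S)) G1 (Gam a j) p q (G a)].
  have [[S' S'E H]|nn] := pselect (exists2 S', perm_eq S' S &
    glued P (phi a) (Gam a) S' (G a)); last by exists (0%N, (0, 0, G0)).
  case: H S'E => [G' _ _ /perm_size/esym/eqP|].
    by rewrite size_eq0 => /eqP S0'; rewrite S0' in i0S.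
  move=> j S1 p q G1 G' H1 L J S'E.
  have jS : j \in S by rewrite -(perm_mem S'E) mem_head.
  have S1E : perm_eq S1 (rem j S).
    rewrite -(perm_cons j); apply: perm_trans S'E _; exact: perm_to_rem.
  (* The arc is translated so as to start within one turn after the output; this bounds its ends,
     which then converge. *)
  pose m := - Num.floor (p - x.1 a).
  have HG1 := glue_cyclic H1.
  exists (j, (p + m%:~R, q + m%:~R, G1)) => _; split=> //.
  - by exists S1.
  - apply: (leaf_shift (Hphi a)).
    by apply: leaf_subset L => k; rewrite (perm_mem S1E).
  - by rewrite /m mulrNz; have := floor_itv (p - x.1 a); rewrite intrD; lra.
  - apply: (join_shift HP m) => //.
    + by eexists; exact: HG1.
    + by eexists; exact: (HGam a j).
    by apply: join_sub J => z z' zz' k; rewrite inE (perm_mem S1E) -in_cons; exact: zz'.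
have [d {}data] := choice data.
pose J a := (d a).1; pose p a := (d a).2.1.1; pose q a := (d a).2.1.2.
pose G1 a := (d a).2.2.
have {}data : \forall a \near F,
    [/\ J a \in S, (exists2 S', perm_eq S' (rem (J a) S) &
          glued P (phi a) (Gam a) S' (G1 a)),
        leaf (phi a) (rem (J a) S) (J a) (p a) (q a),
        x.1 a <= p a < x.1 a + 1 &
        is_join P (same_points (phi a) (J a :: rem (J a) S)) (G1 a)
          (Gam a (J a)) (p a) (q a) (G a)].
  apply: filterS HG => a /(data a); rewrite /J /p /q /G1.
  by case: (d a) => j [[]].
have [|k kS kE] := @ultra_pick _ _ FU (size S) (fun a => index (J a) S).
  by apply: filterS data => a []; rewrite index_mem.
pose j := nth 0%N S k; have jS : j \in S by exact: mem_nth.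
have {kE}data : \forall a \near F,
    [/\ (exists2 S', perm_eq S' (rem j S) & glued P (phi a) (Gam a) S' (G1 a)),
        leaf (phi a) (rem j S) j (p a) (q a), x.1 a <= p a < x.1 a + 1 &
        is_join P (same_points (phi a) (j :: rem j S)) (G1 a)
          (Gam a j) (p a) (q a) (G a)].
  near=> a; have ka : index (J a) S = k by near: a.
  have [JS] : [/\ J a \in S, (exists2 S', perm_eq S' (rem (J a) S) &
          glued P (phi a) (Gam a) S' (G1 a)),
        leaf (phi a) (rem (J a) S) (J a) (p a) (q a),
        x.1 a <= p a < x.1 a + 1 &
        is_join P (same_points (phi a) (J a :: rem (J a) S)) (G1 a)
          (Gam a (J a)) (p a) (q a) (G a)] by near: a.
  by have -> : J a = j by rewrite /j -ka nth_index.
have xb : \forall a \near F, x.2 - 1 <= x.1 a <= x.2 + 1.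
  by apply: filterS (xc 1 ltr01) => a; rewrite ltr_norml; lra.
have [|p0 _ pc] := @rcvg_bounded _ _ FU R p (x.2 - 1) (x.2 + 2).
  apply: filterS (filterI data xb) => a [[_ _ /andP[? ?] _] /andP[? ?]]; lra.
have [|q0 _ qc] := @rcvg_bounded _ _ FU R q (x.2 - 1) (x.2 + 3).
  apply: filterS (filterI data xb).
  move=> a [[_ [/andP[? ?] _ _] /andP[? ?] _] /andP[? ?]]; lra.
have L0 : leaf phi0 (rem j S) j p0 q0.
  by apply: (leaf_limit _ _ _ _ _ _ pc qc); apply: filterS data => a [].
have [G10 HG10] := glue_rem HP Hphi0 HGam0 _ _ j HG0.
have jS0 : j \in S0 by rewrite (perm_mem S0E).
have S0jE : perm_eq (rem j S0) (rem j S).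
  rewrite -(perm_cons j) -(permPl (perm_to_rem jS0)).
  by rewrite -(permPr (perm_to_rem jS)).
have L0' : leaf phi0 (rem j S0) j p0 q0.
  by apply: leaf_subset L0 => l; rewrite (perm_mem S0jE).
have HG1c := glue_cyclic HG10.
have [G0' J0] := leaf_join HP Hphi0 HGam0 HG1c L0'.
have HG0' := glue_cons HG10 L0' J0.
(* The limit may have been glued in another order; by uniqueness it can be rebuilt with [j] attached
   last along the limit arc. *)
have E0 : forall r, vl r -> G0 r = G0' r.
  apply: (glue_unique HP Hphi0 HGam0 HG0 HG0'); first by rewrite (perm_uniq S0E).
  exact: perm_to_rem.
have v0 := mlim_vl FU yc vy.
rewrite E0 //.
have leS1 : (size (rem j S) < n)%N.
  by rewrite size_rem //; move: leS; case: (S) jS => //= a r _; rewrite ltnS.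
have uS1 : uniq (rem j S) by exact: rem_uniq.
have G1c : fcvg (F := F) G1 G10.
  apply: (IH _ _ _ leS1 uS1); last by exists (rem j S0).
  by apply: filterS data => a [].
have HG1a a : (exists2 S', perm_eq S' (rem j S) & glued P (phi a) (Gam a) S' (G1 a)) ->
    cyclic_family (same_points (phi a) (rem j S)) (G1 a).
  move=> [S' S'E H]; apply: cyclic_sub (glue_cyclic H) => z z' zz' l.
  by rewrite (perm_mem S'E); exact: zz'.
(* Either the output is outside the arc for almost all indices, or the arc runs past it. In the
   second case the output is outside the complementary arc [[q - 1, p]], and the roles of the leaf
   and the rest are exchanged. *)
have [hq|hq] := ultra_or FU [set a | q a <= x.1 a + 1].
  apply: (join_fcvg HP FU _ _ G1c (Gam_cvg j) pc qc yc vy).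
  - apply: filterS data => a [H1 L _ Ja].
    exists (same_points (phi a) (j :: rem j S)), (same_points (phi a) (rem j S)).
    by split=> //; [exact: same_points_convex|exact: HG1a].
  - exists (same_points phi0 (j :: rem j S0)), (same_points phi0 (rem j S0)).
    by split=> //; exact: same_points_convex.
  - apply: filterS (filterI data hq) => a [[_ [/andP[? ?] _ _] /andP[? ?] _] ?].
    by split.
have qc' := rcvgD FU qc (rcvg_cst FU (-1)).
apply: (join_fcvg HP FU _ _ (Gam_cvg j) G1c qc' pc yc vy).
- apply: filterS data => a [H1 L _ Ja].
  exists (fun z z' => phi a j z = phi a j z' /\ same_points (phi a) (rem j S) z z'),
    (fun z z' => phi a j z = phi a j z').
  split=> //; first exact: (convex_equiv_lift (Hphi a j)).
  exact: (leaf_join_sym _ _ _ _ _ _ _ _ (Hphi a) (HGam a j) (HG1a a H1) L Ja).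
- exists (fun z z' => phi0 j z = phi0 j z' /\ same_points phi0 (rem j S0) z z'),
    (fun z z' => phi0 j z = phi0 j z').
  split=> //; first exact: (convex_equiv_lift (Hphi0 j)).
  exact: (leaf_join_sym _ _ _ _ _ _ _ _ Hphi0 (HGam0 j) HG1c L0' J0).
- apply: filterS (filterI data hq) => a [[_ [/andP[? ?] _ _] /andP[? ?] _]].
  move=> /negP; rewrite -ltNge /= => ?; split; lra.
Unshelve. all: by end_near. Qed.

End GluingLimits.

Arguments glued_fcvg {R O P} HP {I F} FU {phi phi0 Gam Gam0} _ _ _ _ _ _ {S G G0} _ _ _.

(** If [A] is not in [F], then [F] restricted to the complement of [A] is proper and extends to an
    ultrafilter that misses [A]. *)
Lemma ultra_nbhs (X : Type) (F : set_system X) (A : set X) : Filter F ->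
  (forall U, UltraFilter U -> F `<=` U -> U A) -> F A.
Proof.
move=> FF H; have [//|nFA] := pselect (F A).
have PF : ProperFilter (within (~` A) F).
  split; last exact: within_filter.
  rewrite /within /= => F0; apply: nFA; apply: filterS F0 => x h.
  by have [//|/h] := pselect (A x).
have [U [UU sub]] := ultraFilterLemma PF.
have UA : U A.
  by apply: H => // B FB; apply: sub; apply: filterS FB.
have UnA : U (~` A) by apply: sub; apply: nearW.
by have [x []] := filter_ex (filterI UA UnA).
Qed.

Lemma prod_cvg (X : Type) (F : set_system X) (J : eqType)
    (K : J -> topologicalType) (f : X -> prod_topology K) (y : prod_topology K) :
  Filter F -> (forall i, (fun a => f a i) @ F --> y i) -> f @ F --> y.
Proof.
move=> FF h; apply/cvg_sup => i W [_ [[V oV <-] /= Vy]] VW.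
have FV : F [set a | V (f a i)] by move: (h i V (open_nbhs_nbhs (conj oV Vy))).
change (F (f @^-1` W)); apply: filterS FV => a Va; exact: VW.
Qed.

(** * The totalization as a space of cyclic families *)

Section SimplexPoints.
Context {R : realType}.

Lemma simplex0 k : simplex k (fun _ : 'I_k => 0 : R).
Proof. by split=> *; rewrite ?lexx ?ler01. Qed.

Lemma vl_simplex k (s : seq R) : vl (0 :: s) -> size s = k ->
  simplex k (fun i : 'I_k => nth 0 s i).
Proof.
rewrite /vl /= all_cat pairwise_cat add0r => /andP[/andP[s0 _]].
move=> /and3P[/allrelP s1 ps _] sk.
split=> [a b ab|a].
  move: ab; rewrite leq_eqVlt => /predU1P[->//|ab].
  by move/(pairwiseP 0): ps; apply; rewrite ?inE ?sk.
have ak : nth 0 s a \in s by rewrite mem_nth // sk.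
by rewrite (allP s0) //= s1 ?inE.
Qed.

(* Out-of-range data are sent to the zero point. *)
Definition simplex_pt (k : nat) (s : seq R) : Delta k :=
  match pselect (simplex k (fun i : 'I_k => nth 0 s i)) with
  | left h => SigSub (mem_set h)
  | right _ => SigSub (mem_set (simplex0 k))
  end.

Lemma simplex_ptE k s a : vl (0 :: s) -> size s = k -> (a < k)%N ->
  @getc R _ (set_val (simplex_pt k s)) a = nth 0 s a.
Proof.
move=> v sk ak; rewrite /simplex_pt; case: pselect => [h|]; last first.
  by case; exact: vl_simplex.
by rewrite /getc insubT.
Qed.

Definition coords (k : nat) (y : @Delta R k) : seq R :=
  [seq @getc R _ (set_val y) a | a <- iota 0 k].

Lemma size_coords k (y : @Delta R k) : size (coords k y) = k.
Proof. by rewrite size_map size_iota. Qed.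

Lemma nth_coords k (y : @Delta R k) a :
  nth 0 (coords k y) a = getc (set_val y) a.
Proof.
have [ak|ka] := ltnP a k.
  by rewrite (nth_map 0%N) ?size_iota // nth_iota.
by rewrite nth_default ?size_coords // /getc insubN // -leqNgt.
Qed.

Lemma getcE k (y : @Delta R k) (i : 'I_k) : getc (set_val y) i = set_val y i.
Proof. by rewrite /getc valK. Qed.

Lemma coords_vl k (y : @Delta R k) : vl (0 :: coords k y).
Proof.
have [mono b01] := set_mem (valP y).
have mem z : z \in coords k y -> exists i : 'I_k, z = set_val y i.
  move=> /mapP[a]; rewrite mem_iota /= add0n => ak ->.
  by exists (Ordinal ak); rewrite -getcE.
rewrite /vl /= add0r all_cat pairwise_cat /= andbT ler01 andbT.
apply/and3P; split.
- by apply/allP => z /mem[i ->]; have /andP[] := b01 i.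
- by apply/allrelP => z w /mem[i ->]; rewrite inE => /eqP->; have /andP[] := b01 i.
- rewrite andbT; apply/(pairwiseP 0) => a b; rewrite !inE size_coords => ak bk ab.
  rewrite !nth_coords // -[a]/(val (Ordinal ak)) -[b]/(val (Ordinal bk)) !getcE.
  by apply: mono; apply: ltnW.
Qed.

Lemma delta_ext k (y y' : @Delta R k) :
  (forall a, (a < k)%N -> getc (set_val y) a = getc (set_val y') a) -> y = y'.
Proof.
move=> h; apply: val_inj; apply: funext => i.
by have := h i (ltn_ord i); rewrite !getcE.
Qed.

Lemma coordsK k (y : @Delta R k) : simplex_pt k (coords k y) = y.
Proof.
apply: delta_ext => a ak.
by rewrite simplex_ptE ?size_coords ?nth_coords //; apply: coords_vl.
Qed.

Lemma coords_pt s : vl (0 :: s) -> coords (size s) (simplex_pt (size s) s) = s.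
Proof.
move=> v; apply: (@eq_from_nth _ 0); rewrite size_coords // => a ak.
by rewrite nth_coords // simplex_ptE.
Qed.

Context {I : Type} {F : set_system I} (FU : UltraFilter F).
Local Notation rcvg := (@rcvg I F R).

Lemma delta_cvg k (f : I -> @Delta R k) (y : @Delta R k) :
  (f @ F --> y) <->
  (forall a, (a < k)%N ->
    rcvg (fun i => getc (set_val (f i)) a) (getc (set_val y) a)).
Proof.
split=> [fy a ak|fy].
  apply/(rcvgP FU); rewrite /getc insubT.
  have h : continuous (fun y : @Delta R k => set_val y (Ordinal ak)).
    move=> z; apply: (@continuous_comp _ _ _ set_val
      (fun w : {ptws 'I_k -> R} => w (Ordinal ak))).
      exact: initial_continuous.
    exact: proj_continuous.
  exact: (cvg_comp _ _ fy (h y)).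
have h : (fun i => set_val (f i)) @ F --> (set_val y : {ptws 'I_k -> R}).
  apply: prod_cvg => a; apply/(rcvgP FU) => e e0.
  by have := fy a (ltn_ord a) e e0; apply: filterS => i; rewrite !getcE.
move=> W [V [[B Bo <-] Vy] VW].
have FB : F [set i | B (set_val (f i))] by move: (h B (open_nbhs_nbhs (conj Bo Vy))).
change (F (f @^-1` W)); apply: filterS FB => i Bi; exact: VW.
Qed.

Lemma coords_mcvg k (f : I -> @Delta R k) (y : @Delta R k) : f @ F --> y ->
  mcvg (F := F) [seq (fun i => getc (set_val (f i)) a, getc (set_val y) a)
    | a <- iota 0 k].
Proof.
move=> /delta_cvg fy; suff h s : all (fun a => a < k)%N s ->
    mcvg (F := F) [seq (fun i => getc (set_val (f i)) a, getc (set_val y) a) | a <- s].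
  by apply: h; apply/allP => a; rewrite mem_iota add0n.
by elim: s => //= a s IH /andP[ak /IH]; split=> //=; apply: fy.
Qed.

Lemma mcvg_nth (s : seq ((I -> R) * R)) a : mcvg (F := F) s ->
  rcvg (fun i => nth 0 (mval s i) a) (nth 0 (mlim s) a).
Proof.
elim: s a => [|p s IH] a; first by move=> _; rewrite /= !nth_nil; exact: (rcvg_cst FU 0).
by case: a => [|a] [ps ss] //=; apply: IH.
Qed.

Lemma simplex_pt_cvg k (s : seq ((I -> R) * R)) : mcvg (F := F) s -> size s = k ->
  (\forall i \near F, vl (0 :: mval s i)) ->
  (fun i => simplex_pt k (mval s i)) @ F --> simplex_pt k (mlim s).
Proof.
move=> ss sk vs.
have v0 : vl (0 :: mlim s).
  apply: (mlim_vl FU (s := (fun=> 0, 0) :: s)) => //.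
  by split=> //; exact: rcvg_cst.
apply/delta_cvg => a ak; rewrite simplex_ptE ?size_map // => e e0.
have := mcvg_nth s a ss e e0; apply: filterS2 vs => i vi.
by rewrite simplex_ptE ?size_map.
Qed.

End SimplexPoints.

(** * Compactness of the simplices *)

Section SimplexCompact.
Context {R : realType}.

Lemma delta_compact k : compact [set: @Delta R k].
Proof.
rewrite compact_ultra => U UU _.
have ex a : exists z, (a < k)%N ->
    rcvg (F := U) (fun y : Delta k => getc (set_val y) a) z.
  have [ak|ka] := boolP (a < k)%N; last by exists 0.
  have [|z _ zc] := @rcvg_bounded _ _ UU R (fun y : Delta k => getc (set_val y) a) 0 1.
    apply: nearW => y; have [_ b01] := set_mem (valP y).
    by rewrite -[a]/(val (Ordinal ak)) getcE; apply: b01.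
  by exists z.
have [z zc] := choice ex.
have S : simplex k (fun i : 'I_k => z i).
  split=> [a b ab|a].
    apply: (rcvg_le UU (zc a (ltn_ord a)) (zc b (ltn_ord b))); apply: nearW => y.
    by rewrite !getcE; have [mono _] := set_mem (valP y); apply: mono.
  apply/andP; split.
    apply: (rcvg_le UU (rcvg_cst UU 0) (zc a (ltn_ord a))); apply: nearW => y.
    by rewrite getcE; have [_ /(_ a)/andP[]] := set_mem (valP y).
  apply: (rcvg_le UU (zc a (ltn_ord a)) (rcvg_cst UU 1)); apply: nearW => y.
  by rewrite getcE; have [_ /(_ a)/andP[]] := set_mem (valP y).
exists (SigSub (mem_set S) : Delta k); split=> //.
apply/(@delta_cvg R _ U UU k id) => a ak.
have -> : getc (set_val (SigSub (mem_set S) : Delta k)) a = z a.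
  exact: (getcE _ (SigSub (mem_set S)) (Ordinal ak)).
exact: zc.
Qed.

Lemma delta_hausdorff k : hausdorff_space (@Delta R k).
Proof.
move=> y y' /=; rewrite cluster_cvgE /= => -[G PG [Gy yG]].
have [U [UU GU]] := ultraFilterLemma PG.
apply: delta_ext => a ak.
have h1 : rcvg (F := U) (fun y : Delta k => getc (set_val y) a) (getc (set_val y) a).
  apply: (iffLR (@delta_cvg R _ U UU k id y)) => // B By.
  by apply: GU; first [exact: Gy|exact: yG].
have h2 : rcvg (F := U) (fun y : Delta k => getc (set_val y) a) (getc (set_val y') a).
  apply: (iffLR (@delta_cvg R _ U UU k id y')) => // B By.
  by apply: GU; first [exact: Gy|exact: yG].
by apply: (rcvg_eq UU h1 h2); apply: nearW.
Qed.

Lemma delta_compact_nbhs k (y : @Delta R k) (W : set (Delta k)) : nbhs y W ->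
  exists K, [/\ compact K, nbhs y K & K `<=` W].
Proof.
move=> yW; have [] := compact_regular (@delta_hausdorff k) (@delta_compact k)
  (@filterT _ (nbhs y) _) yW.
move=> K yK KW; exists (closure K); split=> //.
  apply: (subclosed_compact _ (@delta_compact k)) => //; exact: closed_closure.
by apply: filterS yK; exact: subset_closure.
Qed.

End SimplexCompact.

Arguments simplex_pt {R} k s.
Arguments coords {R k} y.
Arguments simplex_pt_cvg {R I F} FU {k s} _ _ _.
Arguments delta_compact_nbhs {R k y W} _.
Arguments ultra_nbhs {X F A} _ _.

(** * From points of the totalization to cyclic families and back *)

Section Totalization.
Context {R : realType} {O : nat -> topologicalType} {P : cyc_op_mult O}.
Context (HP : is_cyc_op_mult P).
Local Notation "a '\o[' i ] b" := (ocmp P i a b)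
  (at level 40, i at level 0, left associativity, format "a  '\o[' i ]  b").
Local Notation t := (orot P).
Local Notation u := (uel P).
Local Notation T := (opel O).
Local Notation cyclic_family := (@cyclic_family R O P).

Implicit Types (x y z : R) (s A C : seq R) (ev : R -> R -> Prop).
Implicit Types G : seq R -> T.

Local Notation Tot := (@TotT R O P).

Definition tot_at (x : Tot) k (y : @Delta R k) : O k :=
  (set_val x k : Delta k -> O k) y.

Definition tot_base (x : Tot) s : T :=
  existT O (size s) (tot_at x (size s) (simplex_pt (size s) s)).

Definition tot_family (x : Tot) : seq R -> T := ext P (tot_base x).

Lemma tot_baseE (x : Tot) s k : size s = k ->
  tot_base x s = existT O k (tot_at x k (simplex_pt k s)).
Proof. by move=> <-. Qed.

Lemma tot_base_coords (x : Tot) k (y : Delta k) :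
  tot_base x (coords y) = existT O k (tot_at x k y).
Proof. by rewrite (tot_baseE x _ k) ?size_coords // coordsK. Qed.

Lemma opel_inj k (a b : O k) : existT O k a = existT O k b -> a = b.
Proof. exact: (Eqdep_dec.inj_pair2_eq_dec _ (@eq_comparable nat)). Qed.

Lemma tot_ext (x x' : Tot) :
  (forall s, vl (0 :: s) -> tot_base x s = tot_base x' s) -> x = x'.
Proof.
move=> h; apply: val_inj; apply: functional_extensionality_dep => k.
apply: funext => y; apply: opel_inj.
by have := h _ (coords_vl k y); rewrite !tot_base_coords.
Qed.

Lemma lift_id : circle_lift (@id R).
Proof. by split=> // y; exists y. Qed.

Lemma eq_convex : convex_equiv (@eq R).
Proof. exact: (convex_equiv_lift lift_id). Qed.

(** Doublings are the inner cofaces, [bas_first] and [bas_last] the outer ones, and deletions the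
    codegeneracies. Points are compared by equality here, so [bas_triv] is vacuous: 0 is not 1. *)
Lemma tot_base_based (x : Tot) : @based_family R O P (@eq R) (tot_base x).
Proof.
have [_ face degen] := set_mem (valP x).
have faceE i s s' : (i <= (size s).+1)%N -> vl (0 :: s) -> vl (0 :: s') ->
    size s' = (size s).+1 ->
    (forall a, (a < (size s).+1)%N -> nth 0 s' a = coface_nat (size s) i (nth 0 s) a) ->
    tot_base x s' = coface_op P (size s) i (tot_at x (size s) (simplex_pt (size s) s)).
  move=> ik v v' s's h; rewrite (tot_baseE x s' _ s's).
  apply: face => // a ak; rewrite simplex_ptE // h // /coface_nat.
  case: ifP => [i0|n0].
    by case: ifP => // a0; rewrite simplex_ptE //; move: a0 ak; case: a {h}.
  case: ifP => [_|i0]; first by case: ifP => // ?; rewrite simplex_ptE.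
  by case: ifP => ai; rewrite simplex_ptE //; move: n0 i0 ai ak ik; nlia.
split=> [//|A z C v|A z z' C + zz'|z C + z0|A z + z1|/eqP].
- have sE : size (A ++ C) = (size (A ++ z :: C)).-1 by rewrite !size_cat /=; nlia.
  have vAC : vl (0 :: A ++ C) by vtac.
  rewrite (tot_baseE x (A ++ C) _ sE).
  apply: (degen (size (A ++ z :: C)) (size A)); first by rewrite size_cat /=; nlia.
  move=> a ak; rewrite simplex_ptE // /codeg_nat.
  have sz : size (A ++ z :: C) = (size A + (size C).+1)%N by rewrite size_cat.
  rewrite sz in ak; case: ifP => aA.
    rewrite simplex_ptE //; last by rewrite sz; nlia.
    by rewrite !nth_cat aA.
  rewrite simplex_ptE //; last by rewrite sz; nlia.
  rewrite !nth_cat aA ifN; last by rewrite -leqNgt leqW // leqNgt aA.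
  by rewrite subSn // leqNgt aA.
- rewrite -{z'}zz' => v.
  have sz : size (A ++ z :: C) = (size A + (size C).+1)%N by rewrite size_cat.
  have sz' : size (A ++ z :: z :: C) = (size A + (size C).+2)%N by rewrite size_cat.
  have vz : vl (0 :: A ++ z :: C) by vtac.
  rewrite (faceE (size A).+1 (A ++ z :: C)) //; try nlia.
    by rewrite /coface_op; case: eqP => // _; case: eqP => //; nlia.
  move=> a ak; rewrite /coface_nat; case: eqP => // _; case: eqP => [e|_].
    by move: e sz; nlia.
  rewrite !nth_cat ltnS; have [aA|Aa|->] := ltngtP a (size A).
  + by rewrite ?(ltnW aA) ?aA.
  + have -> : (a.-1 < size A)%N = false by nlia.
    rewrite ?[(_ <= size A)%N]leqNgt ?Aa /=; have -> : (a - size A = (a.-1 - size A).+1)%N by nlia.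
    by [].
  + by rewrite ?leqnn ?ltnn subnn.
- rewrite -{z}z0 => v; have vC : vl (0 :: C) by vtac.
  rewrite (faceE 0%N C) //; first by rewrite (oprod_il HP).
  by move=> [|a].
- rewrite {z}z1 => v; have vA : vl (0 :: A) by vtac.
  have sz : size (A ++ [:: 1]) = (size A).+1 by rewrite size_cat /=; nlia.
  rewrite (faceE (size A).+1 A) //.
    by rewrite /coface_op eqxx /= (oprod_ir HP).
  move=> a ak; rewrite /coface_nat eqxx /= nth_cat; case: ifP => // h.
  by have -> : a = size A; [nlia|rewrite subnn].
- by rewrite eq_sym oner_eq0.
Qed.

Lemma tot_cyclic (x : Tot) : cyclic_family (@eq R) (tot_family x).
Proof. exact: (ext_cyclic HP eq_convex (tot_base_based x)). Qed.

Lemma tot_family0 (x : Tot) s : vl (0 :: s) -> tot_family x (0 :: s) = tot_base x s.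
Proof. exact: (ext_base HP eq_convex (tot_base_based x)). Qed.

(** The converse passage, by restriction to the output 0. The [fcvg] hypothesis for the constant
    sequence says that [G] is continuous. *)
Lemma tot_of_cyclic G : cyclic_family (@eq R) G ->
  (forall k (U : set_system (@Delta R k)), UltraFilter U ->
    fcvg (F := U) (fun=> G) G) ->
  exists x : Tot, forall s, vl (0 :: s) -> tot_base x s = G (0 :: s).
Proof.
move=> HG cont.
have arG k (y : Delta k) : ar (G (0 :: coords y)) = k.
  by rewrite (cyc_ar HG) ?size_coords //; exact: coords_vl.
pose F k (y : Delta k) : O k := ecast i (O i) (arG k y) (projT2 (G (0 :: coords y))).
have FE k (w : Delta k) : existT O k (F k w) = G (0 :: coords w).
  by rewrite /F; move: (arG k w); case: (G _) => n a /= e; case: k / e w.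
have Fmem : @TotSet R O P (fun k => F k).
  split=> [k w W wW|k i ik w w' h|k i ik w w' h].
  - change (nbhs w (F k @^-1` W)); apply: ultra_nbhs => U UU wU.
    pose ms := (fun=> 0 : R, 0 : R) :: [seq (fun v : Delta k => getc (set_val v) a,
      getc (set_val w) a) | a <- iota 0 k].
    have msv v : mval ms v = 0 :: coords v by rewrite /mval /= -map_comp.
    have msl : mlim ms = 0 :: coords w by rewrite /mlim /= -map_comp.
    have cms : mcvg (F := U) ms.
      by split; [exact: rcvg_cst|exact: (coords_mcvg UU k id w wU)].
    have := cont k U UU ms cms; rewrite msl -FE => /(_ _ W wW) /=.
    have vms : \forall v \near U, vl (mval ms v).
      by apply: nearW => v; rewrite msv; exact: coords_vl.
    move=> /(_ vms); apply: filterS => v [b Wb] e.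
    have {}e : G (mval ms v) = existT O k b by exact: e.
    by move: e; rewrite msv -FE => /opel_inj e; rewrite /preimage /= e.
  - have v := coords_vl k w; have v' := coords_vl k.+1 w'.
    have sk := size_coords k w; have sk' := size_coords k.+1 w'.
    have {}h a : (a < k.+1)%N -> nth 0 (coords w') a = coface_nat k i (nth 0 (coords w)) a.
      by move=> ak; rewrite nth_coords h // (funext (nth_coords k w)).
    rewrite FE /coface_op; case: eqP => [i0|i0]; [|case: eqP => [i1|i1]].
    + have -> : coords w' = 0 :: coords w.
        apply: (@eq_from_nth _ 0); rewrite ?sk' /= ?sk // => a ak.
        by rewrite h // i0; case: a {ak}.
      rewrite (cyc_head_dbl HP HG) //; last by vtac.
      by rewrite [LHS](oprod_il HP) -FE.
    + have -> : coords w' = coords w ++ [:: 1].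
        apply: (@eq_from_nth _ 0); rewrite ?size_cat ?sk' ?sk /= ?addn1 // => a ak.
        rewrite h // /coface_nat i1 eqxx /= nth_cat sk; case: ifP => // ka.
        by have -> : a = k; [nlia|rewrite subnn].
      rewrite (cyc_tail_dbl HP eq_convex HG) ?add0r //; last by vtac.
      by rewrite [LHS](oprod_ir HP) -FE.
    + have [A [z [C [sE sA]]]] : exists A z C, coords w = A ++ z :: C /\ size A = i.-1.
        exists (take i.-1 (coords w)), (nth 0 (coords w) i.-1), (drop i (coords w)).
        rewrite size_takel ?sk; last by nlia.
        split=> //; have -> : i = i.-1.+1 by nlia.
        by rewrite -drop_nth ?cat_take_drop ?sk //; nlia.
      have sC : (size A + (size C).+1)%N = k by rewrite -sk sE size_cat.
      have s'E : coords w' = A ++ z :: z :: C.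
        apply: (@eq_from_nth _ 0); rewrite sk' ?size_cat /=; first by nlia.
        move=> a ak; rewrite h // /coface_nat; case: eqP => // _; case: eqP => // _.
        rewrite sE !nth_cat; have [aA|Aa|->] := ltngtP a (size A).
        * by have -> : (a < i)%N; [nlia|rewrite ?aA].
        * have -> : (a < i)%N = false by nlia.
          have -> : (a.-1 < size A)%N = false by nlia.
          by have -> : (a - size A = (a.-1 - size A).+1)%N by nlia.
        * by have -> : (size A < i)%N; [nlia|rewrite ?ltnn subnn].
      rewrite s'E in v' *; rewrite (cyc_dbl HP HG v') // -sE -FE sA.
      by have -> : i.-1.+1 = i by nlia.
  - have v := coords_vl k w; have sk := size_coords k w.
    have sk' := size_coords k.-1 w'.
    have {}h a : (a < k.-1)%N -> nth 0 (coords w') a = codeg_nat i (nth 0 (coords w)) a.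
      by move=> ak; rewrite nth_coords h // (funext (nth_coords k w)).
    have [A [z [C [sE sA]]]] : exists A z C, coords w = A ++ z :: C /\ size A = i.
      exists (take i (coords w)), (nth 0 (coords w) i), (drop i.+1 (coords w)).
      rewrite size_takel ?sk; last by nlia.
      by rewrite -drop_nth ?cat_take_drop ?sk.
    have sC : (size A + (size C).+1)%N = k by rewrite -sk sE size_cat.
    have s'E : coords w' = A ++ C.
      apply: (@eq_from_nth _ 0); rewrite sk' ?size_cat /=; first by nlia.
      move=> a ak; rewrite h // /codeg_nat sE !nth_cat sA.
      case: ltnP => // ia; rewrite ifN; last by rewrite -leqNgt leqW.
      by rewrite subSn.
    rewrite sE in v; rewrite FE s'E (cyc_del HP HG v) -sE -FE sA.
    by [].
exists (SigSub (mem_set Fmem)) => s v.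
by rewrite /tot_base -[in RHS](coords_pt s v) -FE.
Qed.

(** The formula defining [ext], with the cut at a prescribed integer and with weak inequalities
    only. One integer and one splitting can then serve a whole sequence and its limit, where points
    may reach the cut. *)
Lemma cyc_split ev G (n : int) x A C : cyclic_family ev G ->
  vl (x :: A ++ C) -> n%:~R <= x -> x <= n%:~R + 1 ->
  all (<=%R^~ (n%:~R + 1)) A -> all (<=%R (n%:~R + 1)) C ->
  G (x :: A ++ C) = iter (size C).+1 t (G (0 :: map (+%R^~ (- (n%:~R + 1))) C ++
    x - n%:~R :: map (+%R^~ (- n%:~R)) A)) \o[(size A).+1] u.
Proof.
move=> HG v nx xn An nC; have v1 : vl (x :: A ++ (n%:~R + 1) :: C) by vtac.
rewrite (cyc_del HP HG v1); congr (ocmp P _ _ _).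
have v2 : vl (n%:~R :: map (+%R^~ (- 1)) C ++ x :: A) by vtac.
have := cyc_rotn HG v2; rewrite size_map map_shiftD addNr map_shift0 => <-.
rewrite -(cyc_shift HP HG (- n) v2) /= mulrNz subrr map_cat /= map_shiftD.
by rewrite opprD [- 1 - _]addrC.
Qed.

Context {I : Type} {F : set_system I} (FU : UltraFilter F).

(** Evaluation is continuous for the compact-open topology because simplices are locally compact:
    some compact neighbourhood of [y0] is mapped by [x0] into the interior of [W]. *)
Lemma tot_at_cvg (x_ : I -> Tot) (x0 : Tot) k (y_ : I -> Delta k) (y0 : Delta k) :
  x_ @ F --> x0 -> y_ @ F --> y0 ->
  (fun a => tot_at (x_ a) k (y_ a)) @ F --> tot_at x0 k y0.
Proof.
move=> cx cy W W0; have [cont _ _] := set_mem (valP x0).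
have [K [cK yK KW]] := delta_compact_nbhs (cont k y0 _ (nbhs_interior W0)).
have cxk : (fun a => set_val (x_ a) k : {compact-open, Delta k -> O k}) @ F -->
    (set_val x0 k : {compact-open, Delta k -> O k}).
  have h1 : (fun a => set_val (x_ a)) @ F --> (set_val x0 : MapProd).
    exact: (cvg_comp _ _ cx (@initial_continuous _ _ _ x0)).
  exact: (cvg_comp _ _ h1 (@proj_continuous _ _ k (set_val x0))).
have := iffLR (compact_open_cvgP _ _) cxk K (W^°) cK (@open_interior _ W).
have h : [set set_val x0 k x | x in K] `<=` W^° by move=> _ [z Kz <-]; exact: KW.
move=> /(_ (fmap_filter _ _) h) hF; change (F [set a | W (tot_at (x_ a) k (y_ a))]).
near=> a; apply: interior_subset.
have ha : [set set_val (x_ a) k x | x in K] `<=` W^° by near: a; exact: hF.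
by apply: ha; exists (y_ a) => //; near: a; exact: cy.
Unshelve. all: by end_near. Qed.

Lemma tot_base_cvg (x_ : I -> Tot) (x0 : Tot) (y : seq ((I -> R) * R)) :
  x_ @ F --> x0 -> mcvg (F := F) y -> (\forall a \near F, vl (0 :: mval y a)) ->
  ocvg (F := F) (fun a => tot_base (x_ a) (mval y a)) (tot_base x0 (mlim y)).
Proof.
move=> cx cy vy; have sl : size (mlim y) = size y by rewrite size_map.
rewrite (tot_baseE x0 _ _ sl) => W /= W0.
have cp := simplex_pt_cvg FU cy erefl vy.
have FW : F [set a | W (tot_at (x_ a) (size y) (simplex_pt (size y) (mval y a)))].
  exact: (tot_at_cvg _ _ _ _ _ cx cp W W0).
apply: filterS FW => a Wa.
exists (tot_at (x_ a) (size y) (simplex_pt (size y) (mval y a))) => //.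
by rewrite (tot_baseE (x_ a) _ (size y)) ?size_map.
Qed.

Lemma tot_fcvg (x_ : I -> Tot) (x0 : Tot) : x_ @ F --> x0 ->
  fcvg (F := F) (fun a => tot_family (x_ a)) (tot_family x0).
Proof.
move=> cx [|x s] cy vy; first by have [a] := filter_ex vy.
have [xc sc] := cy; pose l := Num.floor (x.2 - 1).
have lP := floor_itv (x.2 - 1); rewrite -/l intrD /= in lP.
(* The floor of the moving output need not tend to the floor of its limit, but once the output is
   within 1 of the limit its floor lies in [[l, l + 4)], hence is constant along the ultrafilter. *)
have [n xn] : exists n : int, \forall a \near F, n%:~R <= x.1 a <= n%:~R + 1.
  have [|k _ kE] := @ultra_pick _ _ FU 4 (fun a => `|Num.floor (x.1 a) - l|%N).
    apply: filterS (xc 1 ltr01) => a; rewrite ltr_norml => /andP[h1 h2].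
    have := floor_itv (x.1 a); rewrite intrD => h.
    have h3 : (Num.floor (x.1 a) < l + 4)%R by rewrite -(ltr_int R) intrD; lra.
    have h4 : (l < Num.floor (x.1 a) + 1)%R by rewrite -(ltr_int R) intrD; lra.
    by lia.
  exists (l + k%:Z).
  apply: filterS (filterI kE (xc 1 ltr01)) => a [ka]; rewrite ltr_norml => /andP[h1 h2].
  have := floor_itv (x.1 a); rewrite intrD => h.
  have h4 : (l < Num.floor (x.1 a) + 1)%R by rewrite -(ltr_int R) intrD; lra.
  have <- : Num.floor (x.1 a) = l + k%:Z by lia.
  by lra.
pose N := n%:~R + 1 : R.
have cut a : exists k : nat, vl (mval (x :: s) a) -> [/\ (k <= size s)%N,
    all (<=%R^~ N) (mval (take k s) a) & all (<=%R N) (mval (drop k s) a)].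
  have [va|nv] := boolP (vl (mval (x :: s) a)); last by exists 0%N.
  have [A [C [sE AN NC]]] := vl_split N va.
  have {}sE : mval s a = A ++ C by [].
  exists (size A) => _.
  have -> : mval (take (size A) s) a = A by rewrite /mval map_take -/(mval s a) sE take_size_cat.
  have -> : mval (drop (size A) s) a = C by rewrite /mval map_drop -/(mval s a) sE drop_size_cat.
  split=> //.
    by have := congr1 size sE; rewrite size_map size_cat => ->; exact: leq_addr.
  by apply: sub_all AN => z /ltW.
have {cut}[k_ kP] := choice cut.
have [|k _ kE] := @ultra_pick _ _ FU (size s).+1 k_.
  by apply: filterS vy => a /kP[].
pose A := take k s; pose C := drop k s.
have sE : s = A ++ C by rewrite /A /C cat_take_drop.
pose sh (c : R) (r : seq ((I -> R) * R)) := [seq ((fun a => p.1 a + c), p.2 + c) | p <- r].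
have shv c r a : mval (sh c r) a = map (+%R^~ c) (mval r a).
  by rewrite /mval /sh -!map_comp.
have shl c r : mlim (sh c r) = map (+%R^~ c) (mlim r).
  by rewrite /mlim /sh -!map_comp.
have shc c r : mcvg (F := F) r -> mcvg (F := F) (sh c r).
  elim: r => //= p r IH [pc /IH]; split=> //.
  exact: (rcvgD FU pc (rcvg_cst FU c)).
have [cA cC] := iffLR (mcvg_cat _ _) (eq_ind _ mcvg sc _ sE).
have x2n : n%:~R <= x.2 <= N.
  apply/andP; split.
    by apply: (rcvg_le FU (rcvg_cst FU _) xc); apply: filterS xn => a /andP[].
  by apply: (rcvg_le FU xc (rcvg_cst FU _)); apply: filterS xn => a /andP[].
have v0 := mlim_vl FU cy vy.
pose D := sh (- N) C ++ ((fun a => x.1 a - n%:~R), x.2 - n%:~R) :: sh (- n%:~R) A.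
have cD : mcvg (F := F) D.
  apply/mcvg_cat; split; first exact: shc.
  by split; [exact: (rcvgD FU xc (rcvg_cst FU _))|exact: shc].
have ACa : \forall a \near F, all (<=%R^~ N) (mval A a) /\ all (<=%R N) (mval C a).
  by apply: filterS (filterI vy kE) => a [/kP[_ h1 h2] ka]; rewrite /A /C -ka.
have lim_all (r : seq ((I -> R) * R)) (b : R) : mcvg (F := F) r ->
    ((\forall a \near F, all (<=%R^~ b) (mval r a)) -> all (<=%R^~ b) (mlim r)) /\
    ((\forall a \near F, all (<=%R b) (mval r a)) -> all (<=%R b) (mlim r)).
  elim: r => [|p r IH] //= [pc /IH[IH1 IH2]]; split=> h; apply/andP; split.
  - by apply: (rcvg_le FU pc (rcvg_cst FU b)); apply: filterS h => a /andP[].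
  - by apply: IH1; apply: filterS h => a /andP[].
  - by apply: (rcvg_le FU (rcvg_cst FU b) pc); apply: filterS h => a /andP[].
  - by apply: IH2; apply: filterS h => a /andP[].
have A0 : all (<=%R^~ N) (mlim A).
  have [h _] := lim_all A N cA; by apply: h; apply: filterS ACa => a [].
have C0 : all (<=%R N) (mlim C).
  have [_ h] := lim_all C N cC; by apply: h; apply: filterS ACa => a [].
have vD (x' : R) A' C' : vl (x' :: A' ++ C') -> n%:~R <= x' <= N ->
    all (<=%R^~ N) A' -> all (<=%R N) C' ->
    vl (0 :: map (+%R^~ (- N)) C' ++ x' - n%:~R :: map (+%R^~ (- n%:~R)) A').
  rewrite /N => v /andP[h1 h2] h3 h4.
  have v' : vl (n%:~R :: map (+%R^~ (- 1)) C' ++ x' :: A') by vtac.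
  have : vl (map (+%R^~ (- n%:~R)) (n%:~R :: map (+%R^~ (- 1)) C' ++ x' :: A')).
    by rewrite vl_shift.
  rewrite /= map_cat /= subrr map_shiftD.
  by rewrite opprD [- 1 - _]addrC.
have split_at (X : Tot) (x' : R) A' C' : vl (x' :: A' ++ C') -> n%:~R <= x' <= N ->
    all (<=%R^~ N) A' -> all (<=%R N) C' ->
    tot_family X (x' :: A' ++ C') = iter (size C').+1 t (tot_base X
      (map (+%R^~ (- N)) C' ++ x' - n%:~R :: map (+%R^~ (- n%:~R)) A')) \o[(size A').+1] u.
  move=> v h h3 h4; have /andP[h1 h2] := h.
  by rewrite (cyc_split _ _ _ _ _ _ (tot_cyclic X) v h1 h2 h3 h4) tot_family0 // vD.
have sE0 : mlim (x :: s) = x.2 :: mlim A ++ mlim C by rewrite sE /mlim /= map_cat.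
have sEa a : mval (x :: s) a = x.1 a :: mval A a ++ mval C a.
  by rewrite sE /mval /= map_cat.
have DE a : mval D a = map (+%R^~ (- N)) (mval C a) ++ x.1 a - n%:~R ::
    map (+%R^~ (- n%:~R)) (mval A a) by rewrite /D /mval map_cat /= -!/(mval _ a) !shv.
have DE0 : mlim D = map (+%R^~ (- N)) (mlim C) ++ x.2 - n%:~R ::
    map (+%R^~ (- n%:~R)) (mlim A) by rewrite /D /mlim map_cat /= -!/(mlim _) !shl.
rewrite sE0 in v0 *; rewrite split_at // -DE0.
have lim : ocvg (F := F) (fun a => ocmp P (size A).+1
      (iter (size C).+1 t (tot_base (x_ a) (mval D a))) u)
    (ocmp P (size (mlim A)).+1 (iter (size (mlim C)).+1 t (tot_base x0 (mlim D))) u).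
  rewrite !size_map; apply: (ocvg_ocmp HP).
  - by rewrite ar_iter_orot /= DE0 size_cat /= !size_map; nlia.
  - apply: (ocvg_iter_orot HP); apply: tot_base_cvg => //.
    apply: filterS (filterI (filterI vy xn) ACa) => a [[va xa] [Aa Ca]].
    by rewrite DE; apply: vD => //; rewrite -sEa.
  - exact: ocvg_cst.
apply: ocvg_ext lim; apply: filterS (filterI (filterI vy xn) ACa) => a [[va xa] [Aa Ca]].
by rewrite sEa split_at ?DE ?size_map // -sEa.
Qed.

(** If convergence failed for a compact [K] and an open [W], almost every [x_ a] would have a bad
    point in [K]. These points converge in [K], and the hypothesis at their limit is
    contradicted. *)
Lemma tot_cvg (x_ : I -> Tot) (x0 : Tot) :
  (forall k (y_ : I -> Delta k) (y0 : Delta k), y_ @ F --> y0 ->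
    (fun a => tot_at (x_ a) k (y_ a)) @ F --> tot_at x0 k y0) ->
  x_ @ F --> x0.
Proof.
move=> h.
have h1 : (fun a => set_val (x_ a)) @ F --> (set_val x0 : MapProd).
  apply: prod_cvg => k; apply/compact_open_cvgP => K W cK oW KW.
  have [//|nW] := ultra_or FU [set a | [set set_val (x_ a) k z | z in K] `<=` W].
  have ex a : exists y : Delta k, ~ ([set set_val (x_ a) k z | z in K] `<=` W) ->
      K y /\ ~ W (tot_at (x_ a) k y).
    have [//|] := pselect ([set set_val (x_ a) k z | z in K] `<=` W).
      by move=> H; exists (simplex_pt k [::]).
    move=> /existsNP[_ /not_implyP[[z Kz <-] nWz]]; by exists z.
  have [y_ yP] := choice ex.
  have yK : \forall a \near F, K (y_ a).
    by apply: filterS nW => a /yP[].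
  have [y0 Ky0 cy] := ultra_compact_cvg FU cK yK.
  have W0 : nbhs (tot_at x0 k y0) W.
    by apply: open_nbhs_nbhs; split=> //; apply: KW; exists y0.
  have FW : F [set a | W (tot_at (x_ a) k (y_ a))] by exact: (h k y_ y0 cy W W0).
  by have [a [/yP[_ nWa] Wa]] := filter_ex (filterI nW FW).
move=> W [V [[B Bo <-] Vy] VW].
have FB : F [set i | B (set_val (x_ i))].
  by move: (h1 B (open_nbhs_nbhs (conj Bo Vy))).
change (F (x_ @^-1` W)); apply: filterS FB => i Bi; exact: VW.
Qed.

End Totalization.

Arguments tot_family {R O} P x s.
Arguments tot_base {R O} P x s.
Arguments tot_cyclic {R O P} HP x.
Arguments tot_family0 {R O P} HP x {s} _.
Arguments tot_of_cyclic {R O P} HP {G} _ _.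
Arguments tot_ext {R O P x x'} _.
Arguments tot_baseE {R O P} x {s k} _.
Arguments tot_fcvg {R O P} HP {I F} FU {x_ x0} _.
Arguments tot_cvg {R O P I F} FU {x_ x0} _.

(** * Lifts of the cactus map *)

Section Lifts.
Context {R : realType}.
Implicit Types (f g phi : R -> R) (x y : R).

(** Surjectivity gives continuity: preimages of [phi x - e / 2] and [phi x + e / 2] enclose [x]. *)
Lemma lift_near phi x e : circle_lift phi -> 0 < e ->
  exists2 d, 0 < d & forall y, `|y - x| < d -> `|phi y - phi x| < e.
Proof.
move=> Hphi e0; have [a pa] := lift_onto Hphi (phi x - e / 2).
have [b pb] := lift_onto Hphi (phi x + e / 2).
have ax : a < x by apply: (lift_lt Hphi); lra.
have xb : x < b by apply: (lift_lt Hphi); lra.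
exists (Num.min (x - a) (b - x)); first by rewrite lt_min; apply/andP; split; lra.
move=> y; rewrite lt_min !ltr_norml => /andP[/andP[h1 h2] /andP[h3 h4]].
have hy1 : phi a <= phi y by apply: (lift_le Hphi); lra.
have hy2 : phi y <= phi b by apply: (lift_le Hphi); lra.
by apply/andP; split; lra.
Qed.

Lemma lift_rcvg (I : Type) (F : set_system I) (FF : Filter F) phi (x : I -> R) x0 :
  circle_lift phi -> rcvg (F := F) x x0 ->
  rcvg (F := F) (fun a => phi (x a)) (phi x0).
Proof.
move=> Hphi xc e e0; have [d d0 h] := lift_near _ x0 _ Hphi e0.
by apply: filterS (xc d d0) => a; exact: h.
Qed.

Lemma lift_continuous phi : circle_lift phi -> continuous phi.
Proof.
move=> Hphi x; have h : rcvg (F := nbhs x) phi (phi x).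
  apply: (lift_rcvg _ _ _ phi id x Hphi) => e e0.
  by apply: filterS (nbhsx_ballx x e e0) => y; rewrite /ball /= distrC.
by apply/cvgrPdist_lt => e e0; apply: filterS (h e e0) => y; rewrite distrC.
Qed.

Lemma int_half (n : int) : n%:~R != (2^-1 : R).
Proof.
apply/eqP => h; have [n0|n1] := lerP n 0.
  have : (n%:~R : R) <= 0%:~R by rewrite ler_int.
  by rewrite h; lra.
have : (1%:~R : R) <= n%:~R by rewrite ler_int.
by rewrite h; lra.
Qed.

(* Continuous functions with integral difference differ by a constant. *)
Lemma lift_uniq phi psi : circle_lift phi -> circle_lift psi ->
  (forall x, exists n : int, phi x = psi x + n%:~R) ->
  exists n : int, forall x, phi x = psi x + n%:~R.
Proof.
move=> Hphi Hpsi /choice[D DE].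
suff const x y : x <= y -> D x = D y.
  by exists (D 0) => x; rewrite DE; have [/const->//|/ltW/const<-//] := leP 0 x.
move=> xy; apply/eqP; rewrite -(eqr_int R); apply/negPn/negP => neq.
pose d z : R := phi z - psi z.
have dE z : d z = (D z)%:~R by rewrite /d DE addrAC subrr add0r.
have dc : continuous d.
  move=> z; apply: cvgB; exact: lift_continuous.
(* Two different integral values of [d] enclose some [n + 1/2], which [d] would have to attain. *)
have [n vP] : exists n : int,
    Num.min (d x) (d y) <= n%:~R + 2^-1 <= Num.max (d x) (d y).
  rewrite !dE; have [xy'|yx'|e] := ltgtP ((D x)%:~R : R) (D y)%:~R.
  - exists (D x); have : (D x + 1)%:~R <= ((D y)%:~R : R).
      by rewrite ler_int lezD1 -(ltr_int R).
    by rewrite intrD /=; lra.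
  - exists (D y); have : (D y + 1)%:~R <= ((D x)%:~R : R).
      by rewrite ler_int lezD1 -(ltr_int R).
    by rewrite intrD /=; lra.
  - by rewrite e eqxx in neq.
have [|z _] := IVT xy _ vP; first exact: continuous_subspaceT.
rewrite dE => /(congr1 (fun r => r - n%:~R)); rewrite addrAC subrr add0r -intrB.
exact/eqP/int_half.
Qed.

Definition lift_of g x : R := (Num.floor x)%:~R + g (fracR x).

(** The cell is closed: at its right end the value [g 1 = 1] makes up for the jump of the floor. *)
Lemma lift_ofE g (n : int) x : g 0 = 0 -> g 1 = 1 -> n%:~R <= x <= n%:~R + 1 ->
  lift_of g x = n%:~R + g (x - n%:~R).
Proof.
move=> g0 g1 /andP[nx]; rewrite le_eqVlt => /predU1P[->|xn].
  rewrite /lift_of /fracR -[1]/(1%:~R) -intrD intrKfloor.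
  by rewrite subrr g0 intrD /= addr0 addrAC subrr add0r g1.
by rewrite /lift_of /fracR (floor_def (m := n)) // intrD nx.
Qed.

Lemma floor_cell x : exists n : int, n%:~R <= x <= n%:~R + 1.
Proof. by exists (Num.floor x); have := floor_itv x; rewrite intrD; lra. Qed.

Lemma lift_ofP g : g 0 = 0 -> g 1 = 1 ->
  (forall x y, 0 <= x -> x <= y -> y <= 1 -> g x <= g y) ->
  (forall v, 0 <= v <= 1 -> exists2 x, 0 <= x <= 1 & g x = v) ->
  circle_lift (lift_of g).
Proof.
move=> g0 g1 gle gonto; split=> [x y xy|x|v].
- have b z : 0 <= g (fracR z) <= 1.
    have := floor_itv z; rewrite intrD => hz.
    have h1 : g 0 <= g (fracR z) by apply: gle; rewrite /fracR; lra.
    have h2 : g (fracR z) <= g 1 by apply: gle; rewrite /fracR; lra.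
    by rewrite g0 in h1; rewrite g1 in h2; rewrite h1.
  have := b x; have := b y; rewrite /lift_of.
  have [e by_ bx|ne by_ bx] := eqVneq (Num.floor x) (Num.floor y).
    rewrite e lerD2l; have hx := floor_itv x; have hy := floor_itv y.
    by rewrite e !intrD in hx hy; apply: gle; rewrite /fracR ?e; lra.
  have : (Num.floor x)%:~R + 1 <= ((Num.floor y)%:~R : R).
    rewrite -[1]/(1%:~R) -intrD ler_int lezD1 lt_neqAle ne /= floor_ge_int.
    exact: le_trans (floor_le x) xy.
  by lra.
- have [n nx] := floor_cell x.
  rewrite (lift_ofE _ n x) // (lift_ofE _ (n + 1) (x + 1)) //; last by rewrite intrD; lra.
  by rewrite intrD; rewrite opprD addrACA subrr addr0 addrAC.
- have [n nv] := floor_cell v.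
  have [|x x01 gx] := gonto (v - n%:~R); first by lra.
  exists (x + n%:~R); rewrite (lift_ofE _ n) //; last by lra.
  by rewrite addrK gx addrC subrK.
Qed.

End Lifts.

Arguments lift_rcvg {R I F FF phi x x0} _ _.
Arguments lift_continuous {R phi} _.
Arguments lift_uniq {R phi psi} _ _ _.
Arguments lift_of {R} g x.
Arguments lift_ofE {R g} n x _ _ _.
Arguments lift_ofP {R g} _ _ _ _.
Arguments floor_cell {R} x.

(** * The measure of a lobe along the circle *)

Section Mass.
Context {R : realType}.
Implicit Types (A B : set R) (x y s : R).
Local Notation mu := (@lebesgue_measure R).

Definition mass A s : R := fine (mu (A `&` [set r | 0 <= r <= s])).

Lemma mu_fin A x y : measurable A -> A `<=` `[x, y] -> mu A \is a fin_num.
Proof.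
move=> mA Axy; rewrite ge0_fin_numE //.
have h : (mu A <= mu (`[x, y]%classic : set R))%E.
  by apply: le_measure; rewrite ?inE //; exact: measurable_itv.
apply: le_lt_trans h _.
by rewrite /= lebesgue_measure_itv /=; case: ifP => _; rewrite ?ltry.
Qed.

(** The second piece is the part of the arc that has wrapped past 0. *)
Lemma arcE (a L : R) : 0 <= a < 1 -> Defs.arc a L =
  [set t | 0 <= t < 1] `&` ([set t | a <= t <= a + L] `|`
    [set t | t < a /\ t <= a + L - 1]).
Proof.
move=> a01; apply/seteqP; split=> t /=; rewrite /Defs.arc /= /fracR.
  move=> [t01 h]; split=> //; have [ta|at_] := ltP t a; [right|left].
    have e : Num.floor (t - a) = -1 by apply: floor_def; rewrite intrD; lra.
    by rewrite e in h; split=> //; lra.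
  have e : Num.floor (t - a) = 0 by apply: floor_def; rewrite intrD; lra.
  by rewrite e in h; lra.
move=> [t01 [h|[h1 h2]]]; split=> //.
  have -> : Num.floor (t - a) = 0 by apply: floor_def; rewrite intrD; lra.
  by rewrite subr0; lra.
have -> : Num.floor (t - a) = -1 by apply: floor_def; rewrite intrD; lra.
by rewrite opprK; lra.
Qed.

Lemma arc_measurable (a L : R) : 0 <= a < 1 -> measurable (Defs.arc a L).
Proof.
move=> a01; rewrite arcE //; apply: measurableI.
  have -> : [set t : R | 0 <= t < 1] = `[0, 1[%classic.
    by apply/seteqP; split=> t /=; rewrite in_itv.
  exact: measurable_itv.
apply: measurableU.
  have -> : [set t : R | a <= t <= a + L] = `[a, a + L]%classic.
    by apply/seteqP; split=> t /=; rewrite in_itv.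
  exact: measurable_itv.
have -> : [set t : R | t < a /\ t <= a + L - 1] = `]-oo, a[ `&` `]-oo, a + L - 1].
  by apply/seteqP; split=> t /=; rewrite !in_itv.
by apply: measurableI; exact: measurable_itv.
Qed.

Lemma closed_1sub_measurable A : closed_1sub A -> measurable A.
Proof.
move=> [s [sP ->]]; have {sP} : all (fun p : R * R => 0 <= p.1 < 1) s.
  by apply/allP => p /sP[].
elim: s => [_|p s IH /= /andP[p01 /IH ms]].
  have -> : [set t : R | exists2 p, p \in [::] & Defs.arc p.1 p.2 t] = set0.
    by apply/seteqP; split=> // t [].
  exact: measurable0.
have -> : [set t : R | exists2 q, q \in p :: s & Defs.arc q.1 q.2 t] =
    Defs.arc p.1 p.2 `|` [set t : R | exists2 q, q \in s & Defs.arc q.1 q.2 t].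
  apply/seteqP; split=> t.
    by move=> [q]; rewrite inE => /predU1P[->|qs] qt; [left|right; exists q].
  move=> [pt|[q qs qt]]; first by exists p; rewrite ?mem_head.
  by exists q; rewrite // inE qs orbT.
by apply: measurableU => //; exact: arc_measurable.
Qed.

Lemma closed_1sub_bound A : closed_1sub A -> A `<=` [set t | 0 <= t < 1].
Proof. by move=> [s [_ ->]] t [p _ []]. Qed.

(* Only end points of the arcs can fail to be interior. *)
Lemma closed_1sub_cint A : closed_1sub A ->
  exists E : seq R, forall t, 0 < t < 1 -> A t -> t \notin E -> cint A t.
Proof.
move=> [s [sP ->]].
exists ([seq p.1 | p <- s] ++ [seq p.1 + p.2 | p <- s] ++ [seq p.1 + p.2 - 1 | p <- s]).
move=> t t01 [p ps pt]; rewrite !mem_cat !negb_or => /and3P[h1 h2 h3].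
have tp1 : t != p.1 by apply: contraNneq h1 => ->; exact: map_f.
have tp2 : t != p.1 + p.2.
  by apply: contraNneq h2 => ->; exact: (map_f (fun p => p.1 + p.2)).
have tp3 : t != p.1 + p.2 - 1.
  by apply: contraNneq h3 => ->; exact: (map_f (fun p => p.1 + p.2 - 1)).
have [p01 p2] := sP p ps; rewrite arcE // in pt.
split; first by lra.
(* This radius keeps [t + r] inside the unit interval and on the same side of every end point of the
   arc. *)
have d0 : 0 < Num.min (Num.min t (1 - t)) (Num.min `|t - p.1|
    (Num.min `|t - (p.1 + p.2)| `|t - (p.1 + p.2 - 1)|)).
  by rewrite !lt_min !normr_gt0 !subr_eq0 tp1 tp2 tp3; lra.
exists (Num.min (Num.min t (1 - t)) (Num.min `|t - p.1|
    (Num.min `|t - (p.1 + p.2)| `|t - (p.1 + p.2 - 1)|))) => // r.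
move=> {d0 tp1 tp2 tp3 h1 h2 h3}.
rewrite !lt_min !ltr_norml => /andP[/andP[/andP[r1 r2] /andP[r3 r4]]].
move=> /andP[/andP[r5 r6] /andP[/andP[r7 r8] /andP[r9 r10]]].
have -> : fracR (t + r) = t + r.
  rewrite /fracR (floor_def (m := 0)) ?subr0 // intrD /=; lra.
exists p => //; rewrite arcE //; case: pt => _ pt; split=> /=; first by lra.
case: pt => /= [/andP[h4 h5]|[h4 h5]]; [left|right].
  have e1 : `|t - p.1| = t - p.1 by rewrite ger0_norm; lra.
  have e2 : `|t - (p.1 + p.2)| = p.1 + p.2 - t by rewrite ler0_norm; lra.
  by rewrite e1 in r5 r6; rewrite e2 in r7 r8; lra.
have e1 : `|t - p.1| = p.1 - t by rewrite ler0_norm; lra.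
have e2 : `|t - (p.1 + p.2 - 1)| = p.1 + p.2 - 1 - t by rewrite ler0_norm; lra.
by rewrite e1 in r5 r6; rewrite e2 in r9 r10; split; lra.
Qed.

Lemma initial_itv s : [set r | 0 <= r <= s] = `[0, s]%classic.
Proof. by apply/seteqP; split=> t /=; rewrite in_itv. Qed.

Lemma mass_diff A x y : measurable A -> 0 <= x <= y ->
  mass A y = mass A x + fine (mu (A `&` `]x, y])).
Proof.
move=> mA xy; have m1 : measurable (A `&` `[0, x]) by exact: measurableI.
have m2 : measurable (A `&` `]x, y]) by exact: measurableI.
rewrite /mass !initial_itv -fineD; last 2 first.
- by apply: (mu_fin _ 0 x) => // z [].
- by apply: (mu_fin _ x y) => // z [_]; rewrite /= !in_itv /=; lra.
rewrite -measureU //; last first.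
  by apply/seteqP; split=> // z /= [[_ +] [_ +]]; rewrite !in_itv /=; lra.
congr (fine (mu _)); rewrite -setIUr; congr (_ `&` _).
by apply/seteqP; split=> z /=; rewrite !in_itv /=; lra.
Qed.

Lemma mass_itv A x y : measurable A -> x <= y ->
  0 <= fine (mu (A `&` `]x, y])) <= y - x.
Proof.
move=> mA xy; have m2 : measurable (A `&` `]x, y]) by exact: measurableI.
rewrite fine_ge0 //= -lee_fin fineK; last first.
  by apply: (mu_fin _ x y) => // z [_]; rewrite /= !in_itv /=; lra.
have h : (mu (A `&` `]x, y]) <= mu (`]x, y]%classic : set R))%E.
  by apply: le_measure; rewrite ?inE //; exact: measurable_itv.
apply: le_trans h _.
rewrite /= lebesgue_measure_itv /= lte_fin; case: ifP => _ //.
by rewrite lee_fin subr_ge0.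
Qed.

Lemma mass_lip A x y : measurable A -> 0 <= x <= y ->
  mass A x <= mass A y <= mass A x + (y - x).
Proof.
move=> mA xy; rewrite (mass_diff A x y) //.
have xy' : x <= y by lra.
by have /andP[h1 h2] := mass_itv A x y mA xy'; apply/andP; split; lra.
Qed.

Lemma mass0 A : measurable A -> mass A 0 = 0.
Proof.
move=> mA; rewrite /mass; have -> : mu (A `&` [set r | 0 <= r <= 0]) = 0%E; last by [].
apply/eqP; rewrite -measure_le0 -(lebesgue_measure_set1 (0 : R)).
apply: le_measure; rewrite ?inE; first by rewrite initial_itv; exact: measurableI.
  exact: measurable_set1.
by move=> z [_ /=] h; lra.
Qed.

Lemma mass1 A : A `<=` [set t | 0 <= t < 1] -> mass A 1 = fine (mu A).
Proof.
move=> A01; congr (fine (mu _)); apply/setIidPl => z /A01 /=; lra.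
Qed.

(** A gain of mass means positive measure in []x, y]]. The points of [A] that are not interior are
    finitely many, hence null, so an interior one must exist. *)
Lemma mass_cint A x y : closed_1sub A -> 0 <= x -> x <= y -> y <= 1 ->
  mass A x < mass A y -> exists z, x < z < y /\ cint A z.
Proof.
move=> HA x0 xy y1; have mA := closed_1sub_measurable A HA.
have [E EP] := closed_1sub_cint A HA.
rewrite (mass_diff A x y) ?x0 // ltrDl => pos; apply/not_existsP => none.
have sub : A `&` `]x, y] `<=` [set` y :: E].
  move=> z [Az]; rewrite /= in_itv /= => zxy; rewrite inE; apply/orP.
  have [->|zy] := eqVneq z y; [by left|right].
  apply/negPn/negP => nE; apply: (none z); split; first by lra.
  by apply: EP => //; lra.
have cE : countable (A `&` `]x, y]).
  apply: sub_countable (finite_set_countable (finite_seq (y :: E))).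
  exact: subset_card_le.
by move: pos; rewrite (countable_lebesgue_measure0 cE) /= ltxx.
Qed.

Lemma mu_cover A B C x y : measurable A -> measurable B -> measurable C ->
  A `<=` B `|` C -> B `<=` `[x, y] -> C `<=` `[x, y] ->
  fine (mu A) <= fine (mu B) + fine (mu C).
Proof.
move=> mA mB mC ABC Bxy Cxy.
have fB := mu_fin _ _ _ mB Bxy; have fC := mu_fin _ _ _ mC Cxy.
have fA : mu A \is a fin_num.
  by apply: (mu_fin _ x y) => // z /ABC [/Bxy|/Cxy].
rewrite -lee_fin EFinD !fineK //.
have h : (mu (B `|` C) <= mu B + mu C)%E by exact: measureU2.
apply: (le_trans _ h).
by apply: le_measure; rewrite ?inE //; exact: measurableU.
Qed.

(** One of the two differences suffices because the total measures agree: on [[0, s]] it bounds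
    [mass A s] from above, and on []s, 1]] it bounds the remaining mass, so [mass A s] from
    below. *)
Lemma mass_close A B s : measurable A -> measurable B ->
  A `<=` [set t | 0 <= t < 1] -> B `<=` [set t | 0 <= t < 1] ->
  mu A = mu B -> 0 <= s <= 1 ->
  `|mass A s - mass B s| <= fine (mu (A `\` B)).
Proof.
move=> mA mB A01 B01 AB /andP[s0 s1].
have mAB : measurable (A `\` B) by exact: measurableD.
have sAB : A `\` B `<=` `[0, 1].
  by move=> z [/A01 /= h _]; rewrite in_itv /=; lra.
have h1 : mass A s <= mass B s + fine (mu (A `\` B)).
  rewrite /mass !initial_itv; apply: (mu_cover _ _ _ 0 1) => //; try exact: measurableI.
    by move=> z [Az zs]; have [Bz|nBz] := pselect (B z); [left|right].
  by move=> z [_]; rewrite /= !in_itv /=; lra.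
have h2 : fine (mu (A `&` `]s, 1])) <= fine (mu (B `&` `]s, 1])) + fine (mu (A `\` B)).
  apply: (mu_cover _ _ _ 0 1) => //; try exact: measurableI.
    by move=> z [Az zs]; have [Bz|nBz] := pselect (B z); [left|right].
  by move=> z [_]; rewrite /= !in_itv /=; lra.
have := mass_diff A s 1 mA; have := mass_diff B s 1 mB.
rewrite s0 s1 => /(_ isT) + /(_ isT); rewrite !mass1 // AB => e1 e2.
by rewrite ler_norml; lra.
Qed.

End Mass.

Arguments mass {R} A s.

(** * Lobes of a partition as circle lifts *)

Section CactusLifts.
Context {R : realType}.
Implicit Types (A B : set R) (x y s : R).
Local Notation mu := (@lebesgue_measure R).

Lemma mass_neg A s : s < 0 -> mass A s = 0.
Proof.
move=> s0; rewrite /mass; have -> : A `&` [set r | 0 <= r <= s] = set0.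
  by apply/seteqP; split=> // z [_ /=]; lra.
by rewrite measure0.
Qed.

Lemma mass_lipT A x y : measurable A -> x <= y ->
  mass A x <= mass A y <= mass A x + (y - x).
Proof.
move=> mA xy; have [x0|x0] := leP 0 x; first by apply: mass_lip => //; lra.
rewrite (mass_neg A x) //; have [y0|y0] := ltP y 0.
  by rewrite mass_neg //; lra.
have := mass_lip A 0 y mA; rewrite mass0 // lexx y0 => /(_ isT); lra.
Qed.

Lemma mass_continuous A : measurable A -> continuous (mass A).
Proof.
move=> mA x; apply/cvgrPdist_lt => e e0.
apply: filterS (nbhsx_ballx x e e0) => y; rewrite /ball /=; apply: le_lt_trans.
have [xy|/ltW yx] := leP x y.
  by rewrite distrC ger0_norm; have := mass_lipT A x y mA xy; [rewrite distrC ger0_norm; lra|lra].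
by rewrite ger0_norm; have := mass_lipT A y x mA yx; [rewrite ger0_norm; lra|lra].
Qed.

Section Partition.
Context {n : nat} {J : nat -> set R} (HJ : Fpart n J).

Lemma lobe_sub j : (j < n)%N -> J j `<=` [set t | 0 <= t < 1].
Proof. by move=> jn; have [/(_ j jn)[/closed_1sub_bound]] := HJ. Qed.

Lemma lobe_measurable j : (j < n)%N -> measurable (J j).
Proof. by move=> jn; have [/(_ j jn)[/closed_1sub_measurable]] := HJ. Qed.

Lemma lobe_mass1 j : (j < n)%N -> n%:R * mass (J j) 1 = 1.
Proof.
move=> jn; rewrite (mass1 _ (lobe_sub _ jn)).
have [/(_ j jn)[_ ->] _ _ _ _] := HJ; rewrite /= divff //.
by rewrite pnatr_eq0; move: jn; case: (n).
Qed.

Lemma lobe_lift j : (j < n)%N -> circle_lift (lift_of (fun s => n%:R * mass (J j) s)).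
Proof.
move=> jn; have mJ := lobe_measurable _ jn; apply: lift_ofP.
- by rewrite mass0 // mulr0.
- exact: lobe_mass1.
- move=> x y x0 xy y1; rewrite ler_wpM2l //.
  by have /andP[] := mass_lipT _ _ _ mJ xy.
- move=> v v01; have [||x x01 <-] := @IVT R (fun s => n%:R * mass (J j) s) 0 1 v ler01.
  + apply: continuous_subspaceT => x.
    by apply: cvgM; [exact: cvg_cst|exact: mass_continuous].
  + by rewrite mass0 // mulr0 lobe_mass1 // /Num.min /Num.max ltr01.
  by exists x => //; move: x01; rewrite in_itv.
Qed.

Lemma lobe_cint j x y : (j < n)%N -> x <= y -> y <= x + 1 ->
  lift_of (fun s => n%:R * mass (J j) s) x < lift_of (fun s => n%:R * mass (J j) s) y ->
  exists z, x < z < y /\ cint (J j) (fracR z).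
Proof.
move=> jn xy yx1; set psi := lift_of _; have mJ := lobe_measurable _ jn.
(* In one unit cell the lift is affine in [mass]. An interval of length at most one that starts in
   the cell of [N] can cross into the next cell, and no further. *)
have cell (N : int) x' y' : N%:~R <= x' -> x' <= y' -> y' <= N%:~R + 1 ->
    psi x' < psi y' -> exists z, x' < z < y' /\ cint (J j) (fracR z).
  move=> Nx xy' yN; rewrite /psi !(lift_ofE N) ?mass0 ?mulr0 ?lobe_mass1 //; try lra.
  rewrite ltrD2l ltr_pM2l; last by rewrite ltr0n; move: jn; case: (n).
  have [HA _] : closed_1sub (J j) /\ True by have [/(_ j jn)[]] := HJ.
  have h1 : 0 <= x' - N%:~R by lra.
  have h2 : x' - N%:~R <= y' - N%:~R by lra.
  have h3 : y' - N%:~R <= 1 by lra.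
  move=> /(mass_cint _ _ _ HA h1 h2 h3)[z [zxy cz]].
  exists (z + N%:~R); split; first by lra.
  suff -> : fracR (z + N%:~R) = z by [].
  by rewrite /fracR (floor_def (m := N)) ?addrK // intrD; have [? _] := cz; lra.
move=> pxy; have [N /andP[Nx xN]] := floor_cell x.
have [yN|Ny] := leP y (N%:~R + 1); first exact: (cell N).
have [h|h] := ltP (psi x) (psi (N%:~R + 1)).
  have [z [z1 z2]] := cell N x (N%:~R + 1) Nx xN (lexx _) h.
  by exists z; split=> //; lra.
have h1 : (N + 1)%:~R <= N%:~R + 1 :> R by rewrite intrD.
have h2 : y <= (N + 1)%:~R + 1 by rewrite intrD /=; lra.
have [z [z1 z2]] := cell (N + 1) (N%:~R + 1) y h1 (ltW Ny) h2 (le_lt_trans h pxy).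
by exists z; split=> //; lra.
Qed.

(** Around an interior point [z1] of lobe [j], lobe [k] rests from [q - 1] to [p] and then makes its
    turn on [[p, q]]. If [j] moved on that arc, it would have an interior point [z3] there, and
    since [p] and [q] are extreme in their fibres, [k] would have interior points [z2] and [z4] on
    both sides of [z3]: a forbidden 4-tuple. *)
Lemma lobe_separated j k : (j < n)%N -> (k < n)%N -> j != k ->
  separated_lifts (lift_of (fun s => n%:R * mass (J j) s))
    (lift_of (fun s => n%:R * mass (J k) s)).
Proof.
move=> jn kn jk; have Hj := lobe_lift _ jn; have Hk := lobe_lift _ kn.
set pj := lift_of _ in Hj *; set pk := lift_of _ in Hk *.
have [z1 [z1b c1]] : exists z, 0 < z < 1 /\ cint (J j) (fracR z).
  apply: (lobe_cint j 0 1 jn) => //; first by rewrite add0r.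
  by have := lift1 Hj 0; rewrite /pj add0r => ->; lra.
have [p [pE pP]] := lift_fiber_max _ (pk z1) Hk.
have [q [qE qP]] := lift_fiber_min _ (pk z1 + 1) Hk.
have z1p : z1 <= p by rewrite leNgt; apply/negP => /pP; rewrite ltxx.
have qz1 : q <= z1 + 1.
  by rewrite leNgt; apply/negP => /qP; rewrite (lift1 Hk) ltxx.
have pq : p < q by apply: (lift_lt Hk); rewrite pE qE; lra.
exists p, q; split; [by lra| |by rewrite (lift1 Hk) pE qE].
apply/eqP; rewrite eq_le (lift_le Hj (ltW pq)) /= leNgt; apply/negP => h.
have [z3 [z3b c3]] : exists z, p < z < q /\ cint (J j) (fracR z).
  by apply: (lobe_cint j) => //; lra.
have [z2 [z2b c2]] : exists z, p < z < z3 /\ cint (J k) (fracR z).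
  by apply: (lobe_cint k) => //; try lra; rewrite -/pk pE; apply: pP; lra.
have [z4 [z4b c4]] : exists z, z3 < z < q /\ cint (J k) (fracR z).
  by apply: (lobe_cint k) => //; try lra; rewrite -/pk qE; apply: qP; lra.
have [_ _ _ _ /(_ j k jn kn jk _ _ _ _ c1 c2 c3 c4)] := HJ; apply.
(* The four lifted points increase within one turn from [z1]. For their representatives in [[0, 1)],
   the disjunct of [cyc4] is selected by which points have passed 1. *)
have fr z : z1 < z -> z < z1 + 1 ->
    (fracR z = z /\ z < 1) \/ (fracR z = z - 1 /\ 1 <= z).
  move=> h1 h2; rewrite /fracR; have [z1'|z1'] := ltP z 1.
    by left; rewrite (floor_def (m := 0)) ?subr0 // intrD /=; lra.
  by right; rewrite (floor_def (m := 1)) // intrD /=; lra.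
have e1 : fracR z1 = z1.
  by rewrite /fracR (floor_def (m := 0)) ?subr0 // intrD /=; lra.
have f2 : z1 < z2 < z1 + 1 by lra.
have f3 : z1 < z3 < z1 + 1 by lra.
have f4 : z1 < z4 < z1 + 1 by lra.
have b23 : z2 < z3 by lra.
have b34 : z3 < z4 by lra.
rewrite e1 /cyc4 => {c1 c2 c3 c4 jk pP qP pE qE h pq qz1 z1p z3b z2b z4b Hj Hk}.
move/andP: f2 => [f2 g2]; move/andP: f3 => [f3 g3]; move/andP: f4 => [f4 g4].
case: (fr z2 f2 g2) => -[-> w2]; case: (fr z3 f3 g3) => -[-> w3];
  case: (fr z4 f4 g4) => -[-> w4]; clear fr;
  first [exfalso; lra|apply: Or41; split; lra|apply: Or42; split; lra|
    apply: Or43; split; lra|apply: Or44; split; lra].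
Qed.

End Partition.

Lemma mon_continuous f a b : MonI f -> 0 <= a -> b <= 1 ->
  {within `[a, b], continuous (f : R -> R)}.
Proof.
move=> [_ _ _ cf _] a0 b1; apply: continuous_subspaceW cf => x.
by rewrite /= in_itv /=; lra.
Qed.

Lemma mon_lift f : MonI f -> circle_lift (lift_of (f : R -> R)).
Proof.
move=> Hf; have [f0 f1 fle _ _] := Hf; apply: lift_ofP => // v v01.
have [||x x01 <-] := @IVT R f 0 1 v ler01.
- exact: mon_continuous.
- by rewrite f0 f1 /Num.min /Num.max ltr01.
by exists x => //; move: x01; rewrite in_itv.
Qed.

Lemma cdist_int (a b : R) : exists N : int, `|a - b - N%:~R| = cdist a b.
Proof.
rewrite /cdist /Num.min; case: ifP => _; rewrite /fracR.
  exists (Num.floor (a - b)); have := floor_itv (a - b); rewrite intrD => ?.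
  by rewrite ger0_norm; lra.
exists (- Num.floor (b - a)); have := floor_itv (b - a); rewrite intrD => ?.
by rewrite mulrNz ler0_norm; lra.
Qed.

Lemma int_half_dist (N : int) : 2^-1 <= `|2^-1 - N%:~R : R|.
Proof.
have [N0|N1] := lerP N 0.
  have : (N%:~R : R) <= 0%:~R by rewrite ler_int.
  by move=> h; rewrite ger0_norm; lra.
have : (1%:~R : R) <= N%:~R by rewrite ler_int.
by move=> h; rewrite ler0_norm; lra.
Qed.

(** The difference [f - g] starts at 0 and stays within [d <= 1/2] of the integers, so it can never
    reach 1/2 in absolute value; the nearest integer is 0 throughout. *)
Lemma mon_close (f g : R -> R) d : MonI f -> MonI g -> d <= 2^-1 ->
  (forall t, 0 <= t <= 1 -> cdist (f t) (g t) < d) ->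
  forall t, 0 <= t <= 1 -> `|f t - g t| < d.
Proof.
move=> Hf Hg d2 close.
have half f' g' t : MonI f' -> MonI g' -> 0 <= t <= 1 ->
    (forall t, 0 <= t <= 1 -> exists N : int, `|f' t - g' t - N%:~R| < d) ->
    f' t - g' t < 2^-1.
  move=> Hf' Hg' t01 h; rewrite ltNge; apply/negP => h2.
  have /andP[t0 t1] := t01.
  have [f0 _ _ _ _] := Hf'; have [g0 _ _ _ _] := Hg'.
  have [||x x01 xE] := @IVT R (fun t => f' t - g' t) 0 t 2^-1 t0.
  - move=> x; apply: cvgB; [exact: (mon_continuous f')|exact: (mon_continuous g')].
  - rewrite f0 g0 subr0 /Num.min /Num.max; case: ifP => ?; lra.
  have [|N] := h x; first by move: x01; rewrite in_itv /=; lra.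
  by rewrite xE; have := int_half_dist N; lra.
move=> t t01.
have h1 s : 0 <= s <= 1 -> exists N : int, `|f s - g s - N%:~R| < d.
  by move=> s01; have [N NE] := cdist_int (f s) (g s); exists N; rewrite NE close.
have h2 s : 0 <= s <= 1 -> exists N : int, `|g s - f s - N%:~R| < d.
  move=> /h1[N h]; exists (- N); rewrite mulrNz -normrN; by have -> : - (g s - f s - - N%:~R) = f s - g s - N%:~R by lra.
have b1 := half f g t Hf Hg t01 h1; have b2 := half g f t Hg Hf t01 h2.
have [N hN] := h1 t t01; move: (hN); rewrite ltr_norml => hN'.
have N1 : N < 1 by rewrite -(ltr_int R) /=; lra.
have N2 : -1 < N by rewrite -(ltr_int R) /=; lra.
have N0 : N = 0 by lia.
by rewrite N0 subr0 in hN.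
Qed.

End CactusLifts.

Arguments lobe_lift {R n J} HJ {j} _.
Arguments lobe_separated {R n J} HJ {j k} _ _ _.
Arguments mon_lift {R f} _.
Arguments mon_close {R f g d} _ _ _ _ {t} _.
Arguments mass_close {R A B s} _ _ _ _ _ _.
Arguments lobe_sub {R n J} HJ {j} _.
Arguments lobe_measurable {R n J} HJ {j} _.
Arguments lobe_mass1 {R n J} HJ {j} _.

(** * Lifts of spined cacti and their continuity *)

Section SpinedCacti.
Context {R : realType}.
Implicit Types (A B : set R) (x y s : R).
Local Notation mu := (@lebesgue_measure R).

(* The lobes of index [n] and above do not exist; the identity is a placeholder. *)
Definition cmap_lift n (p : @fMS R n) (j : nat) : R -> R :=
  if (j < n)%N then lift_of (fun t => cmap n p t j) else id.

Lemma fMS_parts n (p : @fMS R n) : (0 < n)%N ->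
  [/\ Fpart n (fI (proj1_sig p)), MonI (fmon (proj1_sig p)) &
    forall j, (j < n)%N -> 0 <= fz (proj1_sig p) j < 1].
Proof. by case: n p => // n [p /= []]. Qed.

Lemma cmap_liftE n (p : @fMS R n) j t : (j < n)%N ->
  cmap_lift n p j t = fz (proj1_sig p) j +
    lift_of (fun s => n%:R * mass (fI (proj1_sig p) j) s)
      (lift_of (fmon (proj1_sig p)) t).
Proof.
move=> jn; have [Fp Hf _] := fMS_parts n p (leq_ltn_trans (leq0n j) jn).
have mJ := lobe_measurable Fp jn.
have [f0 f1 fle _ _] := Hf.
rewrite /cmap_lift jn {1 3}/lift_of.
have hr := floor_itv t; rewrite intrD in hr.
have r0 : 0 <= fracR t by rewrite /fracR; lra.
have r1 : fracR t <= 1 by rewrite /fracR; lra.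
have b0 := fle 0 (fracR t) (lexx _) r0 r1.
have b1 := fle (fracR t) 1 r0 r1 (lexx _).
rewrite f0 in b0; rewrite f1 in b1.
rewrite (lift_ofE (Num.floor t)) ?mass0 ?mulr0 ?lobe_mass1 //; last by lra.
by rewrite addrAC subrr add0r /cmap -/(mass _ _) addrCA.
Qed.

Lemma fracR_int (N : int) (x : R) : fracR (N%:~R + x) = fracR x.
Proof.
by rewrite /fracR floorDzr ?intr_int // intrD intrKfloor opprD addrACA subrr add0r.
Qed.

Lemma cmap_lift_frac n (p : @fMS R n) j t : (j < n)%N ->
  fracR (cmap_lift n p j t) = fracR (cmap n p (fracR t) j).
Proof. by move=> jn; rewrite /cmap_lift jn /lift_of fracR_int. Qed.

Lemma lift_uniq_frac (phi psi : R -> R) : circle_lift phi -> circle_lift psi ->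
  (forall x, fracR (phi x) = fracR (psi x)) ->
  exists N : int, forall x, phi x = psi x + N%:~R.
Proof.
move=> Hphi Hpsi h; apply: lift_uniq => // x.
exists (Num.floor (phi x) - Num.floor (psi x)).
by have := h x; rewrite /fracR intrB; lra.
Qed.

Lemma fracR_itv (x : R) : 0 <= fracR x < 1.
Proof. by have := floor_itv x; rewrite intrD /fracR; lra. Qed.

Lemma fracR_id (x : R) : fracR (fracR x) = fracR x.
Proof. by rewrite {2}/fracR -mulrNz addrC fracR_int. Qed.

Lemma cmap_lift_lift n (p : @fMS R n) j : circle_lift (cmap_lift n p j).
Proof.
have [jn|nj] := ltnP j n; last by rewrite /cmap_lift ltnNge nj; exact: lift_id.
have [Fp Hf _] := fMS_parts n p (leq_ltn_trans (leq0n j) jn).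
have := lift_comp _ _ (lift_shift (fz (proj1_sig p) j))
  (lift_comp _ _ (lobe_lift Fp jn) (mon_lift Hf)).
congr circle_lift; apply: funext => t /=.
by rewrite cmap_liftE // addrC.
Qed.

Lemma separated_pull (f g h : R -> R) : circle_lift h -> separated_lifts f g ->
  separated_lifts (f \o h) (g \o h).
Proof.
move=> Hh [p [q [/andP[pq qp] fpq gpq]]].
have [p' hp] := lift_onto Hh p.
have [q' hq pq'] : exists2 q', h q' = q & p' <= q' <= p' + 1.
  move: pq; rewrite le_eqVlt => /predU1P[<-|pq]; first by exists p'; lra.
  move: qp; rewrite le_eqVlt => /predU1P[->|qp].
    by exists (p' + 1); [rewrite (lift1 Hh) hp|lra].
  have [q' hq] := lift_onto Hh q; exists q' => //.
  apply/andP; split; apply/ltW/(lift_lt Hh); rewrite ?(lift1 Hh) hp hq //.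
by exists p', q'; rewrite /= (lift1 Hh) hp hq.
Qed.

Lemma cmap_lift_separated n (p : @fMS R n) j k : (j < n)%N -> (k < n)%N ->
  j != k -> separated_lifts (cmap_lift n p j) (cmap_lift n p k).
Proof.
move=> jn kn jk.
have [Fp Hf _] := fMS_parts n p (leq_ltn_trans (leq0n j) jn).
have [r [q [rq e1 e2]]] :=
  separated_pull _ _ _ (mon_lift Hf) (lobe_separated Fp jn kn jk).
exists r, q; split=> //; rewrite !cmap_liftE //; congr (_ + _).
  exact: e1.
exact: e2.
Qed.

Lemma cdist_ge0 (a b : R) : 0 <= cdist a b <= 1.
Proof.
rewrite /cdist /Num.min /fracR; have := floor_itv (a - b).
by have := floor_itv (b - a); rewrite !intrD; case: ifP => _; lra.
Qed.

Lemma fMS_dist_bounds n (p q : @fMSraw R) d : fMS_dist n p q < d ->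
  [/\ forall j, (j < n)%N ->
        fine (mu (fI p j `\` fI q j)) < d /\ cdist (fz p j) (fz q j) < d &
      forall t, 0 <= t <= 1 -> cdist (fmon p t) (fmon q t) < d].
Proof.
rewrite /fMS_dist; set s1 := \sum_(j < n) _; set s3 := \sum_(j < n) cdist _ _.
set E := [set cdist _ _ | _ in _] => h.
have Eub t : 0 <= t <= 1 -> cdist (fmon p t) (fmon q t) <= sup E.
  move=> t01; apply: ub_le_sup; last by exists t.
  by exists 1 => _ [r _ <-]; have /andP[] := cdist_ge0 (fmon p r) (fmon q r).
have E0 : 0 <= sup E.
  have h1 : cdist (fmon p 0) (fmon q 0) <= sup E by apply: Eub; rewrite lexx ler01.
  by have /andP[h2 _] := cdist_ge0 (fmon p 0) (fmon q 0); exact: le_trans h2 h1.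
have sle (f : nat -> R) j : (j < n)%N -> (forall i, 0 <= f i) -> f j <= \sum_(i < n) f i.
  move=> jn f0; rewrite (bigD1 (Ordinal jn)) //= lerDl.
  by apply: sumr_ge0 => i _.
have s10 : 0 <= s1 by apply: sumr_ge0 => i _; exact: fine_ge0.
have c0 (a b : R) : 0 <= cdist a b by have /andP[] := cdist_ge0 a b.
have s30 : 0 <= s3 by apply: sumr_ge0 => i _.
split=> [j jn|t t01]; last by apply: le_lt_trans (Eub t t01) _; lra.
split.
  apply: le_lt_trans (sle (fun j => fine (mu (fI p j `\` fI q j))) j jn _) _.
    by move=> i; exact: fine_ge0.
  by rewrite -/s1; lra.
apply: le_lt_trans (sle (fun j => cdist (fz p j) (fz q j)) j jn _) _ => //.
by rewrite -/s3; lra.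
Qed.

(** Spine coordinates that are close on the circle may be represented near 0 and near 1, so the
    lifts converge only after correction by integers. The other errors come from the
    reparametrisation and from the masses of the lobes. *)
Lemma cmap_lift_cvg (I : Type) (F : set_system I) (FF : Filter F) n (p : @fMS R n)
    (q : I -> fMS n) :
  (forall d, 0 < d ->
    \forall a \near F, fMS_dist n (proj1_sig p) (proj1_sig (q a)) < d) ->
  exists c : I -> nat -> int, forall j (x : I -> R) x0, rcvg (F := F) x x0 ->
    rcvg (F := F) (fun a => cmap_lift n (q a) j (x a) + (c a j)%:~R)
      (cmap_lift n p j x0).
Proof.
move=> near_p.
have ex a : exists c : nat -> int, forall j, (j < n)%N ->
    `|fz (proj1_sig p) j - fz (proj1_sig (q a)) j - (c j)%:~R| =
    cdist (fz (proj1_sig p) j) (fz (proj1_sig (q a)) j).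
  have [c cP] := choice (fun j => cdist_int (fz (proj1_sig p) j) (fz (proj1_sig (q a)) j)).
  by exists c => j _; exact: cP.
have [c cP] := choice ex.
exists (fun a j => if (j < n)%N then c a j else 0) => j x x0 xc.
have [jn|nj] := ltnP j n; last first.
  by rewrite /cmap_lift ltnNge nj /= => e e0; apply: filterS (xc e e0) => a; rewrite addr0.
have n0 : (0 < n)%N by exact: leq_ltn_trans (leq0n j) jn.
have nR : 0 < n%:R :> R by rewrite ltr0n.
have [Fp Hf _] := fMS_parts n p n0.
move=> e e0; set psi := lift_of (fun s => n%:R * mass (fI (proj1_sig p) j) s).
set L := lift_of (fmon (proj1_sig p)).
have e4 : 0 < e / 4 by lra.
have [d1 d10 psiP] := lift_near psi (L x0) (e / 4) (lobe_lift Fp jn) e4.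
have d12 : 0 < d1 / 2 by lra.
have [d2 d20 LP] := lift_near L x0 (d1 / 2) (mon_lift Hf) d12.
(* The bounds serve, in this order, the reparametrisation, the spine coordinate, the mass of the
   lobe scaled by [n], and the hypothesis of [mon_close]. *)
pose d := Num.min (Num.min (d1 / 2) (e / 4)) (Num.min (e / 4 / n%:R) 2^-1).
have d0 : 0 < d by rewrite !lt_min d12 e4 (divr_gt0 e4 nR) /=; lra.
have [dd1 de den dh] : [/\ d <= d1 / 2, d <= e / 4, d <= e / 4 / n%:R & d <= 2^-1].
  by rewrite /d !ge_min !lexx /= !orbT.
have {}den : n%:R * d <= e / 4 by rewrite mulrC -ler_pdivlMr.
apply: filterS (filterI (near_p d d0) (xc d2 d20)) => a [/fMS_dist_bounds[hj ht] xa].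
have [hI hz] := hj j jn; have [Fq Hg _] := fMS_parts n (q a) n0.
set La := lift_of (fmon (proj1_sig (q a))).
set psia := lift_of (fun s => n%:R * mass (fI (proj1_sig (q a)) j) s).
have fr y : 0 <= fracR y <= 1.
  by have := floor_itv y; rewrite intrD /fracR; lra.
have h1 : `|La (x a) - L (x a)| < d.
  rewrite /La /L /lift_of opprD addrACA subrr add0r distrC.
  exact: (mon_close Hf Hg dh ht (fr _)).
have h2 : `|psi (La (x a)) - psi (L x0)| < e / 4.
  apply: psiP; have := LP _ xa; rewrite !ltr_norml in h1 *.
  by move/andP: h1 => [? ?] /andP[? ?]; apply/andP; split; lra.
have h3 y : `|psia y - psi y| <= e / 4.
  rewrite /psia /psi /lift_of opprD addrACA subrr add0r -mulrBr normrM ger0_norm ?ler0n //.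
  apply: le_trans den; rewrite ler_wpM2l ?ler0n // distrC.
  apply: (le_trans (mass_close (lobe_measurable Fp jn) (lobe_measurable Fq jn)
    (lobe_sub Fp jn) (lobe_sub Fq jn) _ (fr y))); last exact: ltW.
  by have [/(_ j jn)[_ ->] _ _ _ _] := Fp; have [/(_ j jn)[_ ->] _ _ _ _] := Fq.
rewrite !cmap_liftE // -/psi -/psia -/L -/La.
rewrite -(cP a j jn) ltr_norml in hz; have {}h3 := h3 (La (x a)).
move: h2 h3; rewrite !ltr_norml ler_norml => /andP[? ?] /andP[? ?].
by move/andP: hz => [? ?]; apply/andP; split; lra.
Qed.

End SpinedCacti.

Arguments cmap_lift {R} n p j x.
Arguments cmap_lift_lift {R n} p j.
Arguments cmap_lift_separated {R n} p {j k} _ _ _.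
Arguments cmap_lift_cvg {R I F FF n p q} _.
Arguments cmap_lift_frac {R n} p {j} t _.
Arguments lift_uniq_frac {R phi psi} _ _ _.
Arguments fracR_itv {R} x.
Arguments fracR_id {R} x.

(** * The action *)

Section Action.
Context {R : realType} {O : nat -> topologicalType} {P : cyc_op_mult O}.
Context (HP : is_cyc_op_mult P).
Local Notation t := (orot P).
Local Notation T := (opel O).
Local Notation cyclic_family := (@cyclic_family R O P).

Implicit Types (x y z : R) (s A C : seq R) (ev : R -> R -> Prop).
Implicit Types G : seq R -> T.

Local Notation Tot := (@TotT R O P).
Local Notation Totp := (@Totpow R O P).

(** Indices of missing lobes receive the neutral family, so that the general theory can quantify
    over all natural numbers. *)
Definition lobe_family n (xs : Totp n) (j : nat) : seq R -> T :=
  if insub j is Some o then tot_family P (xs o) else const_family P.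

Lemma lobe_cyclic n (xs : Totp n) j : cyclic_family (@eq R) (lobe_family n xs j).
Proof.
rewrite /lobe_family; case: insubP => [w _ _|_]; first exact: tot_cyclic.
exact: const_cyclic.
Qed.

Lemma lobe_pull n (xs : Totp n) j f : circle_lift f ->
  cyclic_family (fun x y => f x = f y) (fun s => lobe_family n xs j (map f s)).
Proof. by move=> Hf; exact: (cyclic_pull (lobe_cyclic n xs j) Hf). Qed.

(** Periodicity of cyclic families makes them insensitive to the choice of a lift. *)
Lemma lobe_shift n (xs : Totp n) j f f' (c : int) : circle_lift f ->
  (forall x, f' x = f x + c%:~R) ->
  forall s, vl s -> lobe_family n xs j (map f' s) = lobe_family n xs j (map f s).
Proof.
move=> Hf f'E s v; rewrite -(cyc_shift HP (lobe_cyclic n xs j) c (lift_vl Hf v)).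
by congr (lobe_family _ _ _ _); rewrite -map_comp; apply: eq_map.
Qed.

Lemma glued_eq_cyclic phi Gam S G : glued P phi Gam S G -> cyclic_family (@eq R) G.
Proof. by move=> H; apply: cyclic_sub (glue_cyclic H) => x _ <-. Qed.

Section Limits.
Context {I : Type} {F : set_system I} (FU : UltraFilter F).

Lemma ocvg_existT k (w : I -> O k) w0 :
  ocvg (F := F) (fun a => existT O k (w a)) (existT O k w0) -> w @ F --> w0.
Proof.
move=> h W W0; have FW := h W W0.
change (F (w @^-1` W)); apply: filterS FW => a [b Wb /opel_inj e].
by rewrite /preimage /= e.
Qed.

Lemma fcvg_pull (G : I -> seq R -> T) G0 (f : I -> R -> R) (f0 : R -> R) :
  (forall a, circle_lift (f a)) -> fcvg (F := F) G G0 ->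
  (forall (x : I -> R) x0, rcvg (F := F) x x0 ->
    rcvg (F := F) (fun a => f a (x a)) (f0 x0)) ->
  fcvg (F := F) (fun a s => G a (map (f a) s)) (fun s => G0 (map f0 s)).
Proof.
move=> Hf Gc fc y cy vy.
pose y' := [seq (fun a => f a (p.1 a), f0 p.2) | p <- y].
have e0 : map f0 (mlim y) = mlim y' by rewrite /mlim /y' -!map_comp.
have e a : map (f a) (mval y a) = mval y' a by rewrite /mval /y' -!map_comp.
rewrite e0; apply: ocvg_ext (Gc y' _ _).
- by apply: nearW => a; rewrite e.
- rewrite /y'; elim: y cy {vy y' e0 e} => //= p y IH [pc /IH]; split=> //; exact: fc.
- by apply: filterS vy => a v; rewrite -e; exact: (lift_vl (Hf a)).
Qed.

Lemma const_fcvg : fcvg (F := F) (fun=> const_family P : seq R -> T) (const_family P).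
Proof.
move=> y _ _; apply: ocvg_ext (ocvg_cst _); apply: nearW => a.
by rewrite /const_family !size_map.
Qed.

Lemma lobe_fcvg n (xs_ : I -> Totp n) (xs : Totp n) j :
  (forall o, (fun a => xs_ a o) @ F --> xs o) ->
  fcvg (F := F) (fun a => lobe_family n (xs_ a) j) (lobe_family n xs j).
Proof.
move=> h; rewrite /lobe_family; case: insubP => [w _ _|_]; last exact: const_fcvg.
exact: (tot_fcvg HP FU (h w)).
Qed.

End Limits.

(* The operation attached to a spined cactus glues the families of its lobes. *)
Definition acts n (p : @fMS R n) (xs : Totp n) (x : Tot) : Prop :=
  exists S G, [/\ perm_eq S (iota 0 n),
    glued P (cmap_lift n p)
      (fun j s => lobe_family n xs j (map (cmap_lift n p j) s)) S G &
    forall s, vl (0 :: s) -> tot_base P x s = G (0 :: s)].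

Lemma acts_glued n (p : fMS n) (xs : Totp n) i : (0 < n)%N -> (i < n)%N ->
  exists S G, perm_eq (rcons S i) (iota 0 n) /\
    glued P (cmap_lift n p)
      (fun j s => lobe_family n xs j (map (cmap_lift n p j) s)) (rcons S i) G.
Proof.
move=> n0 ij; apply: (glue_exists HP (cmap_lift_lift p)).
- by move=> j; apply: lobe_pull; exact: cmap_lift_lift.
- by rewrite mem_iota add0n.
- exact: iota_uniq.
- move=> j k; rewrite !mem_iota !add0n /=; exact: cmap_lift_separated.
Qed.

Lemma acts_exists n (p : fMS n) (xs : Totp n) : exists x : Tot, acts n p xs x.
Proof.
pose Gam j s := lobe_family n xs j (map (cmap_lift n p j) s).
have [S [G [SE H]]] : exists S G, perm_eq S (iota 0 n) /\
    glued P (cmap_lift n p) Gam S G.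
  have [n0|] := posnP n.
    (* The cactus without lobes acts by the constant family. *)
    exists [::], (const_family P); split; first by rewrite [in iota _ _]n0.
    by constructor=> //; exact: const_cyclic.
  by move=> n0; have [S [G HG]] := acts_glued n p xs 0 n0 n0; exists (rcons S 0%N), G.
have [x xE] : exists x : Tot, forall s, vl (0 :: s) -> tot_base P x s = G (0 :: s).
  apply: (tot_of_cyclic HP (glued_eq_cyclic _ _ _ _ H)) => k U UU.
  have Hphi j := cmap_lift_lift p j.
  have HGam j : cyclic_family (fun x y => cmap_lift n p j x = cmap_lift n p j y) (Gam j).
    exact: lobe_pull.
  have phi_cvg j (x : Delta k -> R) x0 : rcvg (F := U) x x0 ->
      rcvg (F := U) (fun a => cmap_lift n p j (x a)) (cmap_lift n p j x0).
    exact: lift_rcvg.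
  apply: (glued_fcvg HP UU (fun _ => Hphi) Hphi (fun _ => HGam) HGam phi_cvg _ (S := S)).
  - move=> j; apply: (fcvg_pull UU (fun=> lobe_family n xs j) _ (fun=> cmap_lift n p j)) => [a||]; [exact: Hphi| |exact: phi_cvg].
    by apply: (lobe_fcvg UU n (fun=> xs)) => o; exact: cvg_cst.
  - by rewrite (perm_uniq SE) iota_uniq.
  - by apply: nearW => a; exists S.
  - by exists S.
by exists x, S, G.
Qed.

Lemma acts_unique n (p : fMS n) (xs : Totp n) (x x' : Tot) S G :
  acts n p xs x -> perm_eq S (iota 0 n) ->
  glued P (cmap_lift n p)
    (fun j s => lobe_family n xs j (map (cmap_lift n p j) s)) S G ->
  (forall s, vl (0 :: s) -> tot_base P x' s = G (0 :: s)) -> x = x'.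
Proof.
move=> [S0 [G0 [SE0 H0 xE]]] SE H x'E; apply: tot_ext => s v.
rewrite xE // x'E //; apply: (glue_unique HP (cmap_lift_lift p) _ H0 H _ _ v).
- by move=> j; apply: lobe_pull; exact: cmap_lift_lift.
- by rewrite (perm_uniq SE0) iota_uniq.
- by rewrite (permPl SE0) perm_sym.
Qed.

Lemma acts_family n (p : fMS n) (xs : Totp n) (x : Tot) : acts n p xs x ->
  exists S, perm_eq S (iota 0 n) /\
  glued P (cmap_lift n p)
    (fun j s => lobe_family n xs j (map (cmap_lift n p j) s)) S (tot_family P x).
Proof.
move=> [S [G [SE H xE]]]; exists S; split=> //; apply: glue_congr (H).
apply: (cyclic_ext HP 0 (glued_eq_cyclic _ _ _ _ H) (tot_cyclic HP x)) => s v.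
by rewrite (tot_family0 HP) // xE.
Qed.

Context {theta : forall n, @fMS R n -> Totp n -> Tot}.
Context (thetaP : forall n p xs, acts n p xs (theta n p xs)).

Lemma theta_unit : alg_unit P theta.
Proof.
move=> e xs eid; set phi := cmap_lift 1 e.
have Hphi j : circle_lift (phi j) by exact: cmap_lift_lift.
have HGam j : cyclic_family (fun x y => phi j x = phi j y)
    (fun s => lobe_family 1 xs j (map (phi j) s)) by exact: lobe_pull.
(* A cactus with one lobe whose map is the identity has a lift that is a translation by an
   integer. *)
have [c cE] : exists c : int, forall x, phi 0%N x = id x + c%:~R.
  apply: lift_uniq_frac => // [|x]; first exact: lift_id.
  by rewrite /phi cmap_lift_frac // (eid _ (fracR_itv x)) // fracR_id.
have L : leaf phi [::] 0 0 1.
  split=> //; first by rewrite add0r ler01 lexx.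
  by rewrite -(lift1 (Hphi 0%N)) add0r.
have H0 : glued P phi (fun j s => lobe_family 1 xs j (map (phi j) s)) [::]
    (const_family P) by constructor=> //; exact: const_cyclic.
have [G J] := leaf_join HP Hphi HGam (glue_cyclic H0) L.
have GE := join_const HP (convex_equiv_lift (Hphi 0%N)) (HGam 0%N) _ _ _ J.
apply: (acts_unique _ _ _ _ _ [:: 0%N] G (thetaP 1 e xs)) => //.
  exact: (glue_cons H0 L J).
move=> s v; rewrite GE //.
- rewrite (lobe_shift 1 xs 0 id (phi 0%N) c lift_id cE) // map_id.
  have -> : lobe_family 1 xs 0 = tot_family P (xs ord0).
    by rewrite /lobe_family insubT; congr (tot_family P (xs _)); exact: val_inj.
  by rewrite (tot_family0 HP).
- by rewrite add0r ler01 lexx.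
- by rewrite add0r.
Qed.

(** [glued] accepts the lobes in any order, so the relabelled gluing for [q] is a gluing for [p],
    and uniqueness identifies the results. *)
Lemma theta_equiv : alg_equiv P theta.
Proof.
move=> n p q s pq xs ys yx.
pose pi (j : nat) : nat := if insub j is Some o then s o else j.
have piE (w : 'I_n) : pi w = s w by rewrite /pi valK.
have [S [SE H]] := acts_family n q xs _ (thetaP n q xs).
have inS j : j \in S -> (j < n)%N by rewrite (perm_mem SE) mem_iota add0n.
have cE j : (j < n)%N -> exists c : int, forall x,
    cmap_lift n q j x = cmap_lift n p (pi j) x + c%:~R.
  move=> jn; apply: lift_uniq_frac => [||x]; try exact: cmap_lift_lift.
  have pin : (pi j < n)%N by rewrite (piE (Ordinal jn)).
  rewrite !cmap_lift_frac // (pq _ (fracR_itv x) (Ordinal jn)).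
  by rewrite -(piE (Ordinal jn)).
have pE j : (j < n)%N -> lobe_family n xs j = lobe_family n ys (pi j).
  move=> jn; rewrite -[j in LHS]/(val (Ordinal jn)) (piE (Ordinal jn)).
  by rewrite /lobe_family !valK yx.
apply/esym/(acts_unique _ _ _ _ _ (map pi S) (tot_family P (theta n q xs))
  (thetaP n p ys)).
- apply: perm_trans (perm_map _ SE) _; rewrite -val_enum_ord -map_comp.
  have -> : map (pi \o val) (enum 'I_n) = map val (map s (enum 'I_n)).
    by elim: (enum 'I_n) => //= w r ->; rewrite piE.
  apply: perm_map; apply: uniq_perm; rewrite ?(map_inj_uniq (@perm_inj _ s)) ?enum_uniq //.
  move=> w; rewrite mem_enum; apply/mapP; exists (s^-1 w)%g; first by rewrite mem_enum.
  by rewrite permKV.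
- apply: glue_relabel; apply: glue_ext H => j /inS jn.
    have [c E] := cE j jn; exists (- c%:~R) => x; rewrite E addrK //.
  move=> r v; rewrite pE //; have [c E] := cE j jn.
  exact: (lobe_shift n ys (pi j) _ _ c (cmap_lift_lift p (pi j)) E).
- by move=> r v; rewrite (tot_family0 HP).
Qed.

Lemma theta_comp : alg_comp P theta.
Proof.
move=> k l i a b cc ik ccE xs ys zs zsE ysE1 ysE2 ysE3.
pose i0 := i.-1; have i0k : (i0 < k)%N by rewrite /i0; lia.
pose phia := cmap_lift k a; pose phib := cmap_lift l b.
(* Lifts of the composite built from those of [a] and [b]. They agree with the lifts of [cc] up to
   integers, which [lobe_shift] and [glue_ext] absorb. *)
pose phic (j : nat) : R -> R := if (j < i0)%N then phia j
  else if (j < i0 + l)%N then phib (j - i0)%N \o phia i0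
  else if (j < k + l - 1)%N then phia (j - l + 1)%N else id.
have Hphic j : circle_lift (phic j).
  rewrite /phic; case: ifP => _; first exact: cmap_lift_lift.
  case: ifP => _; first by apply: lift_comp; exact: cmap_lift_lift.
  by case: ifP => _; [exact: cmap_lift_lift|exact: lift_id].
pose Gama j s := lobe_family k ys j (map (phia j) s).
pose Gamb j s := lobe_family l zs j (map (phib j) s).
pose Gamc j s := lobe_family (k + l - 1) xs j (map (phic j) s).
have [S [Ga [SE HGa]]] := acts_glued k a ys i0 (leq_ltn_trans (leq0n _) i0k) i0k.
have [Sb [SbE HGb]] := acts_family l b zs _ (thetaP l b zs).
(* Positions in the composite of the outer lobes other than [i0]. The subtraction is applied to
   [t > i0] only, so it does not truncate even when [l = 0] and lobe [i0] is simply forgotten. *)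
pose al t := if (t < i0)%N then t else (t + l - 1)%N.
pose be r := (i0 + r)%N.
have SE' : perm_eq S (iota 0 i0 ++ iota i0.+1 (k - i0.+1)).
  rewrite -(perm_cons i0) -(perm_rcons i0 S); apply: perm_trans SE _.
  have -> : k = (i0 + (k - i0.+1).+1)%N by lia.
  rewrite iotaD /= add0n (_ : i0 + (k - i0.+1).+1 - i0.+1 = k - i0.+1)%N; last by lia.
  by rewrite perm_sym -cat1s perm_catCA.
have inS t : t \in S -> (t < k)%N /\ t <> i0.
  by rewrite (perm_mem SE') mem_cat !mem_iota; lia.
have inSb r : r \in Sb -> (r < l)%N by rewrite (perm_mem SbE) mem_iota.
have al_phi : {in S, forall t x, phic (al t) x = phia t x}.
  move=> t /inS[tk ti] x; rewrite /al /phic; have [ti0|it] := ltnP t i0.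
    by rewrite ti0.
  have -> : (t + l - 1 < i0)%N = false by lia.
  have -> : (t + l - 1 < i0 + l)%N = false by lia.
  have -> : (t + l - 1 < k + l - 1)%N by lia.
  by congr (phia _ _); lia.
have be_phi : {in Sb, forall r x, phic (be r) x = phib r (phia i0 x)}.
  move=> r /inSb rl x; rewrite /be /phic.
  have -> : (i0 + r < i0)%N = false by lia.
  have -> : (i0 + r < i0 + l)%N by lia.
  by rewrite /=; congr (phib _ _); lia.
have al_lobe : {in S, forall t, lobe_family (k + l - 1) xs (al t) = lobe_family k ys t}.
  move=> t /inS[tk ti]; have alk : (al t < k + l - 1)%N by rewrite /al; case: ifP => ?; lia.
  rewrite /lobe_family !insubT; congr (tot_family P _); apply/esym.
  have [ti0|] := ltnP t i0; first by apply: ysE1; rewrite //= /al ti0.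
  move=> it; apply: ysE2; first by rewrite /=; lia.
  by rewrite /= /al ltnNge it.
have be_lobe : {in Sb, forall r, lobe_family (k + l - 1) xs (be r) = lobe_family l zs r}.
  move=> r /inSb rl; have bek : (be r < k + l - 1)%N by rewrite /be; lia.
  rewrite /lobe_family !insubT; congr (tot_family P _); apply/esym.
  exact: zsE.
have ysi : lobe_family k ys i0 = tot_family P (theta l b zs).
  by rewrite /lobe_family insubT ysE3.
have ccE' j : (j < k + l - 1)%N -> exists c : int, forall x,
    cmap_lift (k + l - 1) cc j x = phic j x + c%:~R.
  move=> jn; apply: lift_uniq_frac => [||x]; [exact: cmap_lift_lift|exact: Hphic|].
  rewrite cmap_lift_frac // (ccE _ (fracR_itv x)) // /coend_comp -/i0 /phic.
  case: ifP => ji; first by rewrite /phia cmap_lift_frac //; lia.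
  case: ifP => jil; last by rewrite jn /phia cmap_lift_frac //; lia.
  rewrite /= /phib cmap_lift_frac; last by lia.
  by rewrite /phia cmap_lift_frac.
have Gam_be : {in Sb, forall r s, vl s -> Gamc (be r) s = Gamb r (map (phia i0) s)}.
  move=> r rS s v; rewrite /Gamc be_lobe // /Gamb -map_comp.
  by congr (lobe_family _ _ _ _); apply: eq_map => x; exact: be_phi.
have Gam_al : {in S, forall t s, vl s -> Gamc (al t) s = Gama t s}.
  move=> t tS s v; rewrite /Gamc al_lobe // /Gama.
  by congr (lobe_family _ _ _ _); apply: eq_map => x; exact: al_phi.
have HGbE s : vl s -> Gama i0 s = tot_family P (theta l b zs) (map (phia i0) s).
  by move=> v; rewrite /Gama ysi.
have [G' [HG' GE]] := glue_comp HP (cmap_lift_lift a) (cmap_lift_lift b) Hphic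
  (fun j => lobe_pull k ys j _ (cmap_lift_lift a j))
  (fun j => lobe_pull (k + l - 1) xs j _ (Hphic j)) HGb HGbE be_phi Gam_be _ _ HGa
  al_phi Gam_al.
have SSE : perm_eq (map al S ++ map be Sb) (iota 0 (k + l - 1)).
  have -> : (k + l - 1 = i0 + (l + (k - i0.+1)))%N by lia.
  have e1 : map al (iota 0 i0) = iota 0 i0.
    apply: map_id_in => r; rewrite mem_iota /= add0n => ri.
    by rewrite /al ri.
  have e2 m' : map al (iota i0.+1 m') = iota (i0 + l) m'.
    rewrite -[i0.+1]addn0 -[(i0 + l)%N]addn0 !iotaDl -map_comp.
    by apply: eq_map => r; rewrite /= /al; case: ifP => ?; lia.
  have e3 : map be (iota 0 l) = iota i0 l by rewrite -[in RHS](addn0 i0) iotaDl.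
  rewrite !iotaD add0n perm_sym perm_catCA perm_sym perm_catC.
  apply: perm_cat; first by rewrite -e3; exact: perm_map.
  by apply: perm_trans (perm_map al SE') _; rewrite map_cat e1 e2.
apply: (acts_unique _ _ _ _ _ (map al S ++ map be Sb) G' (thetaP _ cc xs)) => //.
  apply: glue_ext HG' => j jS.
    have [|c cE] := ccE' j; first by rewrite (perm_mem SSE) mem_iota in jS.
    by exists c%:~R.
  move=> s v; have [|c cE] := ccE' j; first by rewrite (perm_mem SSE) mem_iota in jS.
  exact/esym/(lobe_shift (k + l - 1) xs j _ _ c (Hphic j) cE).
move=> s v; rewrite -GE //.
have [S1 [G1 [S1E HG1 ->]]] := thetaP k a ys; last by [].
apply: (glue_unique HP (cmap_lift_lift a) _ HG1 HGa _ _ v).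
- by move=> j; apply: lobe_pull; exact: cmap_lift_lift.
- by rewrite (perm_uniq S1E) iota_uniq.
- by rewrite (permPl S1E) perm_sym.
Qed.

Lemma theta_continuous : alg_continuous P theta.
Proof.
move=> n p xs W nW.
(* The neighbourhood filter of [(p, xs)], built by hand from the distance on [fMS n] and the
   topology on [Totp n]. *)
pose F : set_system (fMS n * Totp n) := [set B | exists2 d : R, 0 < d &
  exists2 V : set (Totp n), nbhs xs V & forall (q : fMS n) ys,
    fMS_dist n (proj1_sig p) (proj1_sig q) < d -> V ys -> B (q, ys)].
have FF : Filter F.
  split=> [|A B [d1 d10 [V1 n1 h1]] [d2 d20 [V2 n2 h2]]|A B AB [d d0 [V nV h]]].
  - by exists 1 => //; exists setT => //; exact: filterT.
  - exists (Num.min d1 d2); first by rewrite lt_min d10.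
    exists (V1 `&` V2); first exact: filterI.
    by move=> q ys; rewrite lt_min => /andP[k1 k2] [l1 l2]; split; [exact: h1|exact: h2].
  - by exists d => //; exists V => // q ys k1 k2; apply: AB; exact: h.
suff [d d0 [V nV h]] : F [set a | W (theta n a.1 a.2)].
  by exists d => //; exists V => // q ys k1 k2; exact: (h q ys k1 k2).
apply: ultra_nbhs => U UU FU.
have pU d : 0 < d -> \forall a \near U, fMS_dist n (proj1_sig p) (proj1_sig a.1) < d.
  by move=> d0; apply: FU; exists d => //; exists setT => //; exact: filterT.
have xsU w : (fun a : fMS n * Totp n => a.2 w) @ U --> xs w.
  move=> V nV; apply: FU; exists 1 => //; exists [set ys | V (ys w)] => //.
  exact: (@proj_continuous _ _ w xs V nV).
(* The integers [c] select the lifts of nearby cacti that converge; the glued family does not notice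
   the change. *)
have [c cP] := cmap_lift_cvg pU.
pose phiU (a : fMS n * Totp n) j x := cmap_lift n a.1 j x + (c a j)%:~R.
pose GamU (a : fMS n * Totp n) j s := lobe_family n a.2 j (map (phiU a j) s).
have HphiU a j : circle_lift (phiU a j).
  exact: (lift_comp _ _ (lift_shift _) (cmap_lift_lift a.1 j)).
have HGamU a j : cyclic_family (fun x y => phiU a j x = phiU a j y) (GamU a j).
  exact: lobe_pull.
pose Gam0 j s := lobe_family n xs j (map (cmap_lift n p j) s).
have HGam0 j : cyclic_family (fun x y => cmap_lift n p j x = cmap_lift n p j y) (Gam0 j).
  by apply: lobe_pull; exact: cmap_lift_lift.
have Gc : fcvg (F := U) (fun a => tot_family P (theta n a.1 a.2))
    (tot_family P (theta n p xs)).
  apply: (glued_fcvg HP UU HphiU (cmap_lift_lift p) HGamU HGam0 cP _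
    (S := iota 0 n)).
  - move=> j; apply: (fcvg_pull UU (fun a => lobe_family n a.2 j) _ (fun a => phiU a j)).
    + by [].
    + exact: (lobe_fcvg UU n snd).
    + exact: cP.
  - exact: iota_uniq.
  - apply: nearW => a; have [S [SE H]] := acts_family n a.1 a.2 _ (thetaP n a.1 a.2).
    exists S => //; apply: glue_ext H => j _; first by exists (c a j)%:~R.
    move=> s v; apply/esym.
    exact: (lobe_shift n a.2 j _ _ (c a j) (cmap_lift_lift a.1 j)).
  - by have [S [SE H]] := acts_family n p xs _ (thetaP n p xs); exists S.
suff th : (fun a : fMS n * Totp n => theta n a.1 a.2) @ U --> theta n p xs.
  exact: (th W nW).
apply: (tot_cvg UU) => k y_ y0 yc; apply: (ocvg_existT UU).
pose ms := (fun=> 0 : R, 0 : R) :: [seq (fun a => getc (set_val (y_ a)) r,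
  getc (set_val y0) r) | r <- iota 0 k].
have msv a : mval ms a = 0 :: coords (y_ a) by rewrite /mval /= -map_comp.
have msl : mlim ms = 0 :: coords y0 by rewrite /mlim /= -map_comp.
have cms : mcvg (F := U) ms.
  by split; [exact: rcvg_cst|exact: (coords_mcvg UU k y_ y0 yc)].
have vms : \forall a \near U, vl (mval ms a).
  by apply: nearW => a; rewrite msv; exact: coords_vl.
have := Gc ms cms vms; rewrite msl (tot_family0 HP) ?tot_base_coords; last exact: coords_vl.
apply: ocvg_ext; apply: nearW => a.
by rewrite msv (tot_family0 HP) ?tot_base_coords //; exact: coords_vl.
Qed.

End Action.

Theorem theorem7p7 (R : realType) (O : nat -> topologicalType)
    (P : cyc_op_mult O) :
  is_cyc_op_mult P ->
  exists theta : forall m : nat, @fMS R m -> Totpow P m -> TotT P,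
    fMS_algebra P theta.
Proof.
move=> HP.
pose theta m (p : @fMS R m) xs : TotT P := proj1_sig (cid (acts_exists HP m p xs)).
have thetaP m p xs : acts m p xs (theta m p xs) by exact: (proj2_sig (cid _)).
exists theta; split.
- exact: (theta_continuous HP thetaP).
- exact: (theta_unit HP thetaP).
- exact: (theta_equiv HP thetaP).
- exact: (theta_comp HP thetaP).
Qed.
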